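(* Let $x : M^n \rightarrow \mathbb{E}^{n+1}$ be an isometric immersion of a connected $n$-dimensional Riemannian manifold into Euclidean $(n+1)$-space. Then the Laplace map $L$ of $x$ satisfies $\operatorname{rank}(dL)\equiv 1$ on $M^n$ if and only if $M^n$ is locally a hypercylinder on a 3-regular (planar) curve.
   Context: Manifolds and immersions are smooth, of positive dimension, and manifolds are connected. $\Delta=-\operatorname{trace}\nabla^2$ is the Laplace operator of $M^n$. The Laplace map of $x$ is $L:M^n\to\mathbb{E}^{n+1}$, $L(p)=(\Delta x)(p)$ (applied componentwise to the position vector); by Beltrami's formula $L=-nH$, with $H=\frac1n\operatorname{trace}h$ the mean curvature vector. A 3-regular curve is a regular curve $\beta$ parametrized by arclength $s$ such that $\beta'''(s)$ is nowhere zero. A hypercylinder on a planar curve $\beta\subset\mathbb{E}^2$ is the product hypersurface $\beta\times\mathbb{E}^{n-1}\subset\mathbb{E}^2\times\mathbb{E}^{n-1}=\mathbb{E}^{n+1}$ (up to rigid motion), or an open part of it. *)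

(* Defs.v *)
From HB Require Import structures.
From mathcomp Require Import all_boot all_order all_algebra.
From mathcomp Require Import all_classical all_reals all_analysis.

Set Implicit Arguments.
Unset Strict Implicit.
Unset Printing Implicit Defensive.

Import Order.TTheory GRing.Theory Num.Theory.
Import numFieldNormedType.Exports.

Local Open Scope classical_set_scope.
Local Open Scope ring_scope.

(* The norm of 'rV[R]_n in the library is the sup norm (same topology); the
   Euclidean structure is given by [dotv].  Differentials act on row vectors by
   right multiplication: 'd f p v = v *m 'J f p. *)
Definition dotv (R : realType) (n : nat) (u v : 'rV[R]_n) : R :=
  \sum_(i < n) u 0 i * v 0 i.

(* C^k on an open subset [A] of a finite-dimensional space; for such domains
   continuity of all the directional derivatives x |-> 'D_v f x is continuity
   of the differential. *)
Fixpoint Ck_on (R : realType) (V W : normedModType R) (k : nat) (A : set V)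
    (f : V -> W) : Prop :=
  if k is k'.+1 then
    (forall u, A u -> differentiable f u) /\
    (forall v : V, Ck_on k' A (fun u => 'D_v f u))
  else forall u, A u -> {for u, continuous f}.

Definition smooth_on (R : realType) (V W : normedModType R) (A : set V)
  (f : V -> W) : Prop := forall k, Ck_on k A f.

Definition partial (R : realType) (n : nat) (W : normedModType R) (i : 'I_n)
  (f : 'rV[R]_n -> W) (u : 'rV[R]_n) : W := 'D_(delta_mx 0 i) f u.

(* A homeomorphism from an open subset of M onto an open subset of R^n; values
   of [chart_map] outside [chart_dom], and of [chart_inv] outside [chart_img],
   are irrelevant. *)
Record chart (R : realType) (M : topologicalType) (n : nat) := Chart {
  chart_dom : set M;
  chart_map : M -> 'rV[R]_n;
  chart_inv : 'rV[R]_n -> M;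
  chart_dom_open : open chart_dom;
  chart_img_open : open (chart_map @` chart_dom);
  chart_mapK : forall p, chart_dom p -> chart_inv (chart_map p) = p;
  chart_map_continuous : forall p, chart_dom p -> {for p, continuous chart_map};
  chart_inv_continuous : forall u, (chart_map @` chart_dom) u ->
    {for u, continuous chart_inv} }.

Definition chart_img (R : realType) (M : topologicalType) (n : nat)
  (c : chart R M n) : set 'rV[R]_n := chart_map c @` chart_dom c.

Definition transition (R : realType) (M : topologicalType) (n : nat)
  (c d : chart R M n) : 'rV[R]_n -> 'rV[R]_n := chart_map d \o chart_inv c.

Definition compatible (R : realType) (M : topologicalType) (n : nat)
    (c d : chart R M n) : Prop :=
  smooth_on (chart_map c @` (chart_dom c `&` chart_dom d)) (transition c d) /\
  smooth_on (chart_map d @` (chart_dom c `&` chart_dom d)) (transition d c).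

Record smooth_structure (R : realType) (M : topologicalType) (n : nat) :=
  SmoothStructure {
  atlas : set (chart R M n);
  atlas_cover : forall p : M, exists2 c, atlas c & chart_dom c p;
  atlas_compatible : forall c d, atlas c -> atlas d -> compatible c d;
  manifold_hausdorff : hausdorff_space M;
  manifold_second_countable : @second_countable M }.

Definition chart_at (R : realType) (M : topologicalType) (n : nat)
  (S : smooth_structure R M n) (p : M) : chart R M n :=
  projT1 (cid2 (atlas_cover S p)).

Definition smooth_map (R : realType) (M : topologicalType) (n : nat)
    (S : smooth_structure R M n) (W : normedModType R) (f : M -> W) : Prop :=
  forall c, atlas S c -> smooth_on (chart_img c) (f \o chart_inv c).

Definition diff_rank (R : realType) (M : topologicalType) (n k : nat)
    (S : smooth_structure R M n) (f : M -> 'rV[R]_k) (p : M) : nat :=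
  let c := chart_at S p in \rank ('J (f \o chart_inv c) (chart_map c p)).

Definition immersion (R : realType) (M : topologicalType) (n k : nat)
    (S : smooth_structure R M n) (x : M -> 'rV[R]_k) : Prop :=
  smooth_map S x /\ forall p, diff_rank S x p = n.

(* [metric c u] is the Gram matrix of the coordinate frame of the chart c at
   the point of coordinates u. *)
Record riemannian_metric (R : realType) (M : topologicalType) (n : nat)
    (S : smooth_structure R M n) := RiemannianMetric {
  metric : chart R M n -> 'rV[R]_n -> 'M[R]_n;
  metric_smooth : forall c, atlas S c -> smooth_on (chart_img c) (metric c);
  metric_sym : forall c u, atlas S c -> chart_img c u ->
    (metric c u)^T = metric c u;
  metric_pos : forall c u, atlas S c -> chart_img c u ->
    forall v : 'rV[R]_n, v != 0 -> 0 < dotv (v *m metric c u) v;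
  metric_transition : forall c d p, atlas S c -> atlas S d ->
    chart_dom c p -> chart_dom d p ->
    let J := 'J (transition c d) (chart_map c p) in
    metric c (chart_map c p) = J *m metric d (chart_map d p) *m J^T }.

Definition isometric (R : realType) (M : topologicalType) (n k : nat)
    (S : smooth_structure R M n) (g : riemannian_metric S)
    (x : M -> 'rV[R]_k) : Prop :=
  forall c u, atlas S c -> chart_img c u ->
    forall v w : 'rV[R]_n,
      dotv ('d (x \o chart_inv c) u v) ('d (x \o chart_inv c) u w) =
      dotv (v *m metric g c u) w.

(* Christoffel symbol Gamma^k_ij of the Levi-Civita connection of the metric
   with component matrix G. *)
Definition christoffel (R : realType) (n : nat) (G : 'rV[R]_n -> 'M[R]_n)
    (k i j : 'I_n) (u : 'rV[R]_n) : R :=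
  2^-1 * \sum_(l < n) invmx (G u) k l *
    (partial i (fun w => G w j l) u + partial j (fun w => G w i l) u
     - partial l (fun w => G w i j) u).

Definition hessian (R : realType) (n : nat) (G : 'rV[R]_n -> 'M[R]_n)
    (f : 'rV[R]_n -> R) (i j : 'I_n) (u : 'rV[R]_n) : R :=
  partial i (partial j f) u
  - \sum_(k < n) christoffel G k i j u * partial k f u.

(* Delta = - trace nabla^2; the value does not depend on the chart. *)
Definition laplacian (R : realType) (M : topologicalType) (n : nat)
    (S : smooth_structure R M n) (g : riemannian_metric S) (f : M -> R)
    (p : M) : R :=
  let c := chart_at S p in
  let u := chart_map c p in
  - \sum_(i < n) \sum_(j < n)
      invmx (metric g c u) i j * hessian (metric g c) (f \o chart_inv c) i j u.

Definition laplace_map (R : realType) (M : topologicalType) (n k : nat)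
    (S : smooth_structure R M n) (g : riemannian_metric S)
    (x : M -> 'rV[R]_k) (p : M) : 'rV[R]_k :=
  \row_a laplacian g (fun q => x q 0 a) p.

Definition three_regular (R : realType) (k : nat) (I : set R)
    (beta : R -> 'rV[R]_k) : Prop :=
  [/\ open I, is_interval I, smooth_on I beta,
      (forall s, I s -> dotv (derive1n 1 beta s) (derive1n 1 beta s) = 1) &
      (forall s, I s -> derive1n 3 beta s != 0)].

(* The immersion (s, t) |-> (beta s, t) of I x E^m into E^2 x E^m. *)
Definition hypercylinder (R : realType) (m : nat) (beta : R -> 'rV[R]_2)
    (u : 'rV[R]_(1 + m)) : 'rV[R]_(2 + m) :=
  row_mx (beta (u 0 0)) (rsubmx u).

Definition rigid_motion (R : realType) (k : nat) (T : 'rV[R]_k -> 'rV[R]_k) :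
    Prop :=
  exists (Q : 'M[R]_k) (b : 'rV[R]_k),
    Q *m Q^T = 1%:M /\ forall y, T y = y *m Q + b.

(* Around each point, x is, up to a rigid motion and up to a diffeomorphism psi
   of the source, the restriction of a hypercylinder immersion to an open subset
   of I x E^m; psi is a chart compatible with the smooth structure. *)
Definition locally_hypercylinder (R : realType) (M : topologicalType) (m : nat)
    (S : smooth_structure R M (1 + m)) (x : M -> 'rV[R]_(2 + m)) : Prop :=
  forall p : M,
    exists (I : set R) (beta : R -> 'rV[R]_2) (T : 'rV[R]_(2 + m) -> 'rV[R]_(2 + m))
           (psi : chart R M (1 + m)),
      [/\ three_regular I beta, rigid_motion T,
          (forall c, atlas S c -> compatible c psi),
          chart_dom psi p &
          forall q, chart_dom psi q ->
            I (chart_map psi q 0 0) /\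
            x q = T (hypercylinder beta (chart_map psi q))].

(* Main.v *)
(** Let X be the immersion read in a chart, J its Jacobian, G = J J^T.
  The Laplace map is minus the normal component of sum_ij G^ij d_ij X, hence
  invariant under changes of coordinates and equivariant under rigid motions.
  For a hypercylinder over an arclength curve beta it equals - beta'', so its
  rank is 1 exactly where beta''' <> 0, which gives one direction.

  Conversely, near a point X is, after a rotation, the graph of a function f
  with vanishing gradient at that point, and L = - q N with N = (- grad f, 1)
  and q the trace of the Hessian in the inverse metric, divided by
  W = 1 + |grad f|^2.  Column operations turn rank dL = 1 into: the matrix
  [q Hess f | grad q] has rank 1.  Zeros of q are harmless: there grad q <> 0,
  so an identity q h = 0 can be differentiated to h = 0.  Thus
  Hess f = la r r^T and grad q = mu r.  Symmetry of the third derivatives of f,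
  and comparison with grad q, give q dr = 0, hence r is constant and f depends
  on one linear coordinate only; the arclength of its profile is the first
  coordinate of the required chart. *)

From HB Require Import structures.
Require Import Defs.
From mathcomp Require Import all_boot all_order all_algebra.
From mathcomp Require Import all_classical all_reals all_analysis.
From mathcomp Require Import ring lra.

Set Implicit Arguments.
Unset Strict Implicit.
Unset Printing Implicit Defensive.

Import Order.TTheory GRing.Theory Num.Theory.
Import numFieldNormedType.Exports.

Local Open Scope classical_set_scope.
Local Open Scope ring_scope.

(** * Differential calculus of C^k maps *)

Section Differentials.
Context {R : realType}.
Implicit Types V W : normedModType R.

(** A Hessian of rank at most one only says that the graph is developable, and cones and tangent
    developables share that property. What excludes them is that q is constant along the rulings.
    For Hess f = la r r^T one has W^2 q = la P, where P = W |r|^2 - (grad f . r)^2 is positive by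
    Cauchy-Schwarz. Along the kernel of r the quantities q, grad f and, where la <> 0, r are
    stationary, hence so is la; but the symmetry of the third derivatives makes the derivative of la
    along this kernel equal to la times a derivative of r. The obstacle throughout is that q may
    vanish, at inflections of the profile: the direction r is then not given by the Hessian, and the
    identities come with factors q to be cancelled. The graph is taken over a tangent hyperplane
    because the form of Hess f determines f only up to an affine function; the vanishing gradient
    removes the linear part. The 3-regularity of the profile is obtained last, by reading the rank
    formula for hypercylinders backwards. *)

Lemma differentiable_eps V W (f : V -> W) x : differentiable f x ->
  forall e, 0 < e -> \forall h \near (0 : V),
    `|f (h + x) - f x - 'd f x h| <= e * `|h|.
Proof.
move=> /diff_locallyP[_ fE] e e0.
have /eqaddoP /(_ e e0) := fE.
apply: filterS => h /=.
by rewrite -[(_ - (_ + _)) _]/(f (h + x) - (f x + 'd f x h)) opprD addrA.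
Qed.

Lemma eps_is_diff V W (f : V -> W) x (df : {linear V -> W}) : continuous df ->
  (forall e, 0 < e -> \forall h \near (0 : V),
    `|f (h + x) - f x - df h| <= e * `|h|) -> is_diff x f df.
Proof.
move=> cdf H.
have fE : f \o shift x = cst (f x) + df +o_ 0 id.
  apply/eqaddoP => e e0; near=> h.
  rewrite -[(_ - (_ + _)) _]/(f (h + x) - (f x + df h)) opprD addrA.
  by near: h; exact: H.
have dE : 'd f x = df :> (V -> W) by exact: diff_unique.
split=> //; apply/diff_locallyP; rewrite dE.
by split => // y; apply: cdf.
Unshelve. all: by end_near. Qed.

Lemma near_eq_is_diff V W (f g : V -> W) x : {near x, f =1 g} ->
  differentiable f x -> is_diff x g ('d f x).
Proof.
move=> fg df; apply: eps_is_diff => [|e e0]; first exact: diff_continuous.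
have fg0 : \forall h \near (0 : V), f (h + x) = g (h + x).
  by move: fg; rewrite (near_shift 0) /= subr0.
have fgx : f x = g x by exact: (nbhs_singleton fg).
near=> h; rewrite -fgx -(near fg0 h)//.
by near: h; exact: differentiable_eps.
Unshelve. all: by end_near. Qed.

Lemma near_eq_differentiable V W (f g : V -> W) x : {near x, f =1 g} ->
  differentiable f x -> differentiable g x.
Proof. by move=> fg /(near_eq_is_diff fg) [+ _]. Qed.

Lemma differentiable_mxP V m n (M : V -> 'M[R]_(m, n)) t :
  differentiable M t <-> forall i j, differentiable (fun x => M x i j) t.
Proof.
split=> [dM i j|H].
  by apply: (@differentiable_comp _ _ _ _ M (fun N : 'M[R]_(m, n) => N i j)) => //;
     exact: differentiable_coord.
have -> : M = \sum_(i < m) \sum_(j < n) (fun x => M x i j *: delta_mx i j).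
  apply/funext => x; rewrite fct_sumE.
  rewrite [LHS]matrix_sum_delta; apply: eq_bigr => i _.
  by rewrite fct_sumE.
apply: differentiable_sum => i; apply: differentiable_sum => j.
by apply: differentiableZl.
Qed.

Lemma derive_coord V m n (M : V -> 'M[R]_(m, n)) t v i j :
  differentiable M t -> ('D_v M t) i j = 'D_v (fun x => M x i j) t.
Proof. by move=> dM; rewrite derive_mx ?mxE//; exact: diff_derivable. Qed.

Lemma continuous_mxP (T : topologicalType) m n (M : T -> 'M[R]_(m, n)) t :
  {for t, continuous M} <-> forall i j, {for t, continuous (fun x => M x i j)}.
Proof.
split=> [cM i j|H].
  apply: (@continuous_comp _ _ _ M (fun N : 'M[R]_(m, n) => N i j)) => //.
  exact: coord_continuous.
apply/cvgrPdist_le => /= e e0; near=> x.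
rewrite /Num.Def.normr/= mx_normrE (bigmax_le _ (ltW e0))//= => i _.
rewrite !mxE/=; move: i; near: x; apply: filter_forall => /= i.
exact: ((cvgrPdist_le _ _).1 (H i.1 i.2)).
Unshelve. all: by end_near. Qed.

Lemma derive_compR V n (f : V -> 'rV[R]_n) (g : 'rV[R]_n -> R) x v :
  differentiable f x -> differentiable g (f x) ->
  'D_v (g \o f) x = \sum_(j < n) ('D_v f x) 0 j * partial j g (f x).
Proof.
move=> df dg; rewrite deriveE; last exact: differentiable_comp.
rewrite diff_comp //= -(deriveE v df) [in LHS](row_sum_delta ('D_v f x)) linear_sum.
by apply: eq_bigr => j _; rewrite linearZ /= /partial (deriveE _ dg).
Qed.

Lemma derive_comp1 V (f : V -> R) (g : R -> R) x v :
  differentiable f x -> differentiable g (f x) ->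
  'D_v (g \o f) x = 'D_v f x * 'D_1 g (f x).
Proof.
move=> df dg; rewrite deriveE; last exact: differentiable_comp.
rewrite diff_comp //= -(deriveE v df) -[in LHS](mulr1 ('D_v f x)).
by rewrite -[_ * 1]/(_ *: (1 : R)) linearZ /= -(deriveE _ dg).
Qed.

End Differentials.

(** * Closure properties of C^k maps *)

Section Ck.
Context {R : realType}.
Implicit Types V W : normedModType R.

Lemma Ck_on_pred k V W (A : set V) (f : V -> W) :
  Ck_on k.+1 A f -> Ck_on k A f.
Proof.
elim: k f => [|k IH] f [df Df].
  by move=> u Au; apply: differentiable_continuous; exact: df.
by split=> // v; apply: IH; exact: Df.
Qed.

Lemma Ck_on_sub k V W (A B : set V) (f : V -> W) :
  A `<=` B -> Ck_on k B f -> Ck_on k A f.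
Proof.
move=> AB; elim: k f => [|k IH] f /=; first by move=> H u /AB /H.
by move=> [H1 H2]; split=> [u /AB /H1 //|v]; exact: IH.
Qed.

(** [Ck_on] speaks of derivatives of maps defined on the whole space, so equality on [A] passes to
    derivatives only because [A] is open. The closure lemmas below use this to replace a derivative,
    on [A], by the formula that the product or chain rule gives for it. *)
Lemma Ck_on_eq k V W (A : set V) (f g : V -> W) : open A ->
  (forall u, A u -> f u = g u) -> Ck_on k A f -> Ck_on k A g.
Proof.
move=> oA; elim: k f g => [|k IH] f g fg.
  move=> Hf u Au; have fgu : {near u, f =1 g}.
    by apply: filterS (open_nbhs_nbhs (conj oA Au)).
  rewrite /prop_for /continuous_at -(fg u Au); apply: cvg_trans (Hf u Au).
  exact: near_eq_cvg.
have fgu u : A u -> {near u, f =1 g}.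
  by move=> Au; apply: filterS (open_nbhs_nbhs (conj oA Au)).
move=> [H1 H2]; split=> [u Au|v].
  exact: near_eq_differentiable (fgu u Au) (H1 u Au).
by apply: IH (H2 v) => u Au; apply: near_eq_derive; exact: fgu.
Qed.

Lemma Ck_on_cst k V W (A : set V) (c : W) : Ck_on k A (fun=> c).
Proof.
elim: k c => [|k IH] c; first by move=> u _; exact: cst_continuous.
split=> [u _|v]; first exact: differentiable_cst.
have -> : 'D_v (fun=> c) = (fun=> 0) :> (V -> W); last exact: IH.
by apply/funext => u; exact: derive_cst.
Qed.

Lemma Ck_on_linear k V W (A : set V) (f : {linear V -> W}) :
  continuous f -> Ck_on k A f.
Proof.
case: k => [|k] cf; first by move=> u _; exact: cf.
split=> [u _|v]; first exact: linear_differentiable.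
have -> : 'D_v f = (fun=> f v) :> (V -> W); last exact: Ck_on_cst.
apply/funext => u; rewrite deriveE; last exact: linear_differentiable.
by rewrite diff_lin.
Qed.

Lemma Ck_on_id k V (A : set V) : Ck_on k A id.
Proof. by apply: (@Ck_on_linear k V V A idfun) => x; exact: cvg_id. Qed.

Lemma Ck_onD k V W (A : set V) (f g : V -> W) : open A ->
  Ck_on k A f -> Ck_on k A g -> Ck_on k A (fun u => f u + g u).
Proof.
move=> oA; elim: k f g => [|k IH] f g /=.
  by move=> Hf Hg u Au; apply: cvgD; [exact: Hf|exact: Hg].
move=> [f1 f2] [g1 g2]; split=> [u Au|v].
  by apply: differentiableD; [exact: f1|exact: g1].
apply: Ck_on_eq (IH _ _ (f2 v) (g2 v)) => // u Au.
by rewrite deriveD//; apply: diff_derivable; [exact: f1|exact: g1].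
Qed.

Lemma Ck_onN k V W (A : set V) (f : V -> W) : open A ->
  Ck_on k A f -> Ck_on k A (fun u => - f u).
Proof.
move=> oA; elim: k f => [|k IH] f /=.
  by move=> Hf u Au; apply: cvgN; exact: Hf.
move=> [f1 f2]; split=> [u Au|v].
  by apply: differentiableN; exact: f1.
apply: Ck_on_eq (IH _ (f2 v)) => // u Au.
by rewrite deriveN//; apply: diff_derivable; exact: f1.
Qed.

Lemma Ck_onB k V W (A : set V) (f g : V -> W) : open A ->
  Ck_on k A f -> Ck_on k A g -> Ck_on k A (fun u => f u - g u).
Proof. by move=> oA Hf Hg; apply: Ck_onD => //; exact: Ck_onN. Qed.

Lemma Ck_on_sum k V W (A : set V) (I : Type) (r : seq I) (P : pred I)
    (f : I -> V -> W) : open A -> (forall i, P i -> Ck_on k A (f i)) ->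
  Ck_on k A (fun u => \sum_(i <- r | P i) f i u).
Proof.
move=> oA Hf; elim: r => [|i r IH].
  by rewrite (_ : (fun u => _) = fun=> 0);
    [exact: Ck_on_cst|apply/funext => u; rewrite big_nil].
case Pi : (P i); last first.
  by rewrite (_ : (fun u => _) = fun u => \sum_(j <- r | P j) f j u) //;
    apply/funext => u; rewrite big_cons Pi.
rewrite (_ : (fun u => _) = fun u => f i u + \sum_(j <- r | P j) f j u).
  by apply: Ck_onD => //; exact: Hf.
by apply/funext => u; rewrite big_cons Pi.
Qed.

Lemma Ck_onM k V (A : set V) (f g : V -> R) : open A ->
  Ck_on k A f -> Ck_on k A g -> Ck_on k A (fun u => f u * g u).
Proof.
move=> oA; elim: k f g => [|k IH] f g.
  by move=> Hf Hg u Au; apply: cvgM; [exact: Hf|exact: Hg].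
move=> Hf Hg; move: (Hf) (Hg) => [f1 f2] [g1 g2]; split=> [u Au|v].
  by apply: differentiableM; [exact: f1|exact: g1].
apply: (@Ck_on_eq _ _ _ _ (fun u => f u * 'D_v g u + g u * 'D_v f u)) => //.
  move=> u Au; rewrite -[RHS]/('D_v (f * g) u) deriveM//.
    by apply: diff_derivable; exact: f1.
  by apply: diff_derivable; exact: g1.
apply: Ck_onD => //; apply: IH => //; first [exact: Ck_on_pred|exact: f2|exact: g2].
Qed.

Lemma Ck_on_mxP k V m n (A : set V) (M : V -> 'M[R]_(m, n)) : open A ->
  Ck_on k A M <-> forall i j, Ck_on k A (fun u => M u i j).
Proof.
move=> oA; elim: k M => [|k IH] M /=.
  split=> [H i j u Au|H u Au]; first exact: ((continuous_mxP _ _).1 (H u Au)).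
  by apply/continuous_mxP => i j; exact: H.
split=> [[M1 M2] i j|H].
  split=> [u Au|v]; first exact: ((differentiable_mxP _ _).1 (M1 u Au)).
  apply: Ck_on_eq ((IH _).1 (M2 v) i j) => // u Au.
  by rewrite derive_coord//; exact: M1.
have dM u : A u -> differentiable M u.
  by move=> Au; apply/differentiable_mxP => i j; exact: (H i j).1.
split=> // v; apply/IH => i j.
by apply: Ck_on_eq ((H i j).2 v) => // u Au; rewrite derive_coord//; exact: dM.
Qed.

(** With a scalar [g] the chain rule turns the derivative into a sum of products, to which [Ck_onM]
    applies; the factor [partial j g \o f] is covered by the induction hypothesis, with [f] taken
    one order lower. *)
Lemma Ck_on_compR k V n (A : set V) (B : set 'rV[R]_n) (f : V -> 'rV[R]_n)
    (g : 'rV[R]_n -> R) : open A -> (forall u, A u -> B (f u)) ->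
  Ck_on k A f -> Ck_on k B g -> Ck_on k A (g \o f).
Proof.
move=> oA AB; elim: k g => [|k IH] g.
  by move=> Hf Hg u Au; apply: continuous_comp; [exact: Hf|apply: Hg; exact: AB].
move=> Hf; move: (Hf) => [f1 f2] [g1 g2]; split=> [u Au|v].
  by apply: differentiable_comp; [exact: f1|apply: g1; exact: AB].
apply: (@Ck_on_eq _ _ _ _
  (fun u => \sum_(j < n) ('D_v f u) 0 j * (partial j g \o f) u)) => //.
  by move=> u Au; rewrite derive_compR//; [exact: f1|apply: g1; exact: AB].
apply: Ck_on_sum => // j _; apply: Ck_onM => //.
  exact: ((Ck_on_mxP _ _ oA).1 (f2 v)).
by apply: IH; [exact: Ck_on_pred|exact: g2].
Qed.

Lemma Ck_on_comp k V n p q (A : set V) (B : set 'rV[R]_n) (f : V -> 'rV[R]_n)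
    (g : 'rV[R]_n -> 'M[R]_(p, q)) : open A -> open B ->
    (forall u, A u -> B (f u)) ->
  Ck_on k A f -> Ck_on k B g -> Ck_on k A (g \o f).
Proof.
move=> oA oB AB Hf Hg; apply/(Ck_on_mxP _ _ oA) => i j.
apply: (@Ck_on_compR k V n A B f (fun w => g w i j)) => //.
exact: ((Ck_on_mxP _ _ oB).1 Hg).
Qed.

Lemma Ck_on_comp1 k V (A : set V) (B : set R) (f : V -> R) (g : R -> R) :
  open A -> (forall u, A u -> B (f u)) ->
  Ck_on k A f -> Ck_on k B g -> Ck_on k A (g \o f).
Proof.
move=> oA AB; elim: k g => [|k IH] g.
  by move=> Hf Hg u Au; apply: continuous_comp; [exact: Hf|apply: Hg; exact: AB].
move=> Hf; move: (Hf) => [f1 f2] [g1 g2]; split=> [u Au|v].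
  by apply: differentiable_comp; [exact: f1|apply: g1; exact: AB].
apply: (@Ck_on_eq _ _ _ _ (fun u => 'D_v f u * ('D_1 g \o f) u)) => //.
  by move=> u Au; rewrite derive_comp1//; [exact: f1|apply: g1; exact: AB].
apply: Ck_onM => //; first exact: f2.
by apply: IH; [exact: Ck_on_pred|exact: g2].
Qed.

(** The derivative is a polynomial in the inverse itself and in the derivative of [f]; the inverse
    is already known to be C^k when C^(k+1) is to be proved. *)
Lemma Ck_onV k V (A : set V) (f : V -> R) : open A ->
  (forall u, A u -> f u != 0) -> Ck_on k A f -> Ck_on k A (fun u => (f u)^-1).
Proof.
move=> oA f0; elim: k => [|k IH].
  by move=> Hf u Au; apply: cvgV; [exact: f0|exact: Hf].
move=> Hf; move: (Hf) => [f1 f2]; split=> [u Au|v].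
  by apply: differentiableV; [exact: f1|exact: f0].
have IH' := IH (Ck_on_pred Hf).
apply: (@Ck_on_eq _ _ _ _ (fun u => - ((f u)^-1 * (f u)^-1 * 'D_v f u))) => //.
  move=> u Au; rewrite deriveV ?f0//; last by apply: diff_derivable; exact: f1.
  by rewrite -[RHS]/(- _ * _) -exprVn mulNr expr2.
apply: Ck_onN => //; apply: Ck_onM => //; last exact: f2.
exact: Ck_onM.
Qed.

Lemma Ck_on_sqrt k V (A : set V) (f : V -> R) : open A ->
  (forall u, A u -> 0 < f u) -> Ck_on k A f ->
  Ck_on k A (fun u => Num.sqrt (f u)).
Proof.
move=> oA f0 Hf.
apply: (@Ck_on_comp1 k V A [set x | 0 < x] f) => //.
(* Same scheme on the half-line: the derivative is the inverse of twice the square root, of class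
   C^k by induction. *)
elim: k {Hf} => [|k IH]; first by move=> u _; exact: sqrt_continuous.
have ds (u : R) : 0 < u -> is_derive u 1 Num.sqrt ((2 * Num.sqrt u)^-1).
  exact: is_derive1_sqrt.
split=> [u u0|v].
  apply/derivable1_diffP; exact: (@ex_derive _ _ _ _ _ _ _ (ds u u0)).
have oP : open [set x : R | 0 < x].
  by rewrite (_ : [set x | 0 < x] = `]0, +oo[%classic) ?set_itvoy//;
    exact: interval_open.
apply: (@Ck_on_eq _ _ _ _ (fun u => v * (2 * Num.sqrt u)^-1)) => //.
  move=> u u0; have [d D] := ds u u0.
  rewrite -D [in RHS]deriveE; last exact/derivable1_diffP.
  rewrite -[in RHS](mulr1 v) -[v * 1]/(v *: (1 : R)) linearZ /=.
  by rewrite -deriveE//; exact/derivable1_diffP.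
apply: Ck_onM => //; first exact: Ck_on_cst.
apply: Ck_onV => //; first by move=> u u0; rewrite mulf_neq0// gt_eqF// sqrtr_gt0.
by apply: Ck_onM => //; exact: Ck_on_cst.
Qed.

End Ck.

(** * Mean value theorem and symmetry of second derivatives *)

Section MeanValue.
Context {R : realType}.
Implicit Types V W : normedModType R.

Lemma linear_rV_continuous n W (f : {linear 'rV[R]_n -> W}) : continuous f.
Proof.
have fE : f = \sum_(j < n) (fun v : 'rV[R]_n => v 0 j *: f 'e_j) :> (_ -> _).
  apply/funext => v; rewrite fct_sumE [in LHS](row_sum_delta v) linear_sum.
  by apply: eq_bigr => j _; rewrite linearZ.
move=> v; apply: differentiable_continuous; move: fE => ->.
by apply: differentiable_sum => j; apply: differentiableZl;
  exact: differentiable_coord.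
Qed.

Lemma is_derive_line V W (f : V -> W) (x v : V) (t : R) :
  differentiable f (x + t *: v) ->
  is_derive t 1 (fun s : R => f (x + s *: v)) ('D_v f (x + t *: v)).
Proof.
move=> df.
have dl : is_diff t (fun s : R => x + s *: v) (fun s => s *: v).
  have -> : (fun s => s *: v) = 0 + (fun s : R => s *: v) by rewrite add0r.
  by apply: (@is_diffD _ _ _ (cst x) (fun s : R => s *: v)).
have d : differentiable (f \o (fun s : R => x + s *: v)) t.
  by apply: differentiable_comp.
split; first by apply: diff_derivable.
rewrite -[LHS]/('D_1 (f \o (fun s : R => x + s *: v)) t) deriveE //.
by rewrite diff_comp //= deriveE // diff_val scale1r.
Qed.

Lemma mean_value V (f : V -> R) (x v : V) (h : R) : 0 < h ->
  (forall t, 0 <= t <= h -> differentiable f (x + t *: v)) ->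
  exists2 t, 0 < t < h & f (x + h *: v) - f x = h * 'D_v f (x + t *: v).
Proof.
move=> h0 df.
have [||t th] := @MVT R (fun s : R => f (x + s *: v))
   (fun s => 'D_v f (x + s *: v)) 0 h h0.
- move=> t; rewrite in_itv/= => /andP[t0 th].
  by apply: is_derive_line; apply: df; rewrite !ltW.
- apply: derivable_within_continuous => t; rewrite in_itv/= => tI.
  by have [] := @is_derive_line _ _ f x v t (df t tI).
- rewrite scale0r addr0 subr0 => ->; exists t; first by rewrite in_itv/= in th.
  by rewrite mulrC.
Qed.

Lemma mean_value1 V (f : V -> R) (x y : V) :
  (forall t, 0 <= t <= 1 -> differentiable f (x + t *: (y - x))) ->
  exists2 t, 0 < t < 1 & f y - f x = 'D_(y - x) f (x + t *: (y - x)).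
Proof.
move=> /(mean_value ltr01) [t t01]; rewrite scale1r mul1r (addrC x) subrK.
by exists t.
Qed.

Lemma ball_segment V (c : V) r x y t : ball c r x -> ball c r y ->
  0 <= t <= 1 -> ball c r (x + t *: (y - x)).
Proof.
rewrite -!ball_normE /ball_ /= => cx cy /andP[t0 t1].
have -> : c - (x + t *: (y - x)) = (1 - t) *: (c - x) + t *: (c - y).
  rewrite scalerBl scale1r -addrA -scalerN -scalerDr opprB addrA subrK.
  by rewrite opprD addrA -[in LHS]scalerN opprB.
apply: le_lt_trans (ler_normD _ _) _; rewrite !normrZ.
rewrite (ger0_norm t0) (ger0_norm (_ : 0 <= 1 - t)) ?subr_ge0//.
(* The strict inequality comes from the term in [y], which has weight [t]; hence the separate case
   [t = 0]. *)
have [->|t0'] := eqVneq t 0; first by rewrite subr0 mul0r addr0 mul1r.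
have : t * `|c - y| < t * r by rewrite ltr_pM2l// lt_neqAle eq_sym t0'.
have : (1 - t) * `|c - x| <= (1 - t) * r.
  by rewrite ler_wpM2l ?subr_ge0// ltW.
lra.
Qed.

Lemma derive0_const_ball V (f : V -> R) c r :
  (forall u, ball c r u -> differentiable f u) ->
  (forall u v, ball c r u -> 'D_v f u = 0) ->
  forall x y, ball c r x -> ball c r y -> f x = f y.
Proof.
move=> df Df x y cx cy; apply/eqP; rewrite eq_sym -subr_eq0.
have [t t01|t /andP[t0 t1] ->] := @mean_value1 _ f x y.
  by apply: df; exact: ball_segment.
by apply/eqP; apply: Df; apply: ball_segment => //; rewrite !ltW.
Qed.

(** Two mean values: one for the increment [g] of [f] in direction [w], moved along [v], then one
    for ['D_v f] along [w]. *)
Lemma second_difference V (f : V -> R) c r u v w h :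
  (forall z, ball c r z -> differentiable f z) ->
  (forall z, ball c r z -> differentiable ('D_v f) z) -> 0 < h ->
  (forall s t, 0 <= s <= h -> 0 <= t <= h -> ball c r (u + s *: v + t *: w)) ->
  exists2 z, ball c r z &
    f (u + h *: v + h *: w) - f (u + h *: v) - f (u + h *: w) + f u =
    h * h * 'D_w ('D_v f) z.
Proof.
move=> df ddf h0 H.
have H0 s : 0 <= s <= h -> ball c r (u + s *: v).
  by move=> sh; have := H s 0 sh; rewrite scale0r addr0; apply; rewrite lexx ltW.
have Hw s : 0 <= s <= h -> ball c r (u + h *: w + s *: v).
  by move=> sh; have := H s h sh; rewrite addrAC; apply; rewrite lexx ltW.
pose g z := f (z + h *: w) - f z.
have dsh z : is_diff z (shift (h *: w) : V -> V) id.
  have -> : id = id + 0 :> (V -> V) by rewrite addr0.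
  by apply: (@is_diffD _ _ _ id (cst (h *: w)) id (cst 0)).
have dg z : ball c r z -> ball c r (z + h *: w) ->
    differentiable g z /\ 'D_v g z = 'D_v f (z + h *: w) - 'D_v f z.
  move=> cz czw.
  have d1 : differentiable (f \o shift (h *: w)) z.
    by apply: differentiable_comp => //; exact: df.
  have d2 := df z cz.
  split; first by apply: differentiableB.
  rewrite -[LHS]/('D_v (f \o shift (h *: w) - f) z) deriveB; last 2 first.
  - exact: diff_derivable.
  - exact: diff_derivable.
  congr (_ - _); rewrite deriveE// diff_comp //=; last exact: df.
  by rewrite diff_val -(deriveE _ (df _ czw)).
have [s sh|s /andP[s0 sh] gE] := @mean_value _ g u v h h0.
  by apply: (dg _ _ _).1; [exact: H0|rewrite addrAC; exact: Hw].
have sh' : 0 <= s <= h by rewrite !ltW.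
have [|t th DE] := @mean_value _ ('D_v f) (u + s *: v) w h h0.
  by move=> t th; apply: ddf; apply: H.
exists (u + s *: v + t *: w).
  by apply: H => //; case/andP: th => *; rewrite !ltW.
rewrite -mulrA -DE -(dg _ _ _).2; [|exact: H0|by rewrite addrAC; exact: Hw].
by rewrite -gE /g opprB addrA [in RHS]addrAC.
Qed.

(** The second difference is symmetric in [v] and [w], so one mixed derivative at a point [z1]
    equals the other at a point [z2], both as close to [u] as desired; continuity at [u]
    concludes. *)
Lemma Schwarz V (A : set V) (f : V -> R) u v w : open A -> A u ->
  Ck_on 2 A f -> 'D_v ('D_w f) u = 'D_w ('D_v f) u.
Proof.
move=> oA Au [d1 d2].
apply/eqP; rewrite -subr_eq0 -normr_le0; apply/ler_addgt0Pl => e e0.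
rewrite addr0.
have cf a b : \forall z \near u, `|'D_a ('D_b f) u - 'D_a ('D_b f) z| < e / 2.
  apply: ((cvgrPdist_lt _ _).1 ((d2 b).2 a u Au)); by rewrite divr_gt0.
have nA : nbhs u A by exact: open_nbhs_nbhs.
have : nbhs u (A `&` ([set z | `|'D_v ('D_w f) u - 'D_v ('D_w f) z| < e / 2]
    `&` [set z | `|'D_w ('D_v f) u - 'D_w ('D_v f) z| < e / 2])).
  by apply: filterI => //; apply: filterI; exact: cf.
case/nbhs_ballP => r /= r0 H.
(* Chosen so that h (|v| + |w|) < r, which keeps the parallelogram in the ball; the summand 1 guards
   against v = w = 0. *)
pose h := r / (2 * (1 + `|v| + `|w|)).
have N0 : 0 < 1 + `|v| + `|w| by rewrite !ltr_pwDl.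
have h0 : 0 < h by rewrite divr_gt0 ?mulr_gt0.
have bH a b s t : `|a| + `|b| = `|v| + `|w| -> 0 <= s <= h -> 0 <= t <= h ->
    ball u r (u + s *: a + t *: b).
  move=> ab /andP[s0 sh] /andP[t0 th].
  rewrite -ball_normE /ball_/= -addrA opprD addrA subrr add0r normrN.
  apply: le_lt_trans (ler_normD _ _) _; rewrite !normrZ !ger0_norm//.
  apply: (@le_lt_trans _ _ (h * (`|v| + `|w|))).
    by rewrite -ab mulrDr lerD// ler_wpM2r.
  rewrite /h -mulrA gtr_pMr// mulrC ltr_pdivrMr ?mulr_gt0//.
  have := normr_ge0 v; have := normr_ge0 w; lra.
have [z1 bz1 E1] := @second_difference _ f u r u v w h
  (fun z bz => d1 z (H z bz).1)
  (fun z bz => (d2 v).1 z (H z bz).1) h0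
  (fun s t => @bH v w s t erefl).
have [z2 bz2 E2] := @second_difference _ f u r u w v h
  (fun z bz => d1 z (H z bz).1)
  (fun z bz => (d2 w).1 z (H z bz).1) h0
  (fun s t => @bH w v s t (addrC _ _)).
have hh0 : h * h != 0 by rewrite mulf_neq0// gt_eqF.
have E : 'D_w ('D_v f) z1 = 'D_v ('D_w f) z2.
  have EE : h * h * 'D_w ('D_v f) z1 = h * h * 'D_v ('D_w f) z2.
    apply: etrans (esym E1) _; apply: etrans _ E2; congr (_ + _).
    rewrite (addrAC u (h *: v)); exact: addrAC.
  exact: (mulfI hh0 EE).
have [_ [/= _ B1]] := H z1 bz1; have [_ [/= B2 _]] := H z2 bz2.
move: B1 B2; rewrite E.
move: ('D_v ('D_w f) u) ('D_w ('D_v f) u) ('D_v ('D_w f) z2) => a b d B1 B2.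
by apply: le_trans (ler_distD d a b) _; rewrite [e]splitr (distrC d b) lerD ?ltW.
Qed.

End MeanValue.

(** * Inverse function theorem *)

Section CkMatrix.
Context {R : realType}.
Implicit Types V W : normedModType R.

Lemma Ck_on_prod k V (A : set V) (I : Type) (r : seq I) (P : pred I)
    (f : I -> V -> R) : open A -> (forall i, P i -> Ck_on k A (f i)) ->
  Ck_on k A (fun u => \prod_(i <- r | P i) f i u).
Proof.
move=> oA Hf; elim: r => [|i r IH].
  by rewrite (_ : (fun u => _) = fun=> 1);
    [exact: Ck_on_cst|apply/funext => u; rewrite big_nil].
case Pi : (P i); last first.
  by rewrite (_ : (fun u => _) = fun u => \prod_(j <- r | P j) f j u) //;
    apply/funext => u; rewrite big_cons Pi.
rewrite (_ : (fun u => _) = fun u => f i u * \prod_(j <- r | P j) f j u).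
  by apply: Ck_onM => //; exact: Hf.
by apply/funext => u; rewrite big_cons Pi.
Qed.

Lemma Ck_on_det k V n (A : set V) (M : V -> 'M[R]_n) : open A ->
  (forall i j, Ck_on k A (fun u => M u i j)) -> Ck_on k A (fun u => \det (M u)).
Proof.
move=> oA HM; apply: Ck_on_sum => // s _; apply: Ck_onM => //.
  exact: Ck_on_cst.
exact: Ck_on_prod.
Qed.

Lemma Ck_on_mulmx k V m n p (A : set V) (M : V -> 'M[R]_(m, n))
    (N : V -> 'M[R]_(n, p)) : open A ->
  Ck_on k A M -> Ck_on k A N -> Ck_on k A (fun u => M u *m N u).
Proof.
move=> oA /(Ck_on_mxP _ _ oA) HM /(Ck_on_mxP _ _ oA) HN.
apply/(Ck_on_mxP _ _ oA) => i j.
rewrite (_ : (fun u => _) = fun u => \sum_l M u i l * N u l j).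
  by apply: Ck_on_sum => // l _; exact: Ck_onM.
by apply/funext => u; rewrite mxE.
Qed.

(** Cramer's rule: on [A] the entries of the inverse are cofactors divided by the determinant. *)
Lemma Ck_on_invmx k V n (A : set V) (M : V -> 'M[R]_n) : open A ->
  (forall u, A u -> M u \in unitmx) -> Ck_on k A M ->
  Ck_on k A (fun u => invmx (M u)).
Proof.
move=> oA uM /(Ck_on_mxP _ _ oA) HM; apply/(Ck_on_mxP _ _ oA) => i j.
apply: (@Ck_on_eq _ _ _ _ _
  (fun u => (\det (M u))^-1 * ((-1) ^+ (j + i) * \det (row' j (col' i (M u)))))).
- exact: oA.
- by move=> u Au; rewrite /invmx uM// !mxE.
- apply: Ck_onM => //.
    apply: Ck_onV => //; last exact: Ck_on_det.
    by move=> u Au; have := uM u Au; rewrite unitmxE unitfE.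
  apply: Ck_onM => //; first exact: Ck_on_cst.
  apply: Ck_on_det => // i' j'.
  rewrite (_ : (fun u => _) = fun u => M u (lift j i') (lift i j')) //.
  by apply/funext => u; rewrite !mxE.
Qed.

Lemma jacobianE m n (f : 'rV[R]_m -> 'rV[R]_n) u i j : differentiable f u ->
  'J f u i j = partial i (fun w => f w 0 j) u.
Proof.
by move=> df; rewrite /partial -(derive_coord _ 0 j df) deriveEjacobian//
  -rowE [RHS]mxE.
Qed.

Lemma row_jacobian m n (f : 'rV[R]_m -> 'rV[R]_n) u i : differentiable f u ->
  row i ('J f u) = partial i f u.
Proof. by move=> df; rewrite /partial deriveEjacobian// -rowE. Qed.

Lemma derive_comp_jacobian V m n (f : V -> 'rV[R]_m) (g : 'rV[R]_m -> 'rV[R]_n)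
    u v : differentiable f u -> differentiable g (f u) ->
  'D_v (g \o f) u = 'D_v f u *m 'J g (f u).
Proof.
move=> df dg; have dgf : differentiable (g \o f) u by exact: differentiable_comp.
by rewrite (deriveE v dgf) diff_comp//= -(deriveE v df) -(deriveE _ dg)
  (deriveEjacobian _ dg).
Qed.

Lemma jacobian_comp m n p (f : 'rV[R]_m -> 'rV[R]_n)
    (g : 'rV[R]_n -> 'rV[R]_p) u :
  differentiable f u -> differentiable g (f u) ->
  'J (g \o f) u = 'J f u *m 'J g (f u).
Proof.
move=> df dg; have dgf : differentiable (g \o f) u by exact: differentiable_comp.
apply/row_matrixP => i; rewrite row_mul (row_jacobian _ dgf) (row_jacobian _ df).
exact: derive_comp_jacobian.
Qed.

Lemma Ck_on_jacobian k m n (A : set 'rV[R]_m) (f : 'rV[R]_m -> 'rV[R]_n) :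
  open A -> Ck_on k.+1 A f -> Ck_on k A (fun u => 'J f u).
Proof.
move=> oA Hf; apply/(Ck_on_mxP _ _ oA) => i j.
apply: (@Ck_on_eq _ _ _ _ _ (partial i (fun w => f w 0 j))) => //.
  by move=> u Au; rewrite jacobianE//; exact: Hf.1.
exact: ((Ck_on_mxP _ _ oA).1 Hf 0 j).2.
Qed.

Lemma near_eq_jacobian m n (f g : 'rV[R]_m -> 'rV[R]_n) u :
  {near u, f =1 g} -> differentiable f u -> 'J g u = 'J f u.
Proof.
move=> fg df; have dg := near_eq_differentiable fg df.
apply/row_matrixP => i; apply: etrans (row_jacobian i dg) _.
apply: etrans _ (esym (row_jacobian i df)).
by apply: near_eq_derive; apply: filterS fg => w ->.
Qed.

Lemma jacobian_eq_comp m n p (V : set 'rV[R]_m) (h : 'rV[R]_m -> 'rV[R]_p)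
    (f : 'rV[R]_m -> 'rV[R]_n) (g : 'rV[R]_n -> 'rV[R]_p) u :
  open V -> V u -> (forall w, V w -> h w = g (f w)) ->
  differentiable f u -> differentiable g (f u) ->
  'J h u = 'J f u *m 'J g (f u).
Proof.
move=> oV Vu hgf df dg; have nV : nbhs u V by exact: open_nbhs_nbhs.
apply: etrans (jacobian_comp df dg); apply: near_eq_jacobian.
  by apply: filterS nV => w Vw; rewrite hgf.
exact: differentiable_comp.
Qed.

Lemma mulmx_lipschitz n p (B : 'M[R]_(n, p)) :
  exists2 C, 0 < C & forall v : 'rV[R]_n, `|v *m B| <= C * `|v|.
Proof.
have [|C C0 H] := @linear_lipschitz R _ _ (mulmxr B : {linear 'rV[R]_n -> 'rV[R]_p}).
  exact: linear_rV_continuous.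
by exists C.
Qed.

Lemma differentiable_mulmxr V n p (B : 'M[R]_(n, p)) (F : V -> 'rV[R]_n) u :
  differentiable F u -> differentiable (fun w => F w *m B) u.
Proof.
move=> dF; apply: (@differentiable_comp _ _ _ _ F (mulmxr B)) => //.
by apply: linear_differentiable; exact: linear_rV_continuous.
Qed.

Lemma derive_mulmxr V n p (B : 'M[R]_(n, p)) (F : V -> 'rV[R]_n) u v :
  differentiable F u -> 'D_v (fun w => F w *m B) u = 'D_v F u *m B.
Proof.
move=> dF; have cB : continuous (mulmxr B : {linear 'rV[R]_n -> 'rV[R]_p}).
  exact: linear_rV_continuous.
have dB : differentiable (mulmxr B : 'rV[R]_n -> 'rV[R]_p) (F u).
  exact: linear_differentiable.
apply: etrans (deriveE v (differentiable_mulmxr B dF)) _.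
rewrite (deriveE v dF) -[X in 'd X u]/(mulmxr B \o F).
rewrite (@diff_comp _ _ _ _ F (mulmxr B) u dF dB) /=.
have E := @diff_lin _ _ _ (mulmxr B : {linear 'rV[R]_n -> 'rV[R]_p}) (F u) cB.
exact: (congr1 (fun g => g ('d F u v)) E).
Qed.

Lemma rV_norm_le n (v : 'rV[R]_n) e : 0 <= e ->
  `|v| <= e <-> forall j, `|v 0 j| <= e.
Proof.
move=> e0; rewrite /Num.Def.normr/= mx_normrE; split=> [H j|H].
  by apply: le_trans H; exact: (le_bigmax _ (fun ij => `|v ij.1 ij.2|) (0, j)).
by apply: bigmax_le => // -[i j] _ /=; rewrite (ord1 i); exact: H.
Qed.

Lemma coord_le_norm n (v : 'rV[R]_n) j : `|v 0 j| <= `|v|.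
Proof. exact: (rV_norm_le v (normr_ge0 v)).1. Qed.

Lemma unitmx_inj n (M : 'M[R]_n) :
  (forall v : 'rV[R]_n, v *m M = 0 -> v = 0) -> M \in unitmx.
Proof.
move=> H; rewrite -row_free_unit -kermx_eq0; apply/eqP/row_matrixP => i.
by rewrite row0; apply: H; rewrite -row_mul mulmx_ker row0.
Qed.

End CkMatrix.

(** Presents matrices as a complete normed space, for the Banach fixed point theorem. *)
HB.instance Definition _ (R : realType) (m n : nat) :=
  Complete.copy 'M[R]_(m, n) 'M[R]_(m, n).

(** * Local inversion by contraction *)

Section InverseFunction.
Context {R : realType}.

Lemma small_jacobian_lipschitz n (A : set 'rV[R]_n) (K : 'rV[R]_n -> 'rV[R]_n)
    u0 : open A -> A u0 -> Ck_on 1 A K -> 'J K u0 = 0 ->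
  exists2 r, 0 < r & [/\ ball u0 r `<=` A,
    (forall u v, ball u0 r u -> ball u0 r v -> `|K u - K v| <= 2^-1 * `|u - v|) &
    (forall u v, ball u0 r u -> `|'D_v K u| <= 2^-1 * `|v|)].
Proof.
move=> oA Au0 HK J0.
(* In the sup norm, entries bounded by [e] bound the derivative by n e |v| <= |v| / 2; the successor
   keeps [e] meaningful for [n = 0]. *)
pose e : R := (2 * n.+1%:R)^-1.
have e0 : 0 < e by rewrite invr_gt0 mulr_gt0.
have dK u : A u -> differentiable K u by exact: HK.1.
have nA : nbhs u0 A by exact: open_nbhs_nbhs.
have : nbhs u0 (A `&` [set u | forall ij : 'I_n * 'I_n, `|'J K u ij.1 ij.2| <= e]).
  apply: filterI => //.
  have F0 (ij : 'I_n * 'I_n) : \forall u \near u0, `|'J K u ij.1 ij.2| <= e.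
    have cJ0 : Ck_on 0 A (fun u => 'J K u) by exact: Ck_on_jacobian.
    have cJ := (continuous_mxP _ _).1 (cJ0 u0 Au0) ij.1 ij.2.
    have E : \forall u \near u0, `|'J K u0 ij.1 ij.2 - 'J K u ij.1 ij.2| <= e.
      exact: ((cvgrPdist_le _ _).1 cJ).
    apply: filterS E => u /=.
    by rewrite J0 mxE sub0r normrN.
  exact: filter_forall F0.
case/nbhs_ballP => r /= r0 H; exists r => //.
have Dcoord u v j : ball u0 r u -> `|'D_v (fun w => K w 0 j) u| <= 2^-1 * `|v|.
  move=> bu; have [Au Hu] := H u bu.
  rewrite -(derive_coord v 0 j (dK u Au)).
  rewrite deriveEjacobian; last exact: dK.
  rewrite mxE; apply: le_trans (ler_norm_sum _ _ _) _.
  apply: (@le_trans _ _ (\sum_(l < n) `|v| * e)).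
    apply: ler_sum => l _; rewrite normrM ler_pM//; first exact: coord_le_norm.
    exact: (Hu (l, j)).
  rewrite sumr_const card_ord -(mulr_natl (`|v| * e)) mulrCA (mulrC 2^-1).
  rewrite ler_wpM2l// /e invfM mulrCA -[leRHS]mulr1 ler_wpM2l ?invr_ge0//.
  by rewrite ler_pdivrMr ?ltr0n// mul1r ler_nat.
split.
- by move=> u /H [].
- move=> u v bu bv; apply/rV_norm_le => [|j]; first by rewrite mulr_ge0 ?invr_ge0.
  rewrite !mxE.
  have [t t01|t /andP[t0 t1] ->] := @mean_value1 _ _ (fun w => K w 0 j) v u.
    have [At _] := H _ (ball_segment bv bu t01).
    exact: (differentiable_mxP _ _).1 (dK _ At) 0 j.
  by apply: Dcoord; apply: ball_segment => //; rewrite !ltW.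
- move=> u v bu; apply/rV_norm_le => [|j]; first by rewrite mulr_ge0 ?invr_ge0.
  have [Au _] := H u bu; rewrite derive_coord; last exact: dK.
  exact: Dcoord.
Qed.

(** A solution is a fixed point of [u |-> K u + y], which contracts by 1/2. On the closed ball of
    radius r/2 its values stay within r/4 + r/4 of [u0], which explains both radii. *)
Lemma id_perturbation_surj n (K : 'rV[R]_n -> 'rV[R]_n) u0 r y : 0 < r ->
  (forall u v, ball u0 r u -> ball u0 r v -> `|K u - K v| <= 2^-1 * `|u - v|) ->
  `|y - (u0 - K u0)| < r / 4 -> exists2 u, ball u0 r u & u - K u = y.
Proof.
move=> r0 HK Hy; pose D := closed_ball u0 (r / 2).
have r20 : 0 < r / 2 by rewrite divr_gt0.
have DE u : D u <-> `|u0 - u| <= r / 2 by rewrite /D closed_ballE.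
have Db u : D u -> ball u0 r u.
  by move/DE => H; rewrite -ball_normE /ball_/=; apply: le_lt_trans H _; lra.
pose T u := K u + y.
have b0 : ball u0 r u0 by exact: ballxx.
have TD : {homo T : u / D u}.
  move=> u Du; apply/DE; rewrite /T.
  have -> : u0 - (K u + y) = (K u0 - K u) - (y - (u0 - K u0)).
    by apply/rowP => j; rewrite !mxE; ring.
  apply: le_trans (ler_normB _ _) _.
  have := HK u0 u b0 (Db u Du); have /DE := Du; lra.
have [|||u Du uE] := @banach_fixed_point R _ D (mkfun TD).
- exists 2^-1%:nng; split => /=; first by rewrite invf_lt1 ?ltr1n.
  move=> [u v] [/= Du Dv]; rewrite /T opprD addrACA subrr addr0.
  by apply: HK; exact: Db.
- exact: closed_ball_closed.
- by exists u0; apply/DE; rewrite subrr normr0 ltW.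
- by exists u; [exact: Db|rewrite {1}uE /= /T addrC addKr].
Qed.

(** Let k be the increment of y, h that of G, and M the Jacobian of F. From k = h M + o(h) follows h
    - k M^-1 = - (k - h M) M^-1, and this is o(k) since |h| <= C |k|. *)
Lemma inverse_is_diff n (F G : 'rV[R]_n -> 'rV[R]_n) (y0 : 'rV[R]_n) C :
  0 < C -> differentiable F (G y0) -> 'J F (G y0) \in unitmx ->
  (\forall y \near y0, F (G y) = y) ->
  (\forall y \near y0, `|G y - G y0| <= C * `|y - y0|) ->
  is_diff y0 G (mulmxr (invmx ('J F (G y0)))).
Proof.
move=> C0 dF uM FG lG; set M := 'J F (G y0) in uM *.
have [C1 C10 HC1] := mulmx_lipschitz (invmx M).
apply: (@eps_is_diff _ _ _ G y0
  (mulmxr (invmx M) : {linear 'rV[R]_n -> 'rV[R]_n})) => [|e e0].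
  exact: linear_rV_continuous.
(* [C1] bounds multiplication by [invmx M] and [C] is the Lipschitz constant of [G], so that [e]
   comes back after both estimates. *)
have e1 : 0 < e / (C1 * C) by rewrite divr_gt0// mulr_gt0.
have FGy0 : F (G y0) = y0 by exact: (nbhs_singleton FG).
have := differentiable_eps dF e1.
case/nbhs_ballP => d /= d0 Hd.
have FG0 : \forall h \near (0 : 'rV[R]_n), F (G (h + y0)) = h + y0.
  by move: FG; rewrite (near_shift 0) /= subr0.
have lG0 : \forall h \near (0 : 'rV[R]_n), `|G (h + y0) - G y0| <= C * `|h|.
  move: lG; rewrite (near_shift 0) /= subr0; apply: filterS => h /=.
  by rewrite addrK.
have sm : \forall h \near (0 : 'rV[R]_n), `|h| < d / C.
  by apply: nbhs0_lt; rewrite divr_gt0.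
near=> k.
have FGk : F (G (k + y0)) = k + y0 by near: k.
have lGk : `|G (k + y0) - G y0| <= C * `|k| by near: k.
have kd : `|k| < d / C by near: k.
pose h := G (k + y0) - G y0.
have hd : ball 0 d h.
  rewrite -ball_normE /ball_/= sub0r normrN; apply: le_lt_trans lGk _.
  by rewrite mulrC -ltr_pdivlMr.
have := Hd h hd; rewrite /= {1}/h subrK FGk FGy0 addrK.
rewrite -(deriveE _ dF) deriveEjacobian// -/M => E.
have -> : G (k + y0) - G y0 - k *m invmx M = - ((k - h *m M) *m invmx M).
  by rewrite mulmxBl mulmxK// opprB.
rewrite normrN; apply: le_trans (HC1 _) _.
apply: (@le_trans _ _ (C1 * (e / (C1 * C) * (C * `|k|)))).
  rewrite ler_pM2l//; apply: le_trans E _.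
  by rewrite ler_pM2l.
rewrite le_eqVlt; apply/orP; left; apply/eqP; field.
by rewrite !gt_eqF.
Unshelve. all: by end_near. Qed.

(** The map [K] is the identity minus [F] followed by the inverse of its Jacobian at [u0]; its
    derivative vanishes there, so it is a 1/2-contraction nearby. [V] is cut so that its image is
    exactly a ball, in which line segments through the centre can later be lifted by [G]. *)
Theorem inverse_function n (A : set 'rV[R]_n) (F : 'rV[R]_n -> 'rV[R]_n) u0 :
  open A -> A u0 -> smooth_on A F -> 'J F u0 \in unitmx ->
  exists (V : set 'rV[R]_n) (r : R) (G : 'rV[R]_n -> 'rV[R]_n),
   [/\ [/\ open V, V u0, V `<=` A & 0 < r],
       F @` V = ball (F u0) r,
       (forall u, V u -> G (F u) = u),
       (forall u, V u -> 'J F u \in unitmx) &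
       smooth_on (ball (F u0) r) G].
Proof.
move=> oA Au0 sF uJ; set B := invmx ('J F u0).
have dF u : A u -> differentiable F u by exact: (sF 1%N).1.
have lB := @linear_rV_continuous R n _ (mulmxr B : {linear 'rV[R]_n -> 'rV[R]_n}).
pose K u := u - F u *m B.
have sB k : Ck_on k setT (mulmxr B : 'rV[R]_n -> 'rV[R]_n) by exact: Ck_on_linear.
have sK k : Ck_on k A K.
  apply: Ck_onB => //; first exact: Ck_on_id.
  exact: (@Ck_on_comp _ _ _ _ _ _ A setT F (mulmxr B) oA openT).
have DK u v : A u -> 'D_v K u = v - 'D_v F u *m B.
  move=> Au; have dFu := dF u Au; have dFB := differentiable_mulmxr B dFu.
  rewrite -(derive_mulmxr B v dFu) -[LHS]/('D_v (id - (fun w => F w *m B)) u).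
  by rewrite deriveB ?derive_id//; exact: diff_derivable.
have JK0 : 'J K u0 = 0.
  apply/row_matrixP => i; rewrite row_jacobian; last exact: (sK 1%N).1.
  by rewrite /partial DK// deriveEjacobian ?mulmxK ?subrr ?row0//; exact: dF.
have [r1 r10 [bA lK sDK]] := small_jacobian_lipschitz oA Au0 (sK 1%N) JK0.
have FBE u : F u *m B = u - K u by rewrite /K opprB addrC subrK.
(* [u - v] is the sum of [K u - K v] and [(F u - F v) *m B], and the first term is at most half as
   long as [u - v]. *)
have inj2 u v : ball u0 r1 u -> ball u0 r1 v ->
    `|u - v| <= 2 * `|(F u - F v) *m B|.
  move=> bu bv; rewrite mulmxBl !FBE.
  have E (a b c d : 'rV[R]_n) : a - b - (c - d) = a - c - (b - d).
    by apply/rowP => j; rewrite !mxE; ring.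
  rewrite E.
  have := lerB_dist (u - v) (K u - K v); have := lK u v bu bv; lra.
have [C C0 HC] := mulmx_lipschitz B.
(* [C] bounds multiplication by [B], so a point within [r] of [F u0] leads to a defect below
   [r1 / 4], as [id_perturbation_surj] requires. *)
pose r := r1 / 4 / C.
have r0 : 0 < r by rewrite !divr_gt0.
have surj y : ball (F u0) r y -> exists2 u, ball u0 r1 u & F u = y.
  move=> By; have yr : `|F u0 - y| < r by move: By; rewrite -ball_normE.
  have [||u bu uE] := @id_perturbation_surj _ K u0 r1 (y *m B) r10.
  - exact: lK.
  - rewrite -FBE -mulmxBl; apply: le_lt_trans (HC _) _.
    by rewrite mulrC -ltr_pdivlMr// distrC.
  exists u => //; apply: etrans (esym (mulmxKV uJ (F u))) _.
  by rewrite -/B FBE uE /B mulmxKV.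
have /choice [G GP] : forall y, exists u, ball (F u0) r y ->
    ball u0 r1 u /\ F u = y.
  move=> y; have [/surj [u bu uE]|nb] := pselect (ball (F u0) r y); first by exists u.
  by exists 0.
pose V := ball u0 r1 `&` F @^-1` ball (F u0) r.
have oV : open V.
  rewrite openE => u [bu bFu]; apply: filterI.
    by apply: open_nbhs_nbhs; split => //; exact: ball_open.
  apply: (sF 0%N u (bA _ bu)); apply: open_nbhs_nbhs; split => //.
  exact: ball_open.
have GF u : V u -> G (F u) = u.
  move=> [bu bFu]; have [bG FG] := GP _ bFu.
  apply/eqP; rewrite -subr_eq0 -normr_le0; apply: le_trans (inj2 _ _ bG bu) _.
  by rewrite FG subrr mul0mx normr0 mulr0.
have VG y : ball (F u0) r y -> V (G y).
  by move=> By; have [bG FG] := GP _ By; split => //=; rewrite FG.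
(* If the Jacobian kills [v], then ['D_v K] equals [v], although its norm is at most half that of
   [v]. *)
have uJV u : V u -> 'J F u \in unitmx.
  move=> [bu _]; apply: unitmx_inj => v vJ.
  have := sDK u v bu; rewrite DK; last exact: bA.
  rewrite deriveEjacobian; last by apply: dF; exact: bA.
  rewrite vJ mul0mx subr0 => H; apply/eqP; rewrite -normr_le0.
  by have := normr_ge0 v; lra.
have oB : open (ball (F u0) r) by exact: ball_open.
have dG y : ball (F u0) r y -> is_diff y G (mulmxr (invmx ('J F (G y)))).
  move=> By; have [bG FG] := GP y By.
  have nB : nbhs y (ball (F u0) r) by exact: open_nbhs_nbhs.
  apply: (@inverse_is_diff _ _ _ _ (2 * C)).
  - by rewrite mulr_gt0.
  - by apply: dF; exact: bA.
  - by apply: uJV; exact: VG.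
  - by apply: filterS nB => z Bz; have [] := GP z Bz.
  - apply: filterS nB => z Bz; have [bGz FGz] := GP z Bz.
    apply: le_trans (inj2 _ _ bGz bG) _; rewrite FG FGz -mulrA ler_pM2l//.
exists V, r, G; split => //.
- by split => //; [split; exact: ballxx|move=> u [/bA]].
- rewrite eqEsubset; split=> [_ [u [_ ?] <-]//|y By].
  by exists (G y); [exact: VG|have [] := GP y By].
- elim=> [|k IH].
    by move=> y By; apply: differentiable_continuous; have [] := dG y By.
  split=> [y By|v]; first by have [] := dG y By.
  (* Bootstrap: the derivative of [G] is the inverse Jacobian of [F] evaluated along [G], hence C^k
     as soon as [G] is. *)
  apply: (@Ck_on_eq _ _ _ _ _ ((fun w => v *m invmx ('J F w)) \o G)) => //.
    by move=> y By; have [d dE] := dG y By; rewrite deriveE// dE.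
  apply: (@Ck_on_comp _ _ _ _ _ _ _ V) => //.
  apply: Ck_on_mulmx => //; first exact: Ck_on_cst.
  apply: Ck_on_invmx => //; apply: Ck_on_jacobian => //.
  by apply: Ck_on_sub (sF k.+1) => u [/bA].
Qed.

End InverseFunction.

(** * Normal trace of the second derivatives *)

Section NormalProjection.
Context {R : realType}.

Lemma dotvE n (u v : 'rV[R]_n) : dotv u v = (u *m v^T) 0 0.
Proof. by rewrite mxE; apply: eq_bigr => i _; rewrite mxE. Qed.

Lemma dotvv_ge0 n (v : 'rV[R]_n) : 0 <= dotv v v.
Proof. by apply: sumr_ge0 => i _; rewrite -expr2 sqr_ge0. Qed.

Lemma dotvv_eq0 n (v : 'rV[R]_n) : dotv v v = 0 -> v = 0.
Proof.
move=> /eqP; rewrite psumr_eq0 => [/allP H|i _]; last by rewrite -expr2 sqr_ge0.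
apply/rowP => j; rewrite mxE; apply/eqP.
by have := H j (mem_index_enum j); rewrite mulf_eq0 orbb.
Qed.

Lemma dotvv_gt0 n (v : 'rV[R]_n) : v != 0 -> 0 < dotv v v.
Proof.
rewrite lt_neqAle dotvv_ge0 andbT eq_sym; apply: contra => /eqP H.
by rewrite (dotvv_eq0 (esym H)).
Qed.

Lemma gram_unitmx n k (J : 'M[R]_(n, k)) : row_free J -> J *m J^T \in unitmx.
Proof.
move=> fJ; apply: unitmx_inj => v vJ.
have : v *m J = 0.
  by apply: dotvv_eq0; rewrite dotvE trmx_mul -!mulmxA (mulmxA J) mulmxA vJ mul0mx mxE.
by move=> /eqP; rewrite mulmx_free_eq0// => /eqP.
Qed.

(** Orthogonal projection, acting on row vectors from the right, onto the complement of the row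
    space of [J], provided that the rows of [J] are independent. *)
Definition normal_proj n k (J : 'M[R]_(n, k)) : 'M[R]_k :=
  1%:M - J^T *m invmx (J *m J^T) *m J.

Lemma mulmx_normal_proj n k (J : 'M[R]_(n, k)) : row_free J ->
  J *m normal_proj J = 0.
Proof.
move=> fJ; rewrite mulmxBr mulmx1 !mulmxA mulmxV ?mul1mx ?subrr//.
exact: gram_unitmx.
Qed.

Lemma normal_proj_id n k (J : 'M[R]_(n, k)) (N : 'rV[R]_k) :
  N *m J^T = 0 -> N *m normal_proj J = N.
Proof. by move=> NJ; rewrite mulmxBr mulmx1 !mulmxA NJ !mul0mx subr0. Qed.

Lemma normal_proj_mull n k (P : 'M[R]_n) (J : 'M[R]_(n, k)) :
  P \in unitmx -> row_free J -> normal_proj (P *m J) = normal_proj J.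
Proof.
move=> uP fJ; have uG := gram_unitmx fJ; rewrite /normal_proj; congr (_ - _).
have uPT : P^T \in unitmx by rewrite unitmx_tr.
have -> : invmx (P *m J *m (P *m J)^T) =
    invmx P^T *m invmx (J *m J^T) *m invmx P.
  have uM : P *m J *m (P *m J)^T \in unitmx.
    by rewrite trmx_mul mulmxA -(mulmxA P) !unitmx_mul uP uG.
  apply: (can_inj (mulKmx uM)); rewrite mulmxV//.
  rewrite trmx_mul !mulmxA mulmxK ?unitmx_tr// -(mulmxA P J).
  by rewrite mulmxK// mulmxV.
by rewrite trmx_mul !mulmxA mulmxKV ?mulmxK// -!mulmxA mulKmx// !mulmxA mulmxKV.
Qed.

Lemma normal_proj_mulr n k (J : 'M[R]_(n, k)) (Q : 'M[R]_k) :
  Q *m Q^T = 1%:M -> Q *m normal_proj (J *m Q) = normal_proj J *m Q.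
Proof.
move=> QQ; rewrite mulmxBr mulmxBl mulmx1 mul1mx; congr (_ - _).
by rewrite !trmx_mul !mulmxA QQ mul1mx -(mulmxA J) QQ mulmx1.
Qed.

End NormalProjection.

(** Change of coordinates in a trace: the matrix [P] acting on the indices of [T] is moved onto the
    coefficients [H]. *)
Lemma quadratic_sum (K : comPzRingType) (V : lmodType K) n (H P : 'M[K]_n)
    (T : 'I_n -> 'I_n -> V) :
  \sum_i \sum_j H i j *: (\sum_b \sum_c (P i c * P j b) *: T c b) =
  \sum_c \sum_b (P^T *m H *m P) c b *: T c b.
Proof.
transitivity (\sum_i \sum_j \sum_c \sum_b (H i j * (P i c * P j b)) *: T c b).
  apply: eq_bigr => i _; apply: eq_bigr => j _; rewrite exchange_big /=.
  rewrite scaler_sumr; apply: eq_bigr => c _; rewrite scaler_sumr.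
  by apply: eq_bigr => b _; rewrite scalerA.
under eq_bigr => i _ do rewrite exchange_big /=.
rewrite exchange_big /=; apply: eq_bigr => c _.
under eq_bigr => i _ do rewrite exchange_big /=.
rewrite exchange_big /=; apply: eq_bigr => b _.
rewrite exchange_big /= mxE scaler_suml; apply: eq_bigr => j _.
rewrite mxE mulr_suml scaler_suml; apply: eq_bigr => i _.
by rewrite mxE mulrA (mulrC (H i j)).
Qed.

Section LaplaceForm.
Context {R : realType}.

(** When [J] is the Jacobian and [D] the second derivatives of an immersion, the normal part of [D]
    is the second fundamental form, and the value is n H. *)
Definition normal_trace n k (J : 'M[R]_(n, k)) (D : 'I_n -> 'I_n -> 'rV[R]_k)
    : 'rV[R]_k :=
  (\sum_(i < n) \sum_(j < n) invmx (J *m J^T) i j *: D i j) *m normal_proj J.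

Lemma eq_normal_trace n k (J J' : 'M[R]_(n, k)) D D' : J = J' ->
  (forall i j, D i j = D' i j) -> normal_trace J D = normal_trace J' D'.
Proof.
move=> -> DD; rewrite /normal_trace; congr (_ *m _).
by apply: eq_bigr => i _; apply: eq_bigr => j _; rewrite DD.
Qed.

(** Second derivatives are not tensorial, but the defect [t i j *m J] is tangential and dies under
    the projection; the rest transforms by [P], which the inverse metric compensates. *)
Lemma normal_trace_pullback n k (P : 'M[R]_n) (J : 'M[R]_(n, k)) D D'
    (t : 'I_n -> 'I_n -> 'rV[R]_n) : P \in unitmx -> row_free J ->
  (forall i j, D' i j =
     t i j *m J + \sum_(b < n) \sum_(c < n) (P i c * P j b) *: D c b) ->
  normal_trace (P *m J) D' = normal_trace J D.
Proof.
move=> uP fJ DD; rewrite /normal_trace normal_proj_mull// !mulmx_suml.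
transitivity (\sum_i \sum_j (invmx (P *m J *m (P *m J)^T)) i j *:
   \sum_b \sum_c (P i c * P j b) *: (D c b *m normal_proj J)).
  apply: eq_bigr => i _; rewrite mulmx_suml; apply: eq_bigr => j _.
  rewrite DD -scalemxAl mulmxDl -(mulmxA (t i j)).
  rewrite mulmx_normal_proj// mulmx0 add0r mulmx_suml; congr (_ *: _).
  apply: eq_bigr => b _; rewrite mulmx_suml; apply: eq_bigr => c _.
  by rewrite scalemxAl.
transitivity (\sum_c \sum_b (P^T *m invmx (P *m J *m (P *m J)^T) *m P) c b *:
     (D c b *m normal_proj J)); first exact: quadratic_sum.
apply: eq_bigr => c _; rewrite mulmx_suml; apply: eq_bigr => b _.
rewrite -scalemxAl; congr (_ *: _); congr (fun_of_matrix _ c b).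
have uG := gram_unitmx fJ.
have uPT : P^T \in unitmx by rewrite unitmx_tr.
rewrite trmx_mul !mulmxA -(mulmxA P J).
move: (J *m J^T) uG => G uG.
have uM : P *m G *m P^T \in unitmx by rewrite !unitmx_mul uP uG.
have -> : invmx (P *m G *m P^T) = invmx P^T *m invmx G *m invmx P.
  apply: (can_inj (mulKmx uM)); rewrite mulmxV//.
  by rewrite !mulmxA mulmxK// mulmxK// mulmxV.
by rewrite !mulmxA mulmxV// mul1mx mulmxKV.
Qed.

(* Beltrami: the Laplacian of the position vector is minus the normal component
   of the metric trace of its second derivatives, i.e. -nH. *)
Definition laplace_form n k (X : 'rV[R]_n -> 'rV[R]_k) (u : 'rV[R]_n)
    : 'rV[R]_k := - normal_trace ('J X u) (fun i j => partial i (partial j X) u).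

(** [P] and [D] stand for the first and second derivatives of an immersion. In the combination of
    three derivatives of the induced metric, four of the six scalar products cancel and the other
    two coincide, which absorbs the factor 1/2. *)
Lemma christoffel_koszul n k (G : 'rV[R]_n -> 'M[R]_n) l i j u
    (D : 'I_n -> 'I_n -> 'rV[R]_k) (P : 'I_n -> 'rV[R]_k) :
  (forall a b c, partial a (fun w => G w b c) u =
     dotv (D a b) (P c) + dotv (P b) (D a c)) ->
  (forall a b, D a b = D b a) ->
  christoffel G l i j u = \sum_(m < n) invmx (G u) l m * dotv (D i j) (P m).
Proof.
move=> pG Dsym; rewrite /christoffel mulr_sumr; apply: eq_bigr => m _.
rewrite !pG mulrCA; congr (_ * _).
have dC (a b : 'rV[R]_k) : dotv a b = dotv b a.
  by apply: eq_bigr => ? _; rewrite mulrC.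
rewrite (Dsym j i) (Dsym m i) (Dsym m j) (dC (P j)) (dC (P i)) (dC (D i m)).
by rewrite (dC (D j m)); field.
Qed.

Section Local.
Variables (n k : nat) (A : set 'rV[R]_n) (X : 'rV[R]_n -> 'rV[R]_k).
Hypotheses (oA : open A) (sX : smooth_on A X).

Let dX u : A u -> differentiable X u. Proof. exact: (sX 1%N).1. Qed.

Lemma smooth_coord a : smooth_on A (fun w => X w 0 a).
Proof. by move=> l; exact: ((Ck_on_mxP _ _ oA).1 (sX l)). Qed.

Lemma smooth_partial i : smooth_on A (partial i X).
Proof. by move=> l; have [_] := sX l.+1; apply. Qed.

Lemma partial_coord i u a : A u ->
  (partial i X u) 0 a = partial i (fun w => X w 0 a) u.
Proof. by move=> Au; rewrite /partial (derive_coord _ _ _ (dX Au)). Qed.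

Lemma partial2_coord i j u a : A u ->
  (partial i (partial j X) u) 0 a = partial i (partial j (fun w => X w 0 a)) u.
Proof.
move=> Au; have dj : differentiable (partial j X) u by exact: (smooth_partial j 1).1.
rewrite /partial (derive_coord _ _ _ dj); apply: near_eq_derive.
have nA : nbhs u A by exact: open_nbhs_nbhs.
by apply: filterS nA => w Aw; exact: (partial_coord j a Aw).
Qed.

Lemma partial_sym i j u : A u ->
  partial i (partial j X) u = partial j (partial i X) u.
Proof.
move=> Au; apply/rowP => a; apply: etrans (partial2_coord i j a Au) _.
apply: etrans _ (esym (partial2_coord j i a Au)).
exact: (Schwarz _ _ oA Au (smooth_coord a 2)).
Qed.

Lemma jacobian_coord i a u : A u -> 'J X u i a = partial i (fun w => X w 0 a) u.
Proof. by move=> Au; rewrite jacobianE//; exact: dX. Qed.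

Lemma partial_gram i j l u : A u ->
  partial i (fun w => ('J X w *m ('J X w)^T) j l) u =
  dotv (partial i (partial j X) u) (partial l X u) +
  dotv (partial j X u) (partial i (partial l X) u).
Proof.
move=> Au; have nA : nbhs u A by exact: open_nbhs_nbhs.
pose h a w := partial j (fun w => X w 0 a) w * partial l (fun w => X w 0 a) w.
have E : partial i (fun w => ('J X w *m ('J X w)^T) j l) u =
    partial i (\sum_(a < k) h a) u.
  apply: near_eq_derive; apply: filterS nA => w Aw.
  rewrite mxE fct_sumE; apply: eq_bigr => a _.
  rewrite [X in _ * X]mxE.
  exact: (congr2 *%R (jacobian_coord j a Aw) (jacobian_coord l a Aw)).
have dp a m : differentiable (partial m (fun w => X w 0 a)) u.
  by have [_ H] := smooth_coord a 2; exact: (H _).1.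
apply: etrans E _; apply: etrans (derive_sum _) _ => [a|].
  by apply: derivableM; apply: diff_derivable; exact: dp.
rewrite /dotv -big_split; apply: eq_bigr => a _ /=.
apply: etrans (deriveM (diff_derivable (dp a j)) (diff_derivable (dp a l))) _.
apply: etrans (addrC _ _) _; apply: congr2.
  apply: etrans (mulrC _ _) _.
  exact: (esym (congr2 *%R (partial2_coord i j a Au) (partial_coord l a Au))).
exact: (esym (congr2 *%R (partial_coord j a Au) (partial2_coord i l a Au))).
Qed.

Lemma christoffel_gram (G : 'rV[R]_n -> 'M[R]_n) l i j u :
  (forall w, A w -> G w = 'J X w *m ('J X w)^T) -> A u ->
  christoffel G l i j u =
  \sum_(m < n) invmx (G u) l m * dotv (partial i (partial j X) u) (partial m X u).
Proof.
move=> GE Au; have nA : nbhs u A by exact: open_nbhs_nbhs.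
apply: (@christoffel_koszul n k G l i j u (fun a b => partial a (partial b X) u)
                                 (fun a => partial a X u)).
  move=> a b c; apply: etrans (partial_gram a b c Au); apply: near_eq_derive.
  by apply: filterS nA => w Aw; rewrite GE.
by move=> a b; exact: partial_sym.
Qed.

(** Gauss formula: the Christoffel term is the tangential part of the second derivative, so the
    covariant Hessian of the position vector is its normal part. *)
Lemma hessian_gram (G : 'rV[R]_n -> 'M[R]_n) i j u :
  (forall w, A w -> G w = 'J X w *m ('J X w)^T) -> A u ->
  \row_a hessian G (fun w => X w 0 a) i j u =
  partial i (partial j X) u *m normal_proj ('J X u).
Proof.
move=> GE Au; apply/rowP => a; rewrite mxE /hessian.
rewrite /normal_proj mulmxBr mulmx1 [RHS]mxE partial2_coord//; congr (_ + _).
rewrite [RHS]mxE; congr (- _).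
have symG : (invmx (G u))^T = invmx (G u).
  by rewrite trmx_inv GE// trmx_mul trmxK.
rewrite -(GE u)// -symG !mulmxA mxE; apply: eq_bigr => l _.
rewrite jacobian_coord//; congr (_ * _).
rewrite (christoffel_gram _ _ _ GE)// [RHS]mxE; apply: eq_bigr => m _.
rewrite [X in _ = _ * X]mxE mulrC; congr (_ * _).
rewrite dotvE -(row_jacobian m (dX Au)) [RHS]mxE [LHS]mxE; apply: eq_bigr => b _.
by congr (_ * _); rewrite [LHS]mxE [RHS]mxE [LHS]mxE.
Qed.

(** Beltrami's formula in one chart, by tracing the Gauss formula with the inverse metric; from here
    on no Christoffel symbol is needed. *)
Lemma laplace_form_hessian (G : 'rV[R]_n -> 'M[R]_n) u :
  (forall w, A w -> G w = 'J X w *m ('J X w)^T) -> A u ->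
  \row_a (- \sum_(i < n) \sum_(j < n)
    invmx (G u) i j * hessian G (fun w => X w 0 a) i j u) = laplace_form X u.
Proof.
move=> GE Au; rewrite /laplace_form /normal_trace mulmx_suml -(GE u)//.
apply/rowP => a; rewrite [LHS]mxE [RHS]mxE; congr (- _).
rewrite summxE; apply: eq_bigr => i _; rewrite mulmx_suml summxE.
apply: eq_bigr => j _; rewrite -scalemxAl -(hessian_gram i j GE Au).
by rewrite [RHS]mxE; congr (_ * _); rewrite [RHS]mxE.
Qed.

End Local.

(** Shaped for [normal_trace_pullback]: the second derivatives of [phi] enter only through
    combinations of rows of the Jacobian of [Y]. *)
Lemma partial2_comp n k (A B : set 'rV[R]_n) (phi : 'rV[R]_n -> 'rV[R]_n)
    (Y : 'rV[R]_n -> 'rV[R]_k) u i j : open A -> open B -> A u ->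
  (forall w, A w -> B (phi w)) -> smooth_on A phi -> smooth_on B Y ->
  partial i (partial j (Y \o phi)) u =
  partial i (partial j phi) u *m 'J Y (phi u) +
  \sum_(b < n) \sum_(c < n)
    ('J phi u i c * 'J phi u j b) *: partial c (partial b Y) (phi u).
Proof.
move=> oA oB Au AB sphi sY; have nA : nbhs u A by exact: open_nbhs_nbhs.
have sX : smooth_on A (Y \o phi).
  by move=> l; exact: (@Ck_on_comp _ _ _ _ _ _ A B phi Y oA oB AB (sphi l) (sY l)).
apply/rowP => a; apply: etrans (partial2_coord oA sX i j a Au) _.
have sYa := smooth_coord oB sY a.
have dphi w : A w -> differentiable phi w by exact: (sphi 1%N).1.
have dpp b : differentiable (partial j (fun w => phi w 0 b)) u.
  by have [_ H] := smooth_coord oA sphi b 2; exact: (H _).1.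
have dYp b w : B w -> differentiable (partial b (fun w => Y w 0 a)) w.
  by have [_ H] := sYa 2; exact: (H _).1.
pose h b := partial j (fun w => phi w 0 b) * (partial b (fun w => Y w 0 a) \o phi).
have E : partial i (partial j (fun w => (Y \o phi) w 0 a)) u =
    partial i (\sum_(b < n) h b) u.
  apply: near_eq_derive; apply: filterS nA => w Aw; rewrite fct_sumE.
  apply: etrans (derive_compR ('e_j) (dphi w Aw) ((sYa 1%N).1 _ (AB _ Aw))) _.
  by apply: eq_bigr => b _; congr (_ * _); exact: (derive_coord _ _ _ (dphi w Aw)).
have dh b : derivable (partial b (fun w => Y w 0 a) \o phi) u ('e_i).
  apply: diff_derivable; apply: differentiable_comp; [exact: dphi|].
  by apply: dYp; exact: AB.
have Bu := AB u Au.
apply: etrans E _; apply: etrans (derive_sum _) _ => [b|].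
  by apply: derivableM; [exact: diff_derivable|exact: dh].
rewrite [RHS]mxE [X in _ = X + _]mxE summxE -big_split; apply: eq_bigr => b _ /=.
apply: etrans (deriveM (diff_derivable (dpp b)) (dh b)) _.
apply: etrans (addrC _ _) _; apply: congr2.
  apply: etrans (mulrC _ _) _.
  apply: congr2; last exact: (esym (jacobian_coord sY b a Bu)).
  exact: (esym (partial2_coord oA sphi i j b Au)).
have dYb : differentiable (partial b (fun w => Y w 0 a)) (phi u) by exact: dYp.
apply: etrans (congr1 ( *%R _) (derive_compR ('e_i) (dphi u Au) dYb)) _.
rewrite mulr_sumr summxE; apply: eq_bigr => c _.
apply: etrans (mulrA _ _ _) _; rewrite [RHS]mxE; apply: congr2.
  apply: etrans (mulrC _ _) _; apply: congr2.
    apply: etrans (derive_coord _ _ _ (dphi u Au)) _.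
    exact: (esym (jacobian_coord sphi i c Au)).
  exact: (esym (jacobian_coord sphi j b Au)).
exact: (esym (partial2_coord oB sY c b a Bu)).
Qed.

Lemma laplace_form_comp n k (A B : set 'rV[R]_n) (phi : 'rV[R]_n -> 'rV[R]_n)
    (X Y : 'rV[R]_n -> 'rV[R]_k) u : open A -> open B -> A u ->
  (forall w, A w -> B (phi w)) -> smooth_on A phi -> smooth_on B Y ->
  (forall w, A w -> X w = Y (phi w)) ->
  'J phi u \in unitmx -> row_free ('J Y (phi u)) ->
  laplace_form X u = laplace_form Y (phi u).
Proof.
move=> oA oB Au AB sphi sY XY uP fY.
have nA : nbhs u A by exact: open_nbhs_nbhs.
have dphi w : A w -> differentiable phi w by exact: (sphi 1%N).1.
have dY w : B w -> differentiable Y w by exact: (sY 1%N).1.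
have dYphi w : A w -> differentiable (Y \o phi) w.
  by move=> Aw; apply: differentiable_comp; [exact: dphi|apply: dY; exact: AB].
have JX : 'J X u = 'J phi u *m 'J Y (phi u).
  rewrite -jacobian_comp; [|exact: dphi|apply: dY; exact: AB].
  by apply: near_eq_jacobian; [apply: filterS nA => w Aw; rewrite XY|exact: dYphi].
have p2 i j : partial i (partial j X) u = partial i (partial j (Y \o phi)) u.
  apply: near_eq_derive; apply: filterS nA => w Aw; apply: near_eq_derive.
  have nAw : nbhs w A by exact: open_nbhs_nbhs.
  by apply: filterS nAw => z Az; rewrite XY.
pose DY i j := partial i (partial j Y) (phi u).
have p2' i j : partial i (partial j X) u = partial i (partial j phi) u *m
    'J Y (phi u) + \sum_b \sum_c ('J phi u i c * 'J phi u j b) *: DY c b.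
  by apply: etrans (p2 i j) _; exact: (@partial2_comp n k A B).
have E := normal_trace_pullback uP fY p2'.
exact: (congr1 -%R (etrans (eq_normal_trace JX (fun _ _ => erefl)) E)).
Qed.

Lemma laplace_form_rigid n k (A : set 'rV[R]_n) (X : 'rV[R]_n -> 'rV[R]_k)
    (Q : 'M[R]_k) b u : open A -> A u -> smooth_on A X -> Q *m Q^T = 1%:M ->
  laplace_form (fun w => X w *m Q + b) u = laplace_form X u *m Q.
Proof.
move=> oA Au sX QQ.
have nA : nbhs u A by exact: open_nbhs_nbhs.
have dX w : A w -> differentiable X w by exact: (sX 1%N).1.
have D1 i w : A w -> partial i (fun w => X w *m Q + b) w = partial i X w *m Q.
  move=> Aw; have d := differentiable_mulmxr Q (dX w Aw).
  apply: etrans (deriveD (diff_derivable d) (derivable_cst _ _ _)) _.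
  apply: etrans (congr2 +%R (derive_mulmxr Q _ (dX w Aw)) (derive_cst _ _ _)) _.
  by rewrite addr0.
have JX : 'J (fun w => X w *m Q + b) u = 'J X u *m Q.
  have d : differentiable (fun w => X w *m Q + b) u.
    by apply: differentiableD => //; apply: differentiable_mulmxr; exact: dX.
  apply/row_matrixP => i; rewrite row_mul; apply: etrans (row_jacobian i d) _.
  by rewrite D1//; congr (_ *m Q); exact/esym/row_jacobian/dX.
have D2 i j : partial i (partial j (fun w => X w *m Q + b)) u =
    partial i (partial j X) u *m Q.
  transitivity (partial i (fun w => partial j X w *m Q) u).
    by apply: near_eq_derive; apply: filterS nA => w Aw; rewrite D1.
  by apply: derive_mulmxr; exact: (smooth_partial sX j 1).1.
rewrite /laplace_form mulNmx; congr (- _).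
apply: etrans (eq_normal_trace JX D2) _; rewrite /normal_trace.
rewrite trmx_mul mulmxA -(mulmxA ('J X u)) QQ mulmx1 -[RHS]mulmxA.
rewrite -(normal_proj_mulr _ QQ) mulmxA; congr (_ *m _).
rewrite mulmx_suml; apply: eq_bigr => i _; rewrite mulmx_suml.
by apply: eq_bigr => j _; rewrite scalemxAl.
Qed.

End LaplaceForm.

(** * Hypercylinders *)

Section Hypercylinder.
Context {R : realType}.
Implicit Types V : normedModType R.

Lemma derive1nD V k (f : R -> V) : derive1n k.+1 f = 'D_1 (derive1n k f).
Proof. by apply/funext => s; rewrite derive1nS derive1E. Qed.

Lemma smooth_derive1n k (I : set R) p (f : R -> 'rV[R]_p) :
  smooth_on I f -> smooth_on I (derive1n k f).
Proof.
move=> sf; elim: k => // k IH l; rewrite derive1nD.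
by have [_] := IH l.+1; apply.
Qed.

Lemma derive_comp_curve V p (f : V -> R) (g : R -> 'rV[R]_p) x v :
  differentiable f x -> differentiable g (f x) ->
  'D_v (fun w => g (f w)) x = 'D_v f x *: derive1n 1 g (f x).
Proof.
move=> df dg; rewrite derive1nD.
have dgf : differentiable (g \o f) x by exact: differentiable_comp.
apply/rowP => j; apply: etrans (derive_coord _ _ _ dgf) _.
have dgj : differentiable (fun w => g w 0 j) (f x).
  exact: (differentiable_mxP _ _).1 dg 0 j.
apply: etrans (derive_comp1 v df dgj) _.
by rewrite mxE; congr (_ * _); exact/esym/derive_coord.
Qed.

Lemma differentiable_row_mx V n1 n2 (f : V -> 'rV[R]_n1) (g : V -> 'rV[R]_n2) x :
  differentiable f x -> differentiable g x ->
  differentiable (fun w => row_mx (f w) (g w)) x.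
Proof.
move=> df dg; apply/differentiable_mxP => i j; rewrite (ord1 i).
case: (splitP j) => a ja.
  have -> : j = lshift n2 a by apply: val_inj.
  rewrite (_ : (fun w => _) = fun w => f w 0 a).
    exact: (differentiable_mxP _ _).1 df 0 a.
  by apply/funext => w; rewrite row_mxEl.
have -> : j = rshift n1 a by apply: val_inj.
rewrite (_ : (fun w => _) = fun w => g w 0 a).
  exact: (differentiable_mxP _ _).1 dg 0 a.
by apply/funext => w; rewrite row_mxEr.
Qed.

Lemma derive_row_mx V n1 n2 (f : V -> 'rV[R]_n1) (g : V -> 'rV[R]_n2) x v :
  differentiable f x -> differentiable g x ->
  'D_v (fun w => row_mx (f w) (g w)) x = row_mx ('D_v f x) ('D_v g x).
Proof.
move=> df dg; have dfg := differentiable_row_mx df dg.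
apply/rowP => j; apply: etrans (derive_coord _ _ _ dfg) _.
case: (splitP j) => a ja.
  have -> : j = lshift n2 a by apply: val_inj.
  rewrite row_mxEl; apply: etrans _ (esym (derive_coord v 0 a df)).
  by congr ('D_v _ x); apply/funext => w; rewrite row_mxEl.
have -> : j = rshift n1 a by apply: val_inj.
rewrite row_mxEr; apply: etrans _ (esym (derive_coord v 0 a dg)).
by congr ('D_v _ x); apply/funext => w; rewrite row_mxEr.
Qed.

Lemma derive_entry n (u v : 'rV[R]_n) j :
  'D_v (fun w : 'rV[R]_n => w 0 j) u = v 0 j.
Proof.
have d : differentiable (id : 'rV[R]_n -> 'rV[R]_n) u by [].
by apply: etrans (esym (derive_coord v 0 j d)) _; rewrite derive_id.
Qed.

Lemma derive_rsubmx n1 n2 (u v : 'rV[R]_(n1 + n2)) :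
  'D_v (fun w : 'rV[R]_(n1 + n2) => rsubmx w) u = rsubmx v.
Proof.
apply/rowP => j; apply: etrans (derive_coord _ _ _ (differentiable_rsubmx _)) _.
rewrite [RHS]mxE -(derive_entry u); congr ('D_v _ u).
by apply/funext => w; rewrite mxE.
Qed.

Variables (m : nat) (I : set R) (beta : R -> 'rV[R]_2).
Hypotheses (oI : open I) (sbeta : smooth_on I beta).

Let cyl := [set w : 'rV[R]_(1 + m) | I (w 0 0)].

Lemma cylinder_open : open cyl.
Proof.
apply: (@open_comp _ _ (fun w : 'rV[R]_(1 + m) => w 0 0)) => //.
by move=> w _; exact: coord_continuous.
Qed.

Lemma smooth_hypercylinder : smooth_on cyl (@hypercylinder R m beta).
Proof.
move=> k; apply/(Ck_on_mxP _ _ cylinder_open) => i j; rewrite (ord1 i).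
have Ccoord l : Ck_on k cyl (fun w : 'rV[R]_(1 + m) => w 0 l).
  exact: ((Ck_on_mxP _ _ cylinder_open).1 (Ck_on_id k cyl)).
case: (splitP j) => a ja.
  have -> : j = lshift m a by apply: val_inj.
  rewrite (_ : (fun w => _) = (fun s => beta s 0 a) \o (fun w : 'rV[R]_(1 + m) => w 0 0)).
    apply: (@Ck_on_comp1 _ _ _ cyl I) => //; first exact: cylinder_open.
    exact: ((Ck_on_mxP _ _ oI).1 (sbeta k)).
  by apply/funext => w; rewrite /hypercylinder row_mxEl.
have -> : j = rshift 2 a by apply: val_inj.
rewrite (_ : (fun w => _) = (fun w : 'rV[R]_(1 + m) => w 0 (rshift 1 a))) //.
by apply/funext => w; rewrite /hypercylinder row_mxEr mxE.
Qed.

Let db k s : I s -> differentiable (derive1n k beta) s.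
Proof. exact: (smooth_derive1n k sbeta 1%N).1. Qed.

Let d0 (u : 'rV[R]_(1 + m)) : differentiable (fun w : 'rV[R]_(1 + m) => w 0 0) u.
Proof. exact: differentiable_coord. Qed.

Lemma differentiable_derive1n_coord k (u : 'rV[R]_(1 + m)) : I (u 0 0) ->
  differentiable (fun w : 'rV[R]_(1 + m) => derive1n k beta (w 0 0)) u.
Proof.
move=> Iu; apply: (@differentiable_comp _ _ _ _
  (fun w : 'rV[R]_(1 + m) => w 0 0) (derive1n k beta)); first exact: d0.
exact: db.
Qed.

Lemma derive_hypercylinder (u v : 'rV[R]_(1 + m)) : I (u 0 0) ->
  'D_v (@hypercylinder R m beta) u =
  row_mx (v 0 0 *: derive1n 1 beta (u 0 0)) (rsubmx v).
Proof.
move=> Iu; apply: etrans (derive_row_mx v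
  (@differentiable_derive1n_coord 0 u Iu) (differentiable_rsubmx _)) _.
rewrite derive_rsubmx; congr (row_mx _ _).
by apply: etrans (derive_comp_curve v (d0 u) (@db 0 _ Iu)) _; rewrite derive_entry.
Qed.

Lemma derive2_hypercylinder (u v z : 'rV[R]_(1 + m)) : I (u 0 0) ->
  'D_v ('D_z (@hypercylinder R m beta)) u =
  row_mx ((v 0 0 * z 0 0) *: derive1n 2 beta (u 0 0)) 0.
Proof.
move=> Iu; have nA : nbhs u cyl.
  by apply: open_nbhs_nbhs; split => //; exact: cylinder_open.
pose h (w : 'rV[R]_(1 + m)) :=
  row_mx (z 0 0 *: derive1n 1 beta (w 0 0)) (rsubmx z) : 'rV[R]_(2 + m).
transitivity ('D_v h u).
  by apply: near_eq_derive; apply: filterS nA => w Aw; rewrite derive_hypercylinder.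
have d1 := @differentiable_derive1n_coord 1 u Iu.
have d1Z : differentiable (fun w : 'rV[R]_(1 + m) =>
  z 0 0 *: derive1n 1 beta (w 0 0)) u by exact: differentiableZ.
apply: etrans (derive_row_mx v d1Z (differentiable_cst _ _)) _.
congr (row_mx _ _); last exact: derive_cst.
apply: etrans (deriveZ _ (diff_derivable d1)) _.
rewrite (mulrC (v 0 0)) -scalerA; congr (_ *: _).
by apply: etrans (derive_comp_curve v (d0 u) (@db 1 _ Iu)) _; rewrite derive_entry.
Qed.

Lemma jacobian_hypercylinder (u : 'rV[R]_(1 + m)) : I (u 0 0) ->
  'J (@hypercylinder R m beta) u = block_mx (derive1n 1 beta (u 0 0)) 0 0 1%:M.
Proof.
move=> Iu; have dh : differentiable (@hypercylinder R m beta) u.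
  exact: (smooth_hypercylinder 1).1.
apply/row_matrixP => i; apply: etrans (row_jacobian i dh) _.
apply: etrans (derive_hypercylinder _ Iu) _.
case: (splitP i) => a ia.
  have -> : i = lshift m a by apply: val_inj.
  rewrite (ord1 a) rowKu; apply/rowP => j; rewrite [RHS]mxE.
  have -> : (delta_mx 0 (lshift m 0) : 'rV[R]_(1 + m)) 0 0 = 1.
    by rewrite (_ : lshift m 0 = 0) ?mxE//; apply: val_inj.
  rewrite scale1r; congr (row_mx _ _ 0 j); apply/rowP => l; rewrite !mxE.
  by [].
have -> : i = rshift 1 a by apply: val_inj.
rewrite rowKd; apply/rowP => j; rewrite [RHS]mxE.
have -> : (delta_mx 0 (rshift 1 a) : 'rV[R]_(1 + m)) 0 0 = 0.
  by rewrite mxE.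
rewrite scale0r.
have -> : rsubmx (delta_mx 0 (rshift 1 a) : 'rV[R]_(1 + m)) = row a 1%:M.
  by apply/rowP => l; rewrite !mxE eqxx /= eq_rshift eq_sym.
by rewrite !mxE; case: fintype.split => l; rewrite !mxE.
Qed.

Hypothesis arc : forall s, I s ->
  dotv (derive1n 1 beta s) (derive1n 1 beta s) = 1.

(** Derivative of the constant squared speed, up to the factor 2. *)
Lemma dot_derive12 s : I s -> dotv (derive1n 2 beta s) (derive1n 1 beta s) = 0.
Proof.
move=> Is; have nI : nbhs s I by exact: open_nbhs_nbhs.
pose b a := fun s => derive1n 1 beta s 0 a.
have dba a : differentiable (b a) s by exact: (differentiable_mxP _ _).1 (db 1 Is) 0 a.
have E : 'D_1 (\sum_(a < 2) b a * b a) s = 0.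
  transitivity ('D_1 (cst (1 : R) : R -> R) s); last exact: derive_cst.
  apply: near_eq_derive; apply: filterS nI => w Iw; rewrite /cst -(arc Iw) fct_sumE.
  by apply: eq_bigr.
move: E; rewrite derive_sum => [E|a]; last first.
  by apply: derivableM; exact: diff_derivable.
suff E2 : dotv (derive1n 2 beta s) (derive1n 1 beta s) *+ 2 = 0.
  by apply/eqP; move/eqP: E2; rewrite mulrn_eq0.
rewrite -E /dotv -sumrMnl; apply: eq_bigr => a _.
apply: etrans _ (esym (deriveM (diff_derivable (dba a)) (diff_derivable (dba a)))).
rewrite mulr2n; have -> : 'D_1 (b a) s = derive1n 2 beta s 0 a.
  by rewrite derive1nD; exact/esym/(derive_coord _ _ _ (db 1 Is)).
by rewrite mulrC.
Qed.

Lemma gram_hypercylinder (u : 'rV[R]_(1 + m)) : I (u 0 0) ->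
  'J (@hypercylinder R m beta) u *m ('J (@hypercylinder R m beta) u)^T = 1%:M.
Proof.
move=> Iu; rewrite jacobian_hypercylinder// tr_block_mx mulmx_block.
rewrite !trmx0 trmx1 !mulmx0 !mul0mx mulmx1 !addr0 add0r.
set G := (X in block_mx X); have -> : G = 1%:M.
  by apply/matrixP => i j; rewrite !ord1 -dotvE arc// mxE.
by rewrite -scalar_mx_block.
Qed.

(** In these coordinates the metric is the identity, and the only second derivative that survives is
    the one in the arclength variable; it is already normal, being orthogonal to the unit tangent of
    the curve. *)
Lemma laplace_form_hypercylinder (u : 'rV[R]_(1 + m)) : I (u 0 0) ->
  laplace_form (@hypercylinder R m beta) u =
  - row_mx (derive1n 2 beta (u 0 0)) 0.
Proof.
move=> Iu; have G1 := gram_hypercylinder Iu.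
rewrite /laplace_form /normal_trace; congr (- _).
(* The arclength component of the i-th basis vector: 1 for [i = 0] and 0 otherwise. *)
pose e := fun i : 'I_(1 + m) => (delta_mx 0 i : 'rV[R]_(1 + m)) 0 0.
transitivity ((\sum_i \sum_j (1%:M : 'M[R]_(1 + m)) i j *:
   row_mx ((e i * e j) *: derive1n 2 beta (u 0 0)) 0) *m
   normal_proj ('J (@hypercylinder R m beta) u)).
  congr (_ *m _); apply: eq_bigr => i _; apply: eq_bigr => j _.
  by rewrite G1 invmx1; congr (_ *: _); exact: derive2_hypercylinder.
have -> : \sum_i \sum_j (1%:M : 'M[R]_(1 + m)) i j *:
   row_mx ((e i * e j) *: derive1n 2 beta (u 0 0)) 0 =
   row_mx (derive1n 2 beta (u 0 0)) (0 : 'rV[R]_m).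
  have e0 i : i != 0 -> e i = 0.
    by move=> i0; rewrite /e mxE eqxx /= eq_sym (negbTE i0).
  rewrite (bigD1 0)//= [X in _ + X]big1 ?addr0 => [|i i0]; last first.
    by apply: big1 => j _; rewrite (e0 _ i0) mul0r scale0r row_mx0 scaler0.
  rewrite (bigD1 0)//= [X in _ + X]big1 ?addr0 => [|i i0]; last first.
    by rewrite (e0 _ i0) mulr0 scale0r row_mx0 scaler0.
  by rewrite mxE eqxx scale1r /e mxE !eqxx mulr1 scale1r.
apply: normal_proj_id; rewrite jacobian_hypercylinder// tr_block_mx.
rewrite mul_row_block !mul0mx !addr0 trmx0 mulmx0 -[RHS]row_mx0.
by congr (row_mx _ _); apply/rowP => j; rewrite ord1 -dotvE dot_derive12// mxE.
Qed.

End Hypercylinder.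

(** * Graphs *)

Section Graph.
Context {R : realType}.

(** The index [i0] of the vertical coordinate is a parameter; the final use takes index 1, so that
    the profile lies in the plane of the first two coordinates. *)
Definition graph_map n (i0 : 'I_n.+1) (f : 'rV[R]_n -> R) (y : 'rV[R]_n)
    : 'rV[R]_n.+1 :=
  \row_k (if unlift i0 k is Some j then y 0 j else f y).

Variables (n : nat) (i0 : 'I_n.+1) (A : set 'rV[R]_n) (f : 'rV[R]_n -> R).
Hypotheses (oA : open A) (sf : smooth_on A f).

Let f1 i := partial i f.
Let f2 i j := partial i (partial j f).

Definition graph_area2 (y : 'rV[R]_n) : R := 1 + \sum_i f1 i y ^+ 2.

(* The coefficient of the Laplace map of the graph along the (upward,
   unnormalized) normal: with W = 1 + |grad f|^2, the inverse metric is
   1 - grad f grad f^T / W and q W = tr (G^-1 Hess f). *)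
Definition graph_curv (y : 'rV[R]_n) : R :=
  (graph_area2 y * (\sum_i f2 i i y)
   - \sum_i \sum_j f1 i y * f1 j y * f2 i j y) / graph_area2 y ^+ 2.

Definition graph_normal (y : 'rV[R]_n) : 'rV[R]_n.+1 :=
  \row_k (if unlift i0 k is Some j then - f1 j y else 1).

Lemma graph_area2_gt0 y : 0 < graph_area2 y.
Proof. by rewrite ltr_pwDl// sumr_ge0// => i _; rewrite sqr_ge0. Qed.

Lemma smooth_partial_fun i : smooth_on A (f1 i).
Proof. by move=> k; have [_] := sf k.+1; apply. Qed.

Lemma smooth_partial2_fun i j : smooth_on A (f2 i j).
Proof. by move=> k; have [_ H] := sf k.+2; have [_] := H ('e_j); apply. Qed.

Lemma smooth_graph_area2 : smooth_on A graph_area2.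
Proof.
move=> k; apply: Ck_onD => //; first exact: Ck_on_cst.
apply: Ck_on_sum => // i _; rewrite (_ : (fun u => _) = fun u => f1 i u * f1 i u) //.
by apply: Ck_onM => //; exact: smooth_partial_fun.
Qed.

Lemma smooth_graph_curv : smooth_on A graph_curv.
Proof.
move=> k; have W0 y : A y -> graph_area2 y ^+ 2 != 0.
  by move=> _; rewrite expf_neq0// gt_eqF// graph_area2_gt0.
have C1 i : Ck_on k A (f1 i) by exact: smooth_partial_fun.
have C2 i j : Ck_on k A (f2 i j) by exact: smooth_partial2_fun.
have CW : Ck_on k A graph_area2 by exact: smooth_graph_area2.
apply: Ck_onM => //; last first.
  apply: Ck_onV => //.
  rewrite (_ : (fun u => _) = fun u => graph_area2 u * graph_area2 u) //.
  exact: Ck_onM.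
apply: Ck_onB => //; first by apply: Ck_onM => //; exact: Ck_on_sum.
apply: Ck_on_sum => // i _; apply: Ck_on_sum => // j _.
by apply: Ck_onM => //; exact: Ck_onM.
Qed.

Lemma smooth_graph_map : smooth_on A (graph_map i0 f).
Proof.
move=> k; apply/(Ck_on_mxP _ _ oA) => a j; rewrite (ord1 a).
have [l jl|jl] := unliftP i0 j.
  rewrite (_ : (fun u => _) = fun w : 'rV[R]_n => w 0 l).
    exact: ((Ck_on_mxP _ _ oA).1 (Ck_on_id k A)).
  by apply/funext => w; rewrite mxE jl liftK.
rewrite (_ : (fun u => _) = f) //.
by apply/funext => w; rewrite mxE jl unlift_none.
Qed.

Lemma smooth_graph_normal : smooth_on A graph_normal.
Proof.
move=> k; apply/(Ck_on_mxP _ _ oA) => a j; rewrite (ord1 a).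
have [l jl|jl] := unliftP i0 j.
  rewrite (_ : (fun u => _) = fun w : 'rV[R]_n => - f1 l w).
    by apply: Ck_onN => //; exact: smooth_partial_fun.
  by apply/funext => w; rewrite mxE jl liftK.
rewrite (_ : (fun u => _) = cst 1); first exact: Ck_on_cst.
by apply/funext => w; rewrite mxE jl unlift_none.
Qed.

Lemma derive_graph_map y v : A y -> 'D_v (graph_map i0 f) y =
  \row_k (if unlift i0 k is Some j then v 0 j else 'D_v f y).
Proof.
move=> Ay; have dg : differentiable (graph_map i0 f) y.
  exact: (smooth_graph_map 1).1.
apply/rowP => j; apply: etrans (derive_coord _ _ _ dg) _; rewrite mxE.
have [l jl|jl] := unliftP i0 j.
  rewrite -(derive_entry y v l); congr ('D_v _ y).
  by apply/funext => w; rewrite mxE jl liftK.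
by congr ('D_v _ y); apply/funext => w; rewrite mxE jl unlift_none.
Qed.

Lemma derive2_graph_map y i j : A y ->
  partial i (partial j (graph_map i0 f)) y = f2 i j y *: delta_mx 0 i0.
Proof.
move=> Ay; apply/rowP => k.
apply: etrans (partial2_coord oA smooth_graph_map i j k Ay) _.
have nA : nbhs y A by exact: open_nbhs_nbhs.
rewrite !mxE eqxx /=; have [l kl|kl] := unliftP i0 k.
  rewrite kl eq_sym (negbTE (neq_lift _ _)) mulr0.
  transitivity (partial i (cst (('e_j : 'rV[R]_n) 0 l)) y); last exact: derive_cst.
  apply: near_eq_derive; apply: filterS nA => w Aw.
  apply: etrans (derive_entry w ('e_j) l).
  apply: (congr1 (fun h => 'D_('e_j) h w)).
  by apply/funext => z; rewrite mxE liftK.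
rewrite kl eqxx mulr1 /f2; congr (partial i (partial j _) y).
by apply/funext => w; rewrite mxE unlift_none.
Qed.

Let g y : 'rV[R]_n := \row_i f1 i y.

Lemma jacobian_graph_map y i : A y -> (forall l,
  'J (graph_map i0 f) y i (lift i0 l) = (i == l)%:R) /\
  'J (graph_map i0 f) y i i0 = f1 i y.
Proof.
move=> Ay; have dg : differentiable (graph_map i0 f) y.
  exact: (smooth_graph_map 1).1.
have E : row i ('J (graph_map i0 f) y) = \row_k (if unlift i0 k is Some j
    then ('e_i : 'rV[R]_n) 0 j else f1 i y).
  by apply: etrans (row_jacobian i dg) _; exact: derive_graph_map.
split=> [l|].
  by move/rowP/(_ (lift i0 l)): E; rewrite mxE [RHS]mxE liftK => ->;
    rewrite mxE eqxx eq_sym.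
by move/rowP/(_ i0): E; rewrite mxE [RHS]mxE unlift_none.
Qed.

Lemma gram_graph_map y : A y ->
  'J (graph_map i0 f) y *m ('J (graph_map i0 f) y)^T = 1%:M + (g y)^T *m g y.
Proof.
move=> Ay; apply/matrixP => i j; rewrite !mxE (bigD1_ord i0)//=.
have [Ji1 Ji2] := jacobian_graph_map i Ay.
have [Jj1 Jj2] := jacobian_graph_map j Ay.
rewrite [X in _ * X]mxE Ji2 Jj2 big_ord1 !mxE addrC; congr (_ + _).
rewrite (bigD1 i)//= big1 => [|l li].
  by rewrite [X in _ * X]mxE Ji1 Jj1 eqxx mul1r addr0 eq_sym.
by rewrite Ji1 eq_sym (negbTE li) mul0r.
Qed.

Lemma dot_grad y : g y *m (g y)^T = (graph_area2 y - 1)%:M.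
Proof.
apply/matrixP => i j; rewrite !ord1 !mxE eqxx mulr1n addrC addKr.
by apply: eq_bigr => l _; rewrite !mxE expr2.
Qed.

(** Sherman-Morrison formula for a rank-one perturbation of the identity, where |grad f|^2 = W -
    1. *)
Lemma invmx_gram_graph y :
  invmx (1%:M + (g y)^T *m g y) = 1%:M - (graph_area2 y)^-1 *: ((g y)^T *m g y).
Proof.
have W0 : graph_area2 y != 0 by rewrite gt_eqF// graph_area2_gt0.
set W := graph_area2 y in W0 *.
have E : (1%:M + (g y)^T *m g y) *m (1%:M - W^-1 *: ((g y)^T *m g y)) = 1%:M.
  rewrite mulmxBr mulmx1 -scalemxAr mulmxDl mul1mx.
  have -> : (g y)^T *m g y *m ((g y)^T *m g y) = (W - 1) *: ((g y)^T *m g y).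
    rewrite -mulmxA (mulmxA (g y)) dot_grad -/W mul_scalar_mx -scalemxAr.
    by [].
  rewrite scalerDr scalerA -scalerDl mulrBr mulr1 mulVf// (addrC W^-1) subrK.
  by rewrite scale1r addrK.
have [uM _] := mulmx1_unit E.
by apply: (can_inj (mulKmx uM)); rewrite mulmxV.
Qed.

Lemma row_free_jacobian_graph y : A y -> row_free ('J (graph_map i0 f) y).
Proof.
move=> Ay; rewrite -kermx_eq0; apply/eqP/row_matrixP => a; rewrite row0.
have : row a (kermx ('J (graph_map i0 f) y)) *m 'J (graph_map i0 f) y = 0.
  by rewrite -row_mul mulmx_ker row0.
move: (row a _) => v vJ; apply/rowP => i; move/rowP/(_ (lift i0 i)): vJ.
rewrite mxE (bigD1 i)//= big1 => [|l li].
  by rewrite (jacobian_graph_map i Ay).1 eqxx mulr1 addr0 !mxE.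
by rewrite (jacobian_graph_map l Ay).1 (negbTE li) mulr0.
Qed.

(** All second derivatives of the graph are vertical, with metric trace W q, and the vertical unit
    vector is N / W plus a tangent vector. The normal projection therefore yields q N. *)
Lemma laplace_form_graph y : A y ->
  laplace_form (graph_map i0 f) y = - (graph_curv y *: graph_normal y).
Proof.
move=> Ay; rewrite /laplace_form; congr (- _); rewrite /normal_trace.
have W0 : graph_area2 y != 0 by rewrite gt_eqF// graph_area2_gt0.
have fJ := row_free_jacobian_graph Ay.
pose J := 'J (graph_map i0 f) y.
have E1 : \sum_i \sum_j invmx (J *m J^T) i j *:
    partial i (partial j (graph_map i0 f)) y =
    (graph_area2 y * graph_curv y) *: delta_mx 0 i0.
  transitivity ((\sum_i \sum_j invmx (1%:M + (g y)^T *m g y) i j * f2 i j y) *: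
      (delta_mx 0 i0 : 'rV[R]_n.+1)).
    rewrite scaler_suml; apply: eq_bigr => i _; rewrite scaler_suml.
    apply: eq_bigr => j _; rewrite -scalerA.
    apply: congr2; first by rewrite /J gram_graph_map.
    exact: derive2_graph_map.
  congr (_ *: _); rewrite invmx_gram_graph /graph_curv expr2 invfM.
  have WW (a b : R) : a != 0 -> a * (b * (a^-1 * a^-1)) = a^-1 * b.
    by move=> a0; field.
  rewrite WW// mulrBr mulKf//.
  under eq_bigr do under eq_bigr do rewrite mxE mulrDl.
  under eq_bigr do rewrite big_split /=.
  rewrite big_split /=; congr (_ + _).
    apply: eq_bigr => i _; rewrite (bigD1 i)//= big1 => [|j ji].
      by rewrite mxE eqxx mul1r addr0.
    by rewrite mxE eq_sym (negbTE ji) mul0r.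
  rewrite mulr_sumr -sumrN; apply: eq_bigr => i _.
  rewrite mulr_sumr -sumrN; apply: eq_bigr => j _.
  set M := (X in X i j); have -> : M i j =
      - ((graph_area2 y)^-1 * (f1 i y * f1 j y)).
    by rewrite /M !mxE big_ord1 !mxE.
  by rewrite mulNr !mulrA.
have NJ : graph_normal y *m J^T = 0.
  apply/rowP => i; rewrite mxE (bigD1_ord i0)//= [RHS]mxE.
  rewrite mxE unlift_none mul1r mxE (jacobian_graph_map i Ay).2.
  rewrite (bigD1 i)//= big1 => [|l li].
    rewrite mxE liftK mxE (jacobian_graph_map i Ay).1 eqxx mulr1 addr0.
    by rewrite subrr.
  by rewrite [X in _ * X]mxE (jacobian_graph_map i Ay).1 eq_sym (negbTE li) mulr0.
have E2 : delta_mx 0 i0 =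
    (graph_area2 y)^-1 *: graph_normal y + ((graph_area2 y)^-1 *: g y) *m J.
  apply/rowP => k; rewrite [RHS]mxE [X in _ = X + _]mxE.
  rewrite -scalemxAl [X in _ = _ + X]mxE -mulrDr.
  rewrite [X in _ = _ * (X + _)]mxE [X in _ = _ * (_ + X)]mxE.
  rewrite mxE eqxx /=; have [l kl|kl] := unliftP i0 k.
    rewrite kl eq_sym (negbTE (neq_lift _ _)) (bigD1 l)//= big1 => [|j jl].
      by rewrite (jacobian_graph_map l Ay).1 eqxx mulr1 addr0 mxE addNr mulr0.
    by rewrite (jacobian_graph_map j Ay).1 (negbTE jl) mulr0.
  rewrite kl eqxx; have -> : \sum_j g y 0 j * J j i0 = \sum_j f1 j y ^+ 2.
    by apply: eq_bigr => j _; rewrite (jacobian_graph_map j Ay).2 mxE expr2.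
  by rewrite -/(graph_area2 y) mulVf.
rewrite -/J E1 -scalemxAl E2 mulmxDl -(mulmxA _ J) (mulmx_normal_proj fJ).
by rewrite mulmx0 addr0 -scalemxAl (normal_proj_id NJ) scalerA mulrAC mulfV// mul1r.
Qed.

End Graph.

(** * Graphs whose Laplace map has rank one *)

Section RankOne.
Context {R : realType}.

Lemma rank1_minor m n (M : 'M[R]_(m, n)) i k a b : \rank M = 1%N ->
  M i a * M k b = M i b * M k a.
Proof.
move=> rM; rewrite -(mulmx_base M); move: (col_base M) (row_base M).
by rewrite rM => C D; rewrite !mxE !big_ord1; ring.
Qed.

Lemma is_derive0_mul (V : normedModType R) (f g : V -> R) y v :
  is_derive y v f 0 -> is_derive y v g 0 -> is_derive y v (fun u => f u * g u) 0.
Proof.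
move=> df dg; have -> : (fun u => f u * g u) = f * g by [].
by apply: is_derive_eq; rewrite !scaler0 addr0.
Qed.

Lemma is_derive0_sum (V : normedModType R) n (f : 'I_n -> V -> R) y v :
  (forall i, is_derive y v (f i) 0) -> is_derive y v (fun u => \sum_i f i u) 0.
Proof.
move=> df; have -> : (fun u => \sum_i f i u) = \sum_i f i.
  by apply/funext => u; rewrite fct_sumE.
have := @is_derive_sum _ V R n f y v (fun=> 0) df.
by rewrite big1_eq.
Qed.

Lemma mul_eq0_cancel (V : normedModType R) (A : set V) (q h : V -> R) :
  open A -> (forall u, A u -> differentiable q u) ->
  (forall u, A u -> differentiable h u) ->
  (forall u, A u -> q u = 0 -> exists v, 'D_v q u != 0) ->
  (forall u, A u -> q u * h u = 0) -> forall u, A u -> h u = 0.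
Proof.
move=> oA dq dh q0 qh u Au; have nA : nbhs u A by exact: open_nbhs_nbhs.
have [qu0|qu0] := eqVneq (q u) 0; last first.
  by apply/eqP; move/eqP: (qh u Au); rewrite mulf_eq0 (negbTE qu0).
have [v Dq] := q0 u Au qu0.
have E : 'D_v (q * h) u = 0.
  transitivity ('D_v (cst (0 : R) : V -> R) u); last exact: derive_cst.
  by apply: near_eq_derive; apply: filterS nA => w Aw; rewrite /cst -[RHS](qh w Aw).
move: E; rewrite deriveM; [|exact/diff_derivable/dq|exact/diff_derivable/dh].
rewrite qu0 scale0r add0r => /eqP; rewrite mulf_eq0 (negbTE Dq) orbF => /eqP.
by [].
Qed.

Lemma derive_rowE n (W : normedModType R) (h : 'rV[R]_n -> W) y v :
  differentiable h y -> 'D_v h y = \sum_i v 0 i *: partial i h y.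
Proof.
move=> dh; rewrite (deriveE _ dh) [in LHS](row_sum_delta v) linear_sum.
by apply: eq_bigr => i _; rewrite linearZ /= /partial (deriveE _ dh).
Qed.

(** The vector B a - C b, with B = |b|^2 and C = a . b, has squared length B (|a|^2 B - C^2). *)
Lemma sum_cauchy_schwarz n (a b : 'I_n -> R) : 0 < \sum_i b i * b i ->
  (\sum_i a i * b i) * (\sum_i a i * b i) <=
  (\sum_i a i ^+ 2) * (\sum_i b i * b i).
Proof.
have H s t : \sum_i (s * a i - t * b i) ^+ 2 = s ^+ 2 * (\sum_i a i ^+ 2)
    - 2 * s * t * (\sum_i a i * b i) + t ^+ 2 * (\sum_i b i * b i).
  rewrite !mulr_sumr -sumrB -big_split /=; apply: eq_bigr => i _; ring.
have := H (\sum_i b i * b i) (\sum_i a i * b i).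
set B := \sum_i b i * b i; set C := \sum_i a i * b i; set D := \sum_i a i ^+ 2.
move=> E B0; have H0 : 0 <= \sum_i (B * a i - C * b i) ^+ 2.
  by apply: sumr_ge0 => i _; rewrite sqr_ge0.
have : 0 <= B * (D * B - C * C).
  by move: H0; rewrite E; congr (0 <= _); ring.
by rewrite pmulr_rge0// subr_ge0.
Qed.

(** For a Hessian l c c^T, with [D] the partial derivatives of [l] and [Q k i] those of [c i], the
    last hypothesis is the symmetry of the third derivatives. Taking j = i1, where [c] is 1 and [Q]
    vanishes, and subtracting separates [D] from [Q]. *)
Lemma codazzi_algebra n (D : 'I_n -> R) (Q : 'I_n -> 'I_n -> R) (c : 'I_n -> R)
    (l : R) (i1 : 'I_n) : c i1 = 1 -> (forall k, Q k i1 = 0) ->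
  (forall k i j, D k * c i * c j + l * Q k i * c j + l * c i * Q k j =
                 D i * c k * c j + l * Q i k * c j + l * c k * Q i j) ->
  (forall k j, l * Q k j = c k * (l * Q i1 j)) /\
  (forall k, D k = D i1 * c k + l * Q i1 k).
Proof.
move=> c1 Q1 T.
have S1 k i : D k * c i + l * Q k i = D i * c k + l * Q i k.
  by have := T k i i1; rewrite c1 !Q1 !mulr0 !addr0 !mulr1.
have S2 k i j : l * c i * Q k j = l * c k * Q i j.
  by have := T k i j; rewrite -!mulrDl S1; exact: addrI.
split=> [k j|k]; last by have := S1 k i1; rewrite c1 Q1 mulr1 mulr0 addr0.
by have := S2 k i1 j; rewrite c1 mulr1 => ->; rewrite mulrCA mulrA.
Qed.

End RankOne.

(** * Minors of the Jacobian of the Laplace map of a graph *)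

Section GraphRank.
Context {R : realType}.
Variables (n : nat) (i0 : 'I_n.+1) (A : set 'rV[R]_n) (f : 'rV[R]_n -> R).
Hypotheses (oA : open A) (sf : smooth_on A f).
Hypothesis rank1 : forall y, A y ->
  \rank ('J (laplace_form (graph_map i0 f)) y) = 1%N.

Let q := graph_curv f.
Let f1 i := partial i f.
Let f2 i j := partial i (partial j f).
Let Lg w := - (q w *: graph_normal i0 f w).

Let dq y : A y -> differentiable q y.
Proof. exact: (smooth_graph_curv oA sf 1).1. Qed.
Let df1 i y : A y -> differentiable (f1 i) y.
Proof. exact: (smooth_partial_fun sf i 1).1. Qed.
Let df2 i j y : A y -> differentiable (f2 i j) y.
Proof. exact: (smooth_partial2_fun sf i j 1).1. Qed.

Lemma differentiable_graph_curv_normal y : A y -> differentiable Lg y.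
Proof.
move=> Ay; apply: differentiableN; apply/differentiable_mxP => a k.
rewrite (ord1 a) (_ : (fun w => _) = q * (fun w => graph_normal i0 f w 0 k)).
  apply: differentiableM; first exact: dq.
  apply: ((differentiable_mxP _ _).1 _ 0 k).
  exact: (smooth_graph_normal i0 oA sf 1).1.
by apply/funext => w; rewrite mxE.
Qed.

(** Adding [f1 l] times column [i0] to column [lift i0 l] leaves q times the Hessian; the lemmas on
    minors perform this column operation implicitly. *)
Lemma jacobian_laplace_graph y i : A y ->
  (forall l, 'J (laplace_form (graph_map i0 f)) y i (lift i0 l) =
     partial i q y * f1 l y + q y * f2 i l y) /\
  'J (laplace_form (graph_map i0 f)) y i i0 = - partial i q y.
Proof.
move=> Ay; have nA : nbhs y A by exact: open_nbhs_nbhs.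
have dL := differentiable_graph_curv_normal Ay.
have -> : 'J (laplace_form (graph_map i0 f)) y = 'J Lg y.
  apply: near_eq_jacobian dL; apply: filterS nA => w Aw.
  by rewrite (laplace_form_graph i0 oA sf Aw).
split=> [l|]; apply: etrans (jacobianE _ _ dL) _; rewrite /partial.
  have -> : (fun w => Lg w 0 (lift i0 l)) = q * f1 l.
    by apply/funext => w; rewrite !mxE liftK mulrN opprK.
  apply: etrans (deriveM (diff_derivable (dq Ay)) (diff_derivable (df1 l Ay))) _.
  by apply: etrans (addrC _ _) _; congr (_ + _); exact: mulrC.
have -> : (fun w => Lg w 0 i0) = - q.
  by apply/funext => w; rewrite !mxE unlift_none mulr1.
by apply: deriveN; exact/diff_derivable/dq.
Qed.

(** Otherwise the whole Jacobian of the Laplace map would vanish at [y]. *)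
Lemma graph_curv_neq0 y : A y -> q y = 0 -> exists i, partial i q y != 0.
Proof.
move=> Ay qy0; apply: contrapT => H.
have H0 i : partial i q y = 0.
  by apply: contrapT => /eqP qi; apply: H; exists i.
have := rank1 Ay; rewrite (_ : 'J _ y = 0) ?mxrank0//.
apply/matrixP => i k; have [E1 E2] := jacobian_laplace_graph i Ay.
by have [l ->|->] := unliftP i0 k; [rewrite E1|rewrite E2];
  rewrite H0 ?qy0 ?mul0r ?addr0 ?oppr0 mxE.
Qed.

Lemma graph_curv_derive_neq0 y : A y -> q y = 0 -> exists v, 'D_v q y != 0.
Proof. by move=> Ay /(graph_curv_neq0 Ay) [i H]; exists ('e_i). Qed.

(** In the minor on the columns [lift i0 j] and [i0] the terms in [f1 j] cancel, and what remains is
    q times this identity up to sign; [mul_eq0_cancel] removes q. *)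
Lemma graph_minor1 i j k y : A y ->
  f2 i j y * partial k q y = f2 k j y * partial i q y.
Proof.
move=> Ay; apply/eqP; rewrite -subr_eq0; apply/eqP.
pose h := f2 i j * partial k q - f2 k j * partial i q.
have dqk l u : A u -> differentiable (partial l q) u.
  by have [_ H] := smooth_graph_curv oA sf 2; exact: (H _).1.
apply: (@mul_eq0_cancel _ _ A q h oA dq _ graph_curv_derive_neq0) Ay => u Au.
  by apply: differentiableB; apply: differentiableM; auto.
have := rank1_minor i k (lift i0 j) i0 (rank1 Au).
have [-> ->] := jacobian_laplace_graph i Au.
have [-> ->] := jacobian_laplace_graph k Au.
rewrite /h -[(_ - _) u]/(f2 i j u * partial k q u - f2 k j u * partial i q u).
move: (q u) (f1 j u) (f2 i j u) (f2 k j u) (partial i q u) (partial k q u).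
move=> Q F a b c d /eqP; rewrite -subr_eq0 => /eqP H.
by apply/eqP; rewrite -oppr_eq0 -H; apply/eqP; ring.
Qed.

(** The minor on the columns of [j] and [l] is q^2 times this identity, up to terms that vanish by
    [graph_minor1]. *)
Lemma graph_minor2 i j k l y : A y ->
  f2 i j y * f2 k l y = f2 i l y * f2 k j y.
Proof.
move=> Ay; apply/eqP; rewrite -subr_eq0; apply/eqP.
pose h := f2 i j * f2 k l - f2 i l * f2 k j.
have dh u : A u -> differentiable h u.
  by move=> Au; apply: differentiableB; apply: differentiableM; auto.
apply: (@mul_eq0_cancel _ _ A q h oA dq dh graph_curv_derive_neq0) Ay.
(* The factor q^2 is cancelled one q at a time. *)
pose h' := q * h.
apply: (@mul_eq0_cancel _ _ A q h' oA dq _ graph_curv_derive_neq0) => u Au.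
  by apply: differentiableM; auto.
have := rank1_minor i k (lift i0 j) (lift i0 l) (rank1 Au).
have [Ei _] := jacobian_laplace_graph i Au.
have [Ek _] := jacobian_laplace_graph k Au; rewrite !Ei !Ek.
have := graph_minor1 i j k Au; have := graph_minor1 i l k Au.
rewrite /h' /h -[(_ * _) u]/(q u * (f2 i j u * f2 k l u - f2 i l u * f2 k j u)).
move: (q u) (f1 j u) (f1 l u) (f2 i j u) (f2 k l u) (f2 i l u) (f2 k j u)
  (partial i q u) (partial k q u).
move=> Q Fj Fl aij akl ail akj qi qk H1 H2 /eqP; rewrite -subr_eq0 => /eqP H.
apply/eqP; rewrite -H; apply/eqP.
transitivity (Q * (Q * (aij * akl - ail * akj)) + Q * Fl * (aij * qk - akj * qi)
  - Q * Fj * (ail * qk - akl * qi)); last by ring.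
by rewrite H1 H2 !subrr !mulr0 addr0 subr0.
Qed.

Lemma hess_sym i j y : A y -> f2 i j y = f2 j i y.
Proof. by move=> Ay; exact: (Schwarz _ _ oA Ay (sf 2)). Qed.

(* Either the Hessian or the gradient of q is nonzero at y0; any nonzero column
   of either spans the common rank-one direction and, normalized by one entry,
   depends smoothly on the point. *)
Lemma rank1_direction y0 : A y0 -> exists (i1 : 'I_n) (rho : R)
    (r : 'I_n -> 'rV[R]_n -> R),
  [/\ 0 < rho, ball y0 rho `<=` A, (forall i, smooth_on (ball y0 rho) (r i)) &
      forall y, ball y0 rho y -> [/\ r i1 y = 1,
        forall i j, f2 i j y = f2 i1 i1 y * r i y * r j y &
        forall i, partial i q y = partial i1 q y * r i y]].
Proof.
move=> Ay0.
have [i1 [c [sc c0 cf cq]]] : exists i1 (c : 'I_n -> 'rV[R]_n -> R),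
   [/\ forall i, smooth_on A (c i), c i1 y0 != 0,
       forall y i j, A y -> f2 i j y * c i1 y * c i1 y = f2 i1 i1 y * c i y * c j y &
       forall y i, A y -> partial i q y * c i1 y = partial i1 q y * c i y].
  have [[i1 q1]|noq] := pselect (exists i, partial i q y0 != 0).
    exists i1, (fun i => partial i q); split; [|exact: q1| |].
    - by move=> i k; have [_] := smooth_graph_curv oA sf k.+1; apply.
    - move=> y i j Ay; have H : forall a b c d e g h : R, a * g = c * e ->
        c = d -> d * g = b * h -> a * g * g = b * e * h.
        by move=> a b c d e g h -> -> H; rewrite mulrAC H; ring.
      exact: (H _ _ _ _ _ _ _ (graph_minor1 i j i1 Ay) (hess_sym i1 j Ay)
        (graph_minor1 j i1 i1 Ay)).
    - by move=> y i Ay; exact: mulrC.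
  have qy0 : q y0 != 0.
    by apply/negP => /eqP /(graph_curv_neq0 Ay0).
  (* If the diagonal of the Hessian were zero, [graph_minor2] and symmetry would kill the other
     entries too, and the formula for q would give [q y0 = 0]. *)
  have [i1 f11] : exists i, f2 i i y0 != 0.
    apply: contrapT => noi.
    have fii i : f2 i i y0 = 0.
      by apply: contrapT => /eqP fi; apply: noi; exists i.
    have fij i j : f2 i j y0 = 0.
      have H : forall a b c d : R, a = 0 -> a * b = c * d -> d = c -> c = 0.
        move=> a b c d a0 H dc; move: H; rewrite a0 dc mul0r => /esym/eqP.
        by rewrite mulf_eq0 orbb => /eqP.
      exact: (H _ _ _ _ (fii i) (graph_minor2 i i j j Ay0) (hess_sym j i Ay0)).
    have E1 : \sum_i f2 i i y0 = 0 by apply: big1 => i _; exact: fii.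
    have E2 : \sum_i \sum_j f1 i y0 * f1 j y0 * f2 i j y0 = 0.
      apply: big1 => i _; apply: big1 => j _.
      exact: etrans (congr1 ( *%R _) (fij i j)) (mulr0 _).
    move: qy0; rewrite (_ : q y0 = 0) ?eqxx//.
    transitivity ((graph_area2 f y0 * 0 - 0) / graph_area2 f y0 ^+ 2).
      exact: (congr2 (fun a b => (graph_area2 f y0 * a - b) / _ ^+ 2) E1 E2).
    by rewrite mulr0 subrr mul0r.
  exists i1, (fun i => f2 i i1); split; [|exact: f11| |].
  - by move=> i; exact: smooth_partial2_fun.
  - move=> y i j Ay; have H : forall a b c d e : R, a * b = c * d -> d = e ->
      a * b * b = b * c * e by move=> a b c d e -> ->; ring.
    exact: (H _ _ _ _ _ (graph_minor2 i j i1 i1 Ay) (hess_sym i1 j Ay)).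
  - move=> y i Ay; have H : forall a b c d : R, a * b = c * d -> b * a = d * c.
      by move=> a b c d H; rewrite mulrC H mulrC.
    exact: (H _ _ _ _ (graph_minor1 i1 i1 i Ay)).
have nA : nbhs y0 A by exact: open_nbhs_nbhs.
have : nbhs y0 (A `&` [set y | c i1 y != 0]).
  apply: filterI => //; have cc := sc i1 0%N y0 Ay0.
  exact: cvgr_neq0 cc c0.
case/nbhs_ballP => rho /= rho0 H.
exists i1, rho, (fun i y => c i y / c i1 y); split => //.
- by move=> y /H [].
- move=> i k; have BA : ball y0 rho `<=` A by move=> y /H [].
  have oB : open (ball y0 rho) by exact: ball_open.
  apply: Ck_onM => //; first exact: Ck_on_sub (sc i k).
  apply: Ck_onV => //; first by move=> y /H [].
  exact: Ck_on_sub (sc i1 k).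
- move=> y /H [Ay /= cy]; split.
  + by rewrite divff.
  + move=> i j; apply: (mulIf cy); apply: (mulIf cy); rewrite cf//.
    by field.
  + move=> i; have E : forall a b d e : R, a * b = d * e -> b != 0 -> a = d * (e / b).
      by move=> a b d e ab b0; apply: (mulIf b0); rewrite ab mulrA mulfVK.
    exact: (E _ _ _ _ (cq y i Ay) cy).
Qed.

(** * Constancy of the common direction *)

Section Direction.
Variables (y0 : 'rV[R]_n) (i1 : 'I_n) (rho : R) (r : 'I_n -> 'rV[R]_n -> R).
Hypotheses (rho0 : 0 < rho) (BA : ball y0 rho `<=` A).
Hypothesis sr : forall i, smooth_on (ball y0 rho) (r i).
Hypothesis r1 : forall y, ball y0 rho y -> r i1 y = 1.
Hypothesis f2E : forall y, ball y0 rho y ->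
  forall i j, f2 i j y = f2 i1 i1 y * r i y * r j y.
Hypothesis qE : forall y, ball y0 rho y ->
  forall i, partial i q y = partial i1 q y * r i y.

Let la := f2 i1 i1.
Let oB : open (ball y0 rho). Proof. exact: ball_open. Qed.
Let dr i y : ball y0 rho y -> differentiable (r i) y.
Proof. exact: (sr i 1).1. Qed.

Let partial_r1 k y : ball y0 rho y -> partial k (r i1) y = 0.
Proof.
move=> By; have nB : nbhs y (ball y0 rho) by exact: open_nbhs_nbhs.
transitivity (partial k (cst (1 : R) : 'rV[R]_n -> R) y); last exact: derive_cst.
by apply: near_eq_derive; apply: filterS nB => w Bw; rewrite /cst r1.
Qed.

Let partial_f2 k i j y : ball y0 rho y -> partial k (f2 i j) y =
  partial k la y * r i y * r j y + la y * partial k (r i) y * r j y +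
  la y * r i y * partial k (r j) y.
Proof.
move=> By; have nB : nbhs y (ball y0 rho) by exact: open_nbhs_nbhs.
transitivity (partial k (la * r i * r j) y).
  by apply: near_eq_derive; apply: filterS nB => w Bw; exact: f2E.
have dla := df2 i1 i1 (BA By).
have d1 := diff_derivable (differentiableM dla (dr i By)) : derivable _ _ ('e_k).
apply: etrans (deriveM d1 (diff_derivable (dr j By))) _.
rewrite (deriveM (diff_derivable dla) (diff_derivable (dr i By))).
rewrite -/(partial k la y) -/(partial k (r i) y) -/(partial k (r j) y).
rewrite -![_ *: _]/(_ * _) -[(la * r i) y]/(la y * r i y).
by move: (partial k la y) (partial k (r i) y) (partial k (r j) y) => a b c; rewrite /la; ring.
Qed.

(* Symmetry of the third derivatives of f; the entry j = i1 of the direction is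
   constant, which isolates the derivative of the coefficient la. *)
Let codazzi y : ball y0 rho y ->
  (forall k j, la y * partial k (r j) y = r k y * (la y * partial i1 (r j) y)) /\
  (forall k, partial k la y = partial i1 la y * r k y + la y * partial i1 (r k) y).
Proof.
move=> By; have Ay := BA By.
have T k i j : partial k (f2 i j) y = partial i (f2 k j) y.
  have sfj : smooth_on A (f1 j) by exact: smooth_partial_fun.
  exact: (Schwarz _ _ oA Ay (sfj 2)).
apply: (@codazzi_algebra R n (fun k => partial k la y)
  (fun k j => partial k (r j) y) (fun k => r k y) (la y) i1).
- exact: r1.
- by move=> k; exact: partial_r1.
- move=> k i j.
  exact: (etrans (esym (partial_f2 k i j By)) (etrans (T k i j) (partial_f2 i k j By))).
Qed.

(** W^2 q is linear in the Hessian; on la r r^T it is [la] times a factor that [area_pos] shows to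
    be positive, so [la] and [q] have the same zeros. *)
Let area_curv y : ball y0 rho y -> graph_area2 f y ^+ 2 * q y = la y *
  (graph_area2 f y * (\sum_i r i y * r i y) -
   (\sum_i f1 i y * r i y) * (\sum_i f1 i y * r i y)).
Proof.
move=> By; have W0 : graph_area2 f y ^+ 2 != 0.
  by rewrite expf_neq0// gt_eqF// graph_area2_gt0.
rewrite /q /graph_curv mulrC divfK// mulrBr; congr (_ - _).
  rewrite mulrCA; congr (_ * _); rewrite mulr_sumr; apply: eq_bigr => i _.
  by apply: etrans (f2E By i i) _; rewrite mulrA.
rewrite mulr_suml mulr_sumr; apply: eq_bigr => i _.
rewrite !mulr_sumr; apply: eq_bigr => j _.
apply: etrans (congr1 ( *%R _) (f2E By i j)) _.
have E (a b c d e : R) : a * b * (c * d * e) = c * (a * d * (b * e)) by ring.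
exact: E.
Qed.

(** This is |r|^2 plus the Cauchy-Schwarz defect of grad f and r, and |r| >= 1 because the entry
    [i1] of r is 1. *)
Let area_pos y : ball y0 rho y ->
  0 < graph_area2 f y * (\sum_i r i y * r i y) -
   (\sum_i f1 i y * r i y) * (\sum_i f1 i y * r i y).
Proof.
move=> By; set rr := \sum_i r i y * r i y; set fr := \sum_i f1 i y * r i y.
have rr0 : 0 < rr.
  rewrite /rr (bigD1 i1)//= r1// mulr1 ltr_pwDl// sumr_ge0// => i _.
  by rewrite -expr2 sqr_ge0.
rewrite /graph_area2; set ff := \sum_i _.
have : fr * fr <= ff * rr by exact: sum_cauchy_schwarz.
by lra.
Qed.

(** The symmetry of third derivatives leaves the derivatives of r along ['e_i1] undetermined; the
    constancy of q along the kernel of r supplies the missing equation. *)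
Lemma partial_direction k j y : ball y0 rho y -> partial k (r j) y = 0.
Proof.
apply: (@mul_eq0_cancel _ _ (ball y0 rho) q _ oB) => {y}.
- by move=> y /BA; exact: dq.
- by move=> y By; have [_ H] := sr j 2; exact: (H _).1.
- by move=> y /BA; exact: graph_curv_derive_neq0.
move=> y By; have Ay := BA By; have [S2 S1] := codazzi By.
(* [area_curv] lets the factor q be traded for [la]. *)
suff laj : la y * partial k (r j) y = 0.
  have W0 : graph_area2 f y ^+ 2 != 0.
    by rewrite expf_neq0// gt_eqF// graph_area2_gt0.
  apply: (mulfI W0); rewrite mulr0 mulrA area_curv//.
  by rewrite mulrAC laj mul0r.
have [->|la0] := eqVneq (la y) 0; first by rewrite mul0r.
suff sk l : la y * partial i1 (r l) y = 0 by rewrite S2 sk mulr0.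
(* The vectors [v] span the kernel of r at [y]; along them grad f, q and, since [la y] is nonzero, r
   are stationary. *)
move: l => {}k; pose v := 'e_k - r k y *: 'e_i1 : 'rV[R]_n.
have Dv (h : 'rV[R]_n -> R) : differentiable h y ->
    'D_v h y = partial k h y - r k y * partial i1 h y.
  move=> dh; rewrite (deriveE _ dh) /v linearB linearZ /=.
  by rewrite -!(deriveE _ dh).
have Z (h : 'rV[R]_n -> R) : differentiable h y ->
    partial k h y = r k y * partial i1 h y -> is_derive y v h 0.
  move=> dh E; split; first exact: diff_derivable.
  by rewrite Dv// E subrr.
have Zf i : is_derive y v (f1 i) 0.
  apply: Z; first exact: df1.
  apply: etrans (f2E By k i) _; apply: etrans _ (esym (congr1 ( *%R _) (f2E By i1 i))).
  by rewrite r1//; ring.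
have Zr i : is_derive y v (r i) 0.
  apply: Z; first exact: dr.
  by apply: (mulfI la0); rewrite S2 mulrCA.
have Zq : is_derive y v q 0.
  apply: Z; first exact: dq.
  by apply: etrans (qE By k) (mulrC _ _).
have ZW : is_derive y v (graph_area2 f) 0.
  have -> : graph_area2 f = cst 1 + (fun u => \sum_i f1 i u * f1 i u).
    by apply/funext => u; rewrite /graph_area2; congr (_ + _).
  have := is_derive0_sum (fun i => is_derive0_mul (Zf i) (Zf i)) => Zs.
  by apply: is_derive_eq; rewrite addr0.
pose P := fun u => graph_area2 f u * (\sum_i r i u * r i u) -
   (\sum_i f1 i u * r i u) * (\sum_i f1 i u * r i u).
have ZP : is_derive y v P 0.
  have H1 := is_derive0_mul ZW (is_derive0_sum (fun i => is_derive0_mul (Zr i) (Zr i))).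
  have H2 := is_derive0_sum (fun i => is_derive0_mul (Zf i) (Zr i)).
  have H3 := is_derive0_mul H2 H2.
  have := is_deriveB H1 H3; rewrite subr0; exact.
have ZL : is_derive y v (fun u => graph_area2 f u ^+ 2 * q u) 0.
  have := is_derive0_mul (is_derive0_mul ZW ZW) Zq; congr (is_derive _ _ _ _).
have nB : nbhs y (ball y0 rho) by exact: open_nbhs_nbhs.
have dla := df2 i1 i1 Ay.
(* As [P] is stationary along [v], the product rule makes [P y] times ['D_v la y] vanish, and
   [codazzi] identifies ['D_v la y] with [la y * partial i1 (r k) y]. *)
have : 'D_v (la * P) y = 0.
  rewrite -(@derive_val _ _ _ _ _ _ _ ZL); apply: near_eq_derive.
  by apply: filterS nB => w Bw; rewrite area_curv.
rewrite deriveM; [|exact: diff_derivable|exact: (@ex_derive _ _ _ _ _ _ _ ZP)].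
rewrite (@derive_val _ _ _ _ _ _ _ ZP) scaler0 add0r Dv// S1.
rewrite (mulrC (r k y)) addrC addKr => /eqP; rewrite mulf_eq0.
by rewrite (gt_eqF (area_pos By)) /= => /eqP.
Qed.

Hypothesis df0 : forall i, f1 i y0 = 0.

Lemma direction_eq y i : ball y0 rho y -> r i y = r i y0.
Proof.
move=> By; have B0 : ball y0 rho y0 by exact: ballxx.
apply: (derive0_const_ball _ _ By B0) => [u|u v Bu]; first exact: dr.
rewrite derive_rowE ?big1 => [//|l _|]; last exact: dr.
by rewrite partial_direction// scaler0.
Qed.

(** For v = z - y orthogonal to r, the derivative of [f] along v has gradient la (r . v) r = 0,
    hence is constant; it is zero at [y0] because grad f is. *)
Lemma eq_along_direction y z : ball y0 rho y -> ball y0 rho z ->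
  \sum_i r i y0 * y 0 i = \sum_i r i y0 * z 0 i -> f y = f z.
Proof.
move=> By Bz yz; pose v := z - y; pose h := fun w => \sum_i v 0 i * f1 i w.
have rv w : ball y0 rho w -> \sum_i r i w * v 0 i = 0.
  move=> Bw; under eq_bigr => i _ do rewrite (direction_eq i Bw) !mxE mulrBr.
  by rewrite sumrB yz subrr.
have dfi i w : ball y0 rho w -> differentiable (fun w => v 0 i * f1 i w) w.
  move=> /BA Aw; apply: (@differentiableM _ _ (cst (v 0 i)) (f1 i)).
    exact: differentiable_cst.
  exact: df1.
have dh w : ball y0 rho w -> differentiable h w.
  move=> Bw; rewrite /h (_ : (fun w => _) = \sum_i (fun w => v 0 i * f1 i w)).
    by apply: differentiable_sum => i; exact: dfi.
  by apply/funext => u; rewrite fct_sumE.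
have Dh w k : ball y0 rho w -> partial k h w = 0.
  move=> Bw; have Aw := BA Bw.
  transitivity (partial k (\sum_i (fun w => v 0 i * f1 i w)) w).
    by congr (partial k _ w); apply/funext => u; rewrite fct_sumE.
  apply: etrans (derive_sum _) _ => [i|]; first exact/diff_derivable/dfi.
  transitivity (\sum_i la w * r k w * (r i w * v 0 i)); last first.
    by rewrite -mulr_sumr rv// mulr0.
  apply: eq_bigr => i _.
  have -> : (fun w => v 0 i * f1 i w) = v 0 i *: f1 i by [].
  apply: etrans (deriveZ _ (diff_derivable (df1 i Aw))) _.
  apply: etrans (congr1 ( *:%R _) (f2E Bw k i)) _.
  by rewrite -[_ *: _]/(_ * _) -/(la w); ring.
have h0 w : ball y0 rho w -> h w = 0.
  move=> Bw; have B0 : ball y0 rho y0 by exact: ballxx.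
  transitivity (h y0); last by rewrite /h big1// => i _; rewrite df0 mulr0.
  apply: (derive0_const_ball _ _ Bw B0) => [u|u v' Bu]; first exact: dh.
  rewrite derive_rowE ?big1 => [//|l _|]; last exact: dh.
  by rewrite Dh// scaler0.
have df u : A u -> differentiable f u by exact: (sf 1).1.
apply/eqP; rewrite eq_sym -subr_eq0; apply/eqP.
have [t t01|t /andP[t0 t1] ->] := @mean_value1 _ _ f y z.
  by apply/df/BA; exact: ball_segment.
have Bt : ball y0 rho (y + t *: (z - y)) by apply: ball_segment => //; rewrite !ltW.
rewrite derive_rowE; last exact/df/BA.
exact: (h0 _ Bt).
Qed.

End Direction.

Lemma graph_rank1_cylindrical y0 : A y0 -> (forall i, partial i f y0 = 0) ->
  exists (rho : R) (a : 'rV[R]_n), [/\ 0 < rho, ball y0 rho `<=` A,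
    dotv a a = 1 & forall y z, ball y0 rho y -> ball y0 rho z ->
      dotv a y = dotv a z -> f y = f z].
Proof.
move=> Ay0 df0; have [i1 [rho [r [rho0 BA sr H]]]] := rank1_direction Ay0.
have r1 y : ball y0 rho y -> r i1 y = 1 by move=> /H [].
have f2E y : ball y0 rho y -> forall i j, f2 i j y = f2 i1 i1 y * r i y * r j y.
  by move=> /H [].
have qE y : ball y0 rho y -> forall i, partial i q y = partial i1 q y * r i y.
  by move=> /H [].
pose b : 'rV[R]_n := \row_i r i y0.
have b0 : b != 0.
  apply/eqP => /rowP/(_ i1); rewrite !mxE r1; last exact: ballxx.
  by move/eqP; rewrite oner_eq0.
have bb0 := dotvv_gt0 b0.
pose c := (Num.sqrt (dotv b b))^-1.
have c0 : c != 0 by rewrite invr_eq0 gt_eqF// sqrtr_gt0.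
have dotZ (z : 'rV[R]_n) : dotv (c *: b) z = c * dotv b z.
  by rewrite /dotv mulr_sumr; apply: eq_bigr => i _; rewrite !mxE mulrA.
exists rho, (c *: b); split => //.
  rewrite dotZ (_ : dotv b (c *: b) = c * dotv b b); last first.
    by rewrite /dotv mulr_sumr; apply: eq_bigr => i _; rewrite !mxE mulrCA.
  rewrite mulrA -(sqr_sqrtr (ltW bb0)) -expr2 /c -exprMn mulVf ?expr1n//.
  by rewrite gt_eqF// sqrtr_gt0.
move=> y z By Bz; rewrite !dotZ => /(mulfI c0) byz.
apply: (eq_along_direction rho0 BA sr r1 f2E qE df0 By Bz).
move: byz; rewrite /dotv; under eq_bigr do rewrite mxE.
by under [RHS]eq_bigr do rewrite mxE.
Qed.

End GraphRank.

(** * Orthogonal matrices, primitives and the rank along a cylinder *)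

Section EuclideanAlgebra.
Context {R : realType}.

Lemma mxrank_outer (F : fieldType) m n (c : 'cV[F]_m) (d : 'rV[F]_n) :
  c != 0 -> \rank (c *m d) = (d != 0) :> nat.
Proof.
move=> c0; have [->|d0] := eqVneq d 0; first by rewrite mulmx0 mxrank0.
have rd : \rank d = 1%N.
  by apply/eqP; rewrite eqn_leq rank_leq_row lt0n mxrank_eq0.
have rc : \rank c = 1%N.
  by apply/eqP; rewrite eqn_leq rank_leq_col lt0n mxrank_eq0.
by rewrite mxrankMfree// /row_free rd.
Qed.

Lemma mxrank_unit_conj m n (P : 'M[R]_m) (M : 'M[R]_(m, n)) (Q : 'M[R]_n) :
  P \in unitmx -> Q \in unitmx -> \rank (P *m M *m Q) = \rank M.
Proof.
by move=> uP uQ; rewrite mxrankMfree ?row_free_unit// (eqmxMfull _ _) ?row_full_unit.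
Qed.

Lemma orthogonal_unitmx n (Q : 'M[R]_n) : Q *m Q^T = 1%:M ->
  Q \in unitmx /\ Q^T *m Q = 1%:M.
Proof. by move=> QQ; have [uQ _] := mulmx1_unit QQ; split => //; exact: mulmx1C. Qed.

(** The reflection exchanging [a] and [e]: with v = a - e it is 1 - 2 v^T v / |v|^2. The case
    [a = e], where v = 0, is set apart. *)
Lemma householder n (a e : 'rV[R]_n) : dotv a a = 1 -> dotv e e = 1 ->
  exists2 Q : 'M[R]_n, Q *m Q^T = 1%:M & a *m Q = e.
Proof.
move=> aa ee; have [->|ae] := eqVneq a e.
  by exists 1%:M; rewrite ?trmx1 mulmx1.
move vE: (a - e) => v; have v0 : v != 0 by rewrite -vE subr_eq0.
have vv0 := dotvv_gt0 v0; pose c := 2 / dotv v v.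
have cv : c * dotv v v = 2 by rewrite /c divfK// gt_eqF.
have vvE : v *m v^T = (dotv v v)%:M.
  by apply/matrixP => i j; rewrite !ord1 -dotvE mxE eqxx.
exists (1%:M - c *: (v^T *m v)).
  have -> : (1%:M - c *: (v^T *m v))^T = 1%:M - c *: (v^T *m v).
    by rewrite linearB /= linearZ /= trmx1 trmx_mul trmxK.
  have MM : v^T *m v *m (v^T *m v) = dotv v v *: (v^T *m v).
    by rewrite -mulmxA (mulmxA v) vvE mul_scalar_mx -scalemxAr.
  move: (v^T *m v) MM => M MM.
  rewrite mulmxBl mul1mx mulmxBr mulmx1 -!scalemxAl -!scalemxAr MM !scalerA.
  have -> : c * c * dotv v v = c + c by rewrite -mulrA cv; ring.
  by rewrite scalerDl opprB addrK subrK.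
(* Equal lengths give a . v = |v|^2 / 2, so the reflection subtracts exactly v from [a]. *)
have av : a *m v^T = (dotv v v / 2)%:M.
  apply/matrixP => i j; rewrite !ord1 -dotvE mxE eqxx mulr1n.
  have bil (x y z : 'rV[R]_n) : dotv x (y - z) = dotv x y - dotv x z.
    by rewrite /dotv -sumrB; apply: eq_bigr => l _; rewrite !mxE mulrBr.
  have symd (x y : 'rV[R]_n) : dotv x y = dotv y x.
    by apply: eq_bigr => l _; rewrite mulrC.
  have e1 : dotv a v = 1 - dotv a e by rewrite -vE bil aa.
  have e2 : dotv e v = dotv a e - 1 by rewrite -vE bil ee (symd e a).
  have e3 : dotv v v = dotv a v - dotv e v.
    by rewrite (symd a) (symd e) -bil vE.
  by rewrite e3 e1 e2; lra.
rewrite mulmxBr mulmx1 -scalemxAr mulmxA av mul_scalar_mx scalerA mulrA cv.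
by rewrite divff// scale1r -vE opprB addrCA subrr addr0.
Qed.

Lemma unit_normal m n (J : 'M[R]_(m, n)) : (m < n)%N ->
  exists2 N : 'rV[R]_n, dotv N N = 1 & N *m J^T = 0.
Proof.
move=> mn; have [i Ni] : exists i, row i (kermx J^T) != 0.
  have : ~~ (kermx J^T <= (0 : 'M[R]_n))%MS.
    rewrite submx0 kermx_eq0 /row_free mxrank_tr.
    by apply: contraL mn => /eqP <-; rewrite -leqNgt rank_leq_row.
  by case/row_subPn => i; rewrite submx0; exists i.
have NJ : row i (kermx J^T) *m J^T = 0 by rewrite -row_mul mulmx_ker row0.
move: (row i _) Ni NJ => N N0 NJ; have NN0 := dotvv_gt0 N0.
pose c := (Num.sqrt (dotv N N))^-1; exists (c *: N); last first.
  by rewrite -scalemxAl NJ scaler0.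
have -> : dotv (c *: N) (c *: N) = c ^+ 2 * dotv N N.
  by rewrite /dotv mulr_sumr; apply: eq_bigr => l _; rewrite !mxE; ring.
rewrite -(sqr_sqrtr (ltW NN0)) /c -exprMn mulVf ?expr1n//.
by rewrite gt_eqF// sqrtr_gt0.
Qed.

End EuclideanAlgebra.

(** * Smooth primitives on an interval *)

Section Primitive.
Context {R : realType}.

(** Integrating from the left end of the smaller interval lets one integral over [[a, t]] serve
    every point; halving the radius keeps the closed segment inside the ball, where [g] is
    continuous, hence integrable. *)
Lemma smooth_primitive (g : R -> R) (c r : R) : 0 < r -> smooth_on (ball c r) g ->
  exists2 s : R -> R, smooth_on (ball c (r / 2)) s &
    forall t, ball c (r / 2) t -> 'D_1 s t = g t.
Proof.
move=> r0 sg; pose a := c - r / 2; pose b := c + r / 2.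
have cg t : a <= t <= b -> {for t, continuous g}.
  move=> tab; apply: (sg 0%N); rewrite -ball_normE /ball_/= ltr_distl.
  by move: tab; rewrite /a /b; lra.
have ig : (@lebesgue_measure R).-integrable `[a, b] (EFin \o g).
  apply: continuous_compact_integrable; first exact: segment_compact.
  apply: continuous_in_subspaceT => t; rewrite inE/= in_itv/=; exact: cg.
pose s t := (\int[@lebesgue_measure R]_(x in [set` `[a, t]]) g x)%R.
have Ds t : ball c (r / 2) t -> derivable s t 1 /\ derive1 s t = g t.
  rewrite -ball_normE /ball_/= ltr_distl => /andP[t1 t2].
  have bt : t < b by rewrite /b; lra.
  have at' : a < t by rewrite /a; lra.
  by apply: (continuous_FTC1_closed bt ig at'); apply: cg; rewrite !ltW.
exists s; last by move=> t /Ds [_]; rewrite derive1E.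
have oB : open (ball c (r / 2)) by exact: ball_open.
have ds t : ball c (r / 2) t -> differentiable s t.
  by move=> /Ds [d _]; exact/derivable1_diffP.
case=> [|k]; first by move=> t /ds; exact: differentiable_continuous.
split=> // v; apply: (@Ck_on_eq _ _ _ _ _ (fun t => v * g t)) => //.
  move=> t Bt; rewrite -(Ds t Bt).2 derive1E !(deriveE _ (ds t Bt)).
  have := linearZZ ('d s t) v (1 : R); rewrite -[v *: (1 : R)]/(v * 1) mulr1.
  by move=> ->.
apply: Ck_onM => //; first exact: Ck_on_cst.
by apply: Ck_on_sub (sg k) => t; apply: le_ball; lra.
Qed.

End Primitive.

(** * Rank of the Laplace map of a hypercylinder in arbitrary coordinates *)

Section CylinderRank.
Context {R : realType}.

Lemma smooth_mulmxr n k l (A : set 'rV[R]_n) (X : 'rV[R]_n -> 'rV[R]_k)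
    (Q : 'M[R]_(k, l)) : open A -> smooth_on A X ->
  smooth_on A (fun w => X w *m Q).
Proof. by move=> oA sX j; apply: Ck_on_mulmx => //; exact: Ck_on_cst. Qed.

Lemma jacobian_mulmxr n k l (X : 'rV[R]_n -> 'rV[R]_k) (Q : 'M[R]_(k, l)) u :
  differentiable X u -> 'J (fun w => X w *m Q) u = 'J X u *m Q.
Proof.
move=> dX; have d := differentiable_mulmxr Q dX.
apply/row_matrixP => i; rewrite row_mul; apply: etrans (row_jacobian i d) _.
apply: etrans (derive_mulmxr Q _ dX) _.
by congr (_ *m Q); exact/esym/row_jacobian.
Qed.

(** The Jacobian is a column, the gradient of the first coordinate of [Psi], times a row, minus the
    third derivative of [beta] rotated by [Q]. An equality with a boolean serves both directions:
    rank one from 3-regularity, and 3-regularity from rank one. *)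
Lemma rank_laplace_cylinder m (V : set 'rV[R]_(1 + m)) (I : set R)
    (beta : R -> 'rV[R]_2) (Psi : 'rV[R]_(1 + m) -> 'rV[R]_(1 + m))
    (X : 'rV[R]_(1 + m) -> 'rV[R]_(2 + m)) (Q : 'M[R]_(2 + m)) b u :
  open V -> open I -> smooth_on V Psi -> smooth_on I beta ->
  (forall s, I s -> dotv (derive1n 1 beta s) (derive1n 1 beta s) = 1) ->
  (forall w, V w -> 'J Psi w \in unitmx) ->
  (forall w, V w -> I (Psi w 0 0)) -> Q *m Q^T = 1%:M ->
  (forall w, V w -> X w = hypercylinder beta (Psi w) *m Q + b) -> V u ->
  \rank ('J (laplace_form X) u) = (derive1n 3 beta (Psi u 0 0) != 0) :> nat.
Proof.
move=> oV oI sPsi sb arc uPsi VI QQ XE Vu.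
have [uQ _] := orthogonal_unitmx QQ.
pose cyl := [set w : 'rV[R]_(1 + m) | I (w 0 0)].
have oC : open cyl by exact: cylinder_open.
have sH := @smooth_hypercylinder R m I beta oI sb.
pose Y w := hypercylinder beta w *m Q + b.
have sY : smooth_on cyl Y.
  by move=> k; apply: Ck_onD => //; [exact: smooth_mulmxr|exact: Ck_on_cst].
have dH w : cyl w -> differentiable (@hypercylinder R m beta) w.
  by exact: (sH 1%N).1.
have fY w : cyl w -> row_free ('J Y w).
  move=> Cw; have -> : 'J Y w = 'J (@hypercylinder R m beta) w *m Q.
    have d1 := dH w Cw; have d := differentiable_mulmxr Q d1.
    have dY : differentiable Y w by exact: (sY 1%N).1.
    apply/row_matrixP => i; rewrite row_mul; apply: etrans (row_jacobian i dY) _.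
    apply: etrans (deriveD (diff_derivable d) (derivable_cst _ _ _)) _.
    apply: etrans (congr2 +%R (derive_mulmxr Q _ d1) (derive_cst _ _ _)) _.
    by rewrite addr0; congr (_ *m Q); exact/esym/row_jacobian.
  rewrite /row_free mxrankMfree ?row_free_unit// -/(row_free _).
  apply/row_freeP; exists ('J (@hypercylinder R m beta) w)^T.
  exact: (gram_hypercylinder oI sb).
pose h w := - (row_mx (derive1n 2 beta (Psi w 0 0)) (0 : 'rV[R]_m) *m Q).
have LE w : V w -> laplace_form X w = h w.
  move=> Vw; rewrite (@laplace_form_comp _ _ _ V cyl Psi X Y)//.
  - rewrite (@laplace_form_rigid _ _ _ cyl)//; last exact: VI.
    by rewrite (laplace_form_hypercylinder oI sb)// ?mulNmx//; exact: VI.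
  - exact: uPsi.
  - by apply: fY; exact: VI.
have nV : nbhs u V by exact: open_nbhs_nbhs.
have dPsi : differentiable Psi u by exact: (sPsi 1%N).1.
have dPsi0 : differentiable (fun w => Psi w 0 0) u.
  exact: (differentiable_mxP _ _).1 dPsi 0 0.
have db : differentiable (derive1n 2 beta) (Psi u 0 0).
  by apply: (smooth_derive1n 2 sb 1%N).1; exact: VI.
have dbP : differentiable (fun w => derive1n 2 beta (Psi w 0 0)) u.
  exact: (@differentiable_comp _ _ _ _ (fun w => Psi w 0 0) (derive1n 2 beta)).
have dr := differentiable_row_mx dbP (differentiable_cst (0 : 'rV[R]_m) u).
have drQ := differentiable_mulmxr Q dr.
have dh : differentiable h u by exact: differentiableN.
have -> : 'J (laplace_form X) u = 'J h u.
  by apply: near_eq_jacobian dh; apply: filterS nV => w Vw; rewrite LE.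
have -> : 'J h u = col 0 ('J Psi u) *m
    (row_mx (- derive1n 3 beta (Psi u 0 0)) 0 *m Q).
  apply/row_matrixP => i; apply: etrans (row_jacobian i dh) _.
  apply: etrans (deriveN (diff_derivable drQ)) _.
  apply: etrans (congr1 -%R (derive_mulmxr Q _ dr)) _.
  apply: etrans (congr1 (fun M => - (M *m Q)) (derive_row_mx _ dbP
    (differentiable_cst (0 : 'rV[R]_m) u))) _.
  apply: etrans (congr2 (fun M N => - (row_mx M N *m Q))
    (derive_comp_curve _ dPsi0 db) (derive_cst _ _ _)) _.
  rewrite row_mul mulmxA -mulNmx; congr (_ *m Q).
  rewrite opp_row_mx oppr0 -scalerN.
  have -> : row i (col 0 ('J Psi u)) = ('D_('e_i) (fun w => Psi w 0 0) u)%:M.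
    apply/matrixP => a l; rewrite !ord1 [RHS]mxE eqxx mulr1n mxE mxE.
    exact: jacobianE.
  rewrite mul_scalar_mx scale_row_mx scaler0; congr (row_mx (_ *: - _) _).
rewrite mxrank_outer.
  congr (nat_of_bool (~~ _)).
  apply/eqP/eqP => [E|->]; last by rewrite oppr0 row_mx0 mul0mx.
  have : row_mx (- derive1n 3 beta (Psi u 0 0)) (0 : 'rV[R]_m) = 0.
    by apply: (can_inj (mulmxK uQ)); rewrite E mul0mx.
  by rewrite -[RHS]row_mx0 => /eq_row_mx [/eqP]; rewrite oppr_eq0 => /eqP.
(* A zero column in the invertible Jacobian of [Psi] would force a basis vector to be zero. *)
apply/eqP => c0; have := uPsi u Vu.
have : 'J Psi u *m (delta_mx 0 0 : 'rV[R]_(1 + m))^T = 0.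
  by rewrite trmx_delta -colE.
move=> H uJ; have : (delta_mx 0 0 : 'rV[R]_(1 + m))^T = 0.
  by rewrite -(mulKmx uJ (delta_mx 0 0)^T) H mulmx0.
by move=> /matrixP/(_ 0 0)/eqP; rewrite !mxE !eqxx oner_eq0.
Qed.

End CylinderRank.

(** * Local reduction to a graph *)

Section LocalGraph.
Context {R : realType}.
Variable n : nat.
Variable i0 : 'I_n.+1.

(** Right multiplication by this matrix drops the coordinate [i0]. *)
Definition forget_mx : 'M[R]_(n.+1, n) := \matrix_(k, j) (k == lift i0 j)%:R.

Lemma mul_forget_mx p (M : 'M[R]_(p, n.+1)) a j :
  (M *m forget_mx) a j = M a (lift i0 j).
Proof.
rewrite mxE (bigD1 (lift i0 j))//= mxE eqxx mulr1 big1 ?addr0// => k kj.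
by rewrite mxE (negbTE kj) mulr0.
Qed.

Lemma forget_mxK : forget_mx^T *m forget_mx = 1%:M.
Proof.
apply/matrixP => a j; rewrite mul_forget_mx !mxE.
by rewrite (inj_eq (@lift_inj _ i0)) eq_sym.
Qed.

Lemma forget_mx_eq0 (v : 'rV[R]_n.+1) :
  v *m forget_mx = 0 -> v *m delta_mx i0 (0 : 'I_1) = 0 -> v = 0.
Proof.
move=> v1 v2; apply/rowP => k; rewrite mxE; have [j ->|->] := unliftP i0 k.
  by move/rowP/(_ j): v1; rewrite mul_forget_mx mxE.
by move/rowP/(_ 0): v2; rewrite -colE !mxE.
Qed.

(** [Q] makes the unit normal at [u0] vertical. The vertical column of the rotated Jacobian then
    vanishes at [u0], so the horizontal projection [F] is locally invertible; [f] is the height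
    composed with its inverse, and its gradient vanishes because the tangent space is horizontal. *)
Lemma local_graph (U : set 'rV[R]_n) (X : 'rV[R]_n -> 'rV[R]_n.+1) u0 :
  open U -> U u0 -> smooth_on U X -> (forall u, U u -> row_free ('J X u)) ->
  exists (Q : 'M[R]_n.+1) (V : set 'rV[R]_n) (r : R) (f : 'rV[R]_n -> R),
    let F u := X u *m Q *m forget_mx in
    [/\ Q *m Q^T = 1%:M, [/\ open V, V u0, V `<=` U & 0 < r],
       [/\ F @` V = ball (F u0) r, forall u, V u -> 'J F u \in unitmx,
           smooth_on (ball (F u0) r) f &
           forall i, partial i f (F u0) = 0] &
       forall u, V u -> X u *m Q = graph_map i0 f (F u)].
Proof.
move=> oU Uu0 sX fX.
have dX u : U u -> differentiable X u by exact: (sX 1%N).1.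
have [N NN NJ] := unit_normal ('J X u0) (ltnSn n).
have ee : dotv (delta_mx 0 i0 : 'rV[R]_n.+1) (delta_mx 0 i0) = 1.
  rewrite /dotv (bigD1 i0)//= big1 => [|k ki]; rewrite !mxE !eqxx /=.
    by rewrite mulr1 addr0.
  by rewrite (negbTE ki) mul0r.
have [Q QQ NQ] := householder NN ee.
have [uQ _] := orthogonal_unitmx QQ.
pose X1 w := X w *m Q; have sX1 : smooth_on U X1 by exact: smooth_mulmxr.
have dX1 u : U u -> differentiable X1 u by exact: (sX1 1%N).1.
have JX1 u : U u -> 'J X1 u = 'J X u *m Q by move=> /dX; exact: jacobian_mulmxr.
have col0 : 'J X1 u0 *m delta_mx i0 (0 : 'I_1) = 0.
  rewrite JX1// -trmx_delta -NQ trmx_mul !mulmxA -(mulmxA _ Q) QQ mulmx1.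
  by apply: (can_inj trmxK); rewrite trmx_mul trmxK NJ trmx0.
pose F w := X1 w *m forget_mx; have sF : smooth_on U F by exact: smooth_mulmxr.
have JF u : U u -> 'J F u = 'J X1 u *m forget_mx.
  by move=> /dX1; exact: jacobian_mulmxr.
have uJF : 'J F u0 \in unitmx.
  apply: unitmx_inj => v; rewrite JF// mulmxA => v1.
  have : v *m 'J X1 u0 = 0.
    by apply: forget_mx_eq0 => //; rewrite -mulmxA col0 mulmx0.
  rewrite JX1// mulmxA => v2; have : v *m 'J X u0 = 0.
    by apply: (can_inj (mulmxK uQ)); rewrite v2 mul0mx.
  by move/eqP; rewrite mulmx_free_eq0 ?fX// => /eqP.
have [V [r [G [[oV Vu0 VU r0] FV GF uV sG]]]] := inverse_function oU Uu0 sF uJF.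
have oB : open (ball (F u0) r) by exact: ball_open.
have GV y : ball (F u0) r y -> V (G y).
  by rewrite -FV => -[u Vu <-]; rewrite GF.
pose f y := X1 (G y) 0 i0.
have sf : smooth_on (ball (F u0) r) f.
  move=> k; apply: (@Ck_on_compR _ k _ _ _ V G (fun w => X1 w 0 i0)) => //.
  by apply: Ck_on_sub VU _; exact: ((Ck_on_mxP _ _ oU).1 (sX1 k)).
have XG u : V u -> X1 u = graph_map i0 f (F u).
  move=> Vu; apply/rowP => k; rewrite [RHS]mxE.
  by have [j ->|->] := unliftP i0 k; [rewrite mul_forget_mx|rewrite /f GF].
exists Q, V, r, f; split => //; split => // i.
have B0 : ball (F u0) r (F u0) by exact: ballxx.
have nV : nbhs u0 V by exact: open_nbhs_nbhs.
have dF : differentiable F u0 by exact: (sF 1%N).1.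
have dg : differentiable (graph_map i0 f) (F u0).
  exact: (smooth_graph_map i0 oB sf 1).1.
have E : 'J X1 u0 = 'J F u0 *m 'J (graph_map i0 f) (F u0).
  exact: (jacobian_eq_comp oV).
have : 'J (graph_map i0 f) (F u0) *m delta_mx i0 (0 : 'I_1) = 0.
  by apply: (can_inj (mulKmx uJF)); rewrite mulmx0 mulmxA -E.
rewrite -colE => /colP/(_ i); rewrite mxE [RHS]mxE.
by rewrite (jacobian_graph_map i0 oB sf i B0).2.
Qed.

(** The two Laplace maps differ by the coordinate change [F] and the rotation [Q^T], so their
    Jacobians differ by invertible factors. *)
Lemma rank_laplace_graph (V : set 'rV[R]_n) (X : 'rV[R]_n -> 'rV[R]_n.+1)
    (F : 'rV[R]_n -> 'rV[R]_n) (B : set 'rV[R]_n) (f : 'rV[R]_n -> R)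
    (Q : 'M[R]_n.+1) u :
  open V -> open B -> smooth_on V X -> smooth_on V F -> smooth_on B f ->
  Q *m Q^T = 1%:M -> (forall w, V w -> B (F w)) ->
  (forall w, V w -> 'J F w \in unitmx) ->
  (forall w, V w -> X w *m Q = graph_map i0 f (F w)) -> V u ->
  \rank ('J (laplace_form (graph_map i0 f)) (F u)) = \rank ('J (laplace_form X) u).
Proof.
move=> oV oB sX sF sf QQ VB uF XG Vu; have [uQ QQ'] := orthogonal_unitmx QQ.
pose LG := laplace_form (graph_map i0 f).
have nV : nbhs u V by exact: open_nbhs_nbhs.
have LE w : V w -> laplace_form X w = LG (F w) *m Q^T.
  move=> Vw; apply: (can_inj (mulmxK uQ)).
  have E (v : 'rV[R]_n.+1) : v *m Q^T *m Q = v by rewrite -mulmxA QQ' mulmx1.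
  apply: etrans _ (esym (E _)).
  apply: etrans (esym (laplace_form_rigid 0 oV Vw sX QQ)) _.
  apply: (@laplace_form_comp _ _ _ V B F) => //.
  - exact: smooth_graph_map.
  - by move=> z Vz; rewrite addr0 XG.
  - exact: uF.
  - by apply: (row_free_jacobian_graph i0 oB sf); exact: VB.
have dF : differentiable F u by exact: (sF 1%N).1.
have BF : B (F u) by exact: VB.
have nB : nbhs (F u) B by exact: open_nbhs_nbhs.
have dLG : differentiable LG (F u).
  apply: near_eq_differentiable (differentiable_graph_curv_normal i0 oB sf BF).
  by apply: filterS nB => w Bw; rewrite /LG (laplace_form_graph i0 oB sf Bw).
have dLF : differentiable (LG \o F) u by exact: differentiable_comp.
have E : 'J (laplace_form X) u = 'J F u *m 'J LG (F u) *m Q^T.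
  apply: etrans (congr1 (mulmxr Q^T) (jacobian_comp dF dLG)).
  apply: etrans (jacobian_mulmxr _ dLF); apply: near_eq_jacobian.
    by apply: filterS nV => w Vw; rewrite LE.
  exact: differentiable_mulmxr.
apply: etrans _ (esym (congr1 (fun M => \rank M) E)); apply/esym.
by apply: mxrank_unit_conj; rewrite ?unitmx_tr//; exact: uF.
Qed.

End LocalGraph.

(** * Arclength coordinates *)

Section LocalCylinder.
Context {R : realType}.

Lemma open_cap_preimage (V W : normedModType R) (A : set V) (B : set W) (f : V -> W) :
  open A -> open B -> Ck_on 0 A f -> open (A `&` f @^-1` B).
Proof.
move=> oA oB cf; rewrite openE => u [Au Bfu]; apply: filterI.
  exact: open_nbhs_nbhs.
by apply: (cf u Au); exact: open_nbhs_nbhs.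
Qed.

Lemma derive_R (s : R -> R) t v : differentiable s t -> 'D_v s t = v * 'D_1 s t.
Proof.
move=> ds; rewrite !(deriveE _ ds).
by have := linearZZ ('d s t) v (1 : R); rewrite -[v *: (1 : R)]/(v * 1) mulr1 => ->.
Qed.

(** Balls are taken in the sup norm, which Euclidean length dominates; this keeps lines with a
    Euclidean unit direction inside the balls used below. *)
Lemma unit_norm_le1 n (a : 'rV[R]_n) : dotv a a = 1 -> `|a| <= 1.
Proof.
move=> aa; apply/rV_norm_le => // j.
rewrite -(ler_pXn2r (_ : 0 < 2)%N) ?nnegrE// expr1n -aa real_normK ?num_real//.
by rewrite /dotv (bigD1 j)//= expr2 lerDl sumr_ge0// => i _; rewrite -expr2 sqr_ge0.
Qed.

Lemma smooth_line n (y0 a : 'rV[R]_n) (c : R) (A : set R) : open A ->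
  smooth_on A (fun t => y0 + (t - c) *: a).
Proof.
move=> oA k; apply/(Ck_on_mxP _ _ oA) => i j; rewrite (ord1 i).
rewrite (_ : (fun t => _) = fun t : R => y0 0 j + (t - c) * a 0 j).
  apply: Ck_onD => //; first exact: Ck_on_cst.
  apply: Ck_onM => //; last exact: Ck_on_cst.
  by apply: Ck_onB => //; [exact: Ck_on_id|exact: Ck_on_cst].
by apply/funext => t; rewrite !mxE.
Qed.

Lemma ball_line n (y0 a : 'rV[R]_n) (c t r : R) : `|a| <= 1 -> ball c r t ->
  ball y0 r (y0 + (t - c) *: a).
Proof.
move=> a1; rewrite -!ball_normE /ball_/= => H.
rewrite opprD addrA subrr add0r normrN normrZ distrC.
by apply: le_lt_trans H; rewrite ler_piMr.
Qed.

Lemma derive_pos_inj (s : R -> R) c r :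
  (forall t, ball c r t -> differentiable s t) ->
  (forall t, ball c r t -> 0 < 'D_1 s t) ->
  forall t t', ball c r t -> ball c r t' -> s t = s t' -> t = t'.
Proof.
move=> ds Ds t t' Bt Bt' st; apply/eqP; rewrite eq_sym -subr_eq0.
have [x x01|x /andP[x0 x1]] := @mean_value1 _ _ s t t'.
  by apply: ds; exact: ball_segment.
have Bx : ball c r (t + x *: (t' - t)) by apply: ball_segment => //; rewrite !ltW.
rewrite st subrr derive_R; last exact: ds.
by move=> /esym/eqP; rewrite mulf_eq0 (gt_eqF (Ds _ Bx)) orbF.
Qed.

(** Index 1 for the vertical coordinate: with index 0 it spans the plane of the curve in
    [hypercylinder]. *)
Let i0 m : 'I_(2 + m) := lift ord0 ord0.

(** The graph of [phi] reparametrized by [tau], meant to be the inverse of the arclength. *)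
Definition planar_curve (tau phi : R -> R) (t : R) : 'rV[R]_2 :=
  \row_j (if j == 0 then tau t else phi (tau t)).

(** Differentiating s (tau t) = t gives tau' s' = 1, while s'^2 = 1 + phi'^2; hence tau'^2 (1 +
    phi'^2) = 1. *)
Lemma planar_curve_arc (I : set R) (B : set R) (tau phi s : R -> R) :
  open I -> open B -> smooth_on I tau -> smooth_on B phi -> smooth_on B s ->
  (forall t, I t -> B (tau t)) -> (forall t, I t -> s (tau t) = t) ->
  (forall t, B t -> 'D_1 s t = Num.sqrt (1 + ('D_1 phi t) ^+ 2)) ->
  smooth_on I (planar_curve tau phi) /\
  forall t, I t -> dotv (derive1n 1 (planar_curve tau phi) t)
                        (derive1n 1 (planar_curve tau phi) t) = 1.
Proof.
move=> oI oB stau sphi ss IB sK Ds.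
have sb : smooth_on I (planar_curve tau phi).
  move=> k; apply/(Ck_on_mxP _ _ oI) => i j; rewrite (ord1 i).
  have [j0|j0] := eqVneq j 0.
    rewrite (_ : (fun u => _) = tau) //.
    by apply/funext => t; rewrite mxE j0 eqxx.
  rewrite (_ : (fun u => _) = phi \o tau).
    exact: (@Ck_on_comp1 _ _ _ I B).
  by apply/funext => t; rewrite mxE (negbTE j0).
split => // t It; have dt : differentiable tau t by exact: (stau 1%N).1.
have Bt := IB t It.
have dphi : differentiable phi (tau t) by exact: (sphi 1%N).1.
have ds : differentiable s (tau t) by exact: (ss 1%N).1.
have db : differentiable (planar_curve tau phi) t by exact: (sb 1%N).1.
have b0 : derive1n 1 (planar_curve tau phi) t 0 0 = 'D_1 tau t.
  rewrite (derive1nD 0) /=; apply: etrans (derive_coord _ _ _ db) _.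
  by congr ('D_1 _ t); apply/funext => u; rewrite mxE eqxx.
have b1 : derive1n 1 (planar_curve tau phi) t 0 1 = 'D_1 tau t * 'D_1 phi (tau t).
  rewrite (derive1nD 0) /=; apply: etrans (derive_coord _ _ _ db) _.
  apply: etrans _ (derive_comp1 (1 : R) dt dphi).
  by congr ('D_1 _ t); apply/funext => u; rewrite mxE.
have E : 'D_1 tau t * 'D_1 s (tau t) = 1.
  apply: etrans (esym (derive_comp1 (1 : R) dt ds)) _.
  have nI : nbhs t I by exact: open_nbhs_nbhs.
  transitivity ('D_1 (id : R -> R) t); last exact: derive_id.
  by apply: near_eq_derive; apply: filterS nI => u Iu; rewrite /= sK.
rewrite /dotv big_ord_recl big_ord1 (_ : lift ord0 ord0 = 1); last exact: val_inj.
rewrite b0 b1.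
have alg (a p d : R) : a * d = 1 -> d ^+ 2 = 1 + p ^+ 2 -> a * a + a * p * (a * p) = 1.
  move=> ad d2; transitivity (a * a * (1 + p ^+ 2)); first by ring.
  by rewrite -d2; transitivity ((a * d) ^+ 2); [ring|rewrite ad expr1n].
apply: (alg _ _ _ E); apply: etrans (congr1 (fun z => z ^+ 2) (Ds _ Bt)) _.
by rewrite sqr_sqrtr// addr_ge0 ?sqr_ge0.
Qed.

(** [Q] rotates the coordinates other than [i0] by [Rm] and fixes that one; its orthogonality rests
    on the splitting P P^T + E = 1. *)
Lemma cylinder_rotation m (Rm : 'M[R]_(1 + m)) : Rm *m Rm^T = 1%:M ->
  let Q := forget_mx (i0 m) *m Rm *m (forget_mx (i0 m))^T + delta_mx (i0 m) (i0 m) in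
  Q *m Q^T = 1%:M /\ forall x : 'rV[R]_(2 + m),
    (forall j, (x *m Q) 0 (lift (i0 m) j) = (x *m forget_mx (i0 m) *m Rm) 0 j) /\
    (x *m Q) 0 (i0 m) = x 0 (i0 m).
Proof.
move=> RR; set P := forget_mx (i0 m); set E := delta_mx _ _.
have PE : P^T *m E = 0.
  apply/matrixP => j k; rewrite mxE (bigD1 (i0 m))//= big1 => [|l li].
    by rewrite addr0 mxE mxE (negbTE (neq_lift _ _)) mul0r mxE.
  by rewrite [E l k]mxE (negbTE li) mulr0.
have ET : E^T = E by rewrite /E trmx_delta.
have EP : E *m P = 0 by apply: (can_inj trmxK); rewrite trmx_mul ET PE trmx0.
have EE : E *m E = E by rewrite /E mul_delta_mx.
have PPE : P *m P^T + E = 1%:M.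
  apply/matrixP => a b; rewrite mxE [E a b]mxE [RHS]mxE mxE.
  have [j ->|->] := unliftP (i0 m) a.
    rewrite (bigD1 j)//= big1 ?addr0 => [|l lj]; last first.
      by rewrite mxE (inj_eq (@lift_inj _ _)) eq_sym (negbTE lj) mul0r.
    rewrite !mxE eqxx mul1r eq_sym (eq_sym (lift _ _) (i0 m)).
    by rewrite (negbTE (neq_lift _ _)) addr0.
  rewrite big1 ?add0r => [|l _]; first by rewrite eqxx eq_sym.
  by rewrite mxE (negbTE (neq_lift _ _)) mul0r.
have PP : P^T *m P = 1%:M by exact: forget_mxK.
split.
  rewrite linearD /= ET !trmx_mul trmxK mulmxDl !mulmxDr EE.
  rewrite -!mulmxA (mulmxA E P) EP mul0mx add0r.
  rewrite PE !mulmx0 addr0 (mulmxA P^T P) PP mul1mx (mulmxA Rm) RR mul1mx.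
  by rewrite PPE.
move=> x; rewrite mulmxDr !mulmxA; move: (x *m P *m Rm) => y; split=> [j|].
  rewrite mxE -[X in _ + X]/((x *m delta_mx _ _) 0 _) [X in _ + X]mxE big1 => [|k _].
    rewrite addr0 mxE (bigD1 j)//= big1 => [|l lj]; rewrite !mxE.
      by rewrite eqxx mulr1 addr0.
    by rewrite (inj_eq (@lift_inj _ _)) eq_sym (negbTE lj) mulr0.
  rewrite mxE (_ : (lift (i0 m) j == i0 m) = false) ?andbF ?mulr0//.
  by rewrite eq_sym (negbTE (neq_lift _ _)).
rewrite mxE mxE big1 ?add0r => [|l _]; last first.
  by rewrite !mxE (negbTE (neq_lift _ _)) mulr0.
rewrite mxE (bigD1 (i0 m))//= big1 ?addr0 => [|k ki]; first by rewrite mxE !eqxx mulr1.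
by rewrite mxE (negbTE ki) mulr0.
Qed.

End LocalCylinder.

(** * Hypercylinder coordinates around a point *)

Section LocalTheorem.
Context {R : realType}.
Variable m : nat.
Let n := (1 + m)%N.
Let i0 : 'I_n.+1 := lift ord0 ord0.

(* On the graph of phi(y . a), the coordinates are the arclength of the profile
   curve and the remaining coordinates in a basis starting with a. *)
Lemma graph_arclength (V : set 'rV[R]_n) (F : 'rV[R]_n -> 'rV[R]_n) u0 rho
    (f : 'rV[R]_n -> R) (a : 'rV[R]_n) :
  open V -> V u0 -> smooth_on V F -> (forall u, V u -> 'J F u \in unitmx) ->
  (forall u, V u -> ball (F u0) rho (F u)) -> 0 < rho ->
  smooth_on (ball (F u0) rho) f -> dotv a a = 1 ->
  (forall y z, ball (F u0) rho y -> ball (F u0) rho z ->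
     dotv a y = dotv a z -> f y = f z) ->
  exists (Q : 'M[R]_n.+1) (I : set R) (beta : R -> 'rV[R]_2)
    (Psi G : 'rV[R]_n -> 'rV[R]_n) (V' : set 'rV[R]_n) (r : R),
    [/\ [/\ Q *m Q^T = 1%:M, open I, is_interval I, smooth_on I beta &
           forall s, I s -> dotv (derive1n 1 beta s) (derive1n 1 beta s) = 1],
        [/\ open V', V' u0, V' `<=` V, smooth_on V' Psi &
            forall u, V' u -> 'J Psi u \in unitmx],
        [/\ Psi @` V' = ball (Psi u0) r, smooth_on (ball (Psi u0) r) G &
            forall u, V' u -> G (Psi u) = u],
        (forall s, I s -> exists2 u, V' u & Psi u 0 0 = s) &
        forall u, V' u -> I (Psi u 0 0) /\
          graph_map i0 f (F u) *m Q = hypercylinder beta (Psi u)].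
Proof.
move=> oV Vu0 sF uF VB rho0 sf aa fE.
pose e0 : 'rV[R]_n := delta_mx 0 0.
have ee : dotv e0 e0 = 1.
  rewrite /dotv (bigD1 0)//= big1 => [|k k0]; rewrite !mxE !eqxx /=.
    by rewrite mulr1 addr0.
  by rewrite (negbTE k0) mul0r.
have [Rm RR aR] := householder aa ee.
have [uR RR'] := orthogonal_unitmx RR.
have [QQ QE] := cylinder_rotation RR.
set Q := (X in X *m _ = _) in QQ QE.
set y0 := F u0; pose t0 := dotv a y0.
have a1 : `|a| <= 1 by exact: unit_norm_le1.
have e1 : `|e0| <= 1 by exact: unit_norm_le1.
(* The first coordinate of [Y u] is [dotv a (F u)], the only variable on which [f] depends. *)
pose Y u := F u *m Rm.
have sY : smooth_on V Y by exact: smooth_mulmxr.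
have dF u : V u -> differentiable F u by exact: (sF 1%N).1.
have dY u : V u -> differentiable Y u by exact: (sY 1%N).1.
have uY u : V u -> 'J Y u \in unitmx.
  move=> Vu; rewrite (_ : 'J Y u = 'J F u *m Rm) ?unitmx_mul ?uF//.
  by apply: jacobian_mulmxr; exact: dF.
have Y0 u : Y u 0 0 = dotv a (F u).
  have -> : dotv a (F u) = dotv (F u) a by apply: eq_bigr => l _; rewrite mulrC.
  have -> : a = e0 *m Rm^T by rewrite -aR -mulmxA RR mulmx1.
  by rewrite dotvE trmx_mul trmxK mulmxA trmx_delta -colE [RHS]mxE.
have a_line t : dotv a (y0 + (t - t0) *: a) = t.
  have -> : dotv a (y0 + (t - t0) *: a) = t0 + (t - t0) * dotv a a.
    rewrite /t0 /dotv mulr_sumr -big_split /=; apply: eq_bigr => l _.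
    by rewrite !mxE; ring.
  by rewrite aa mulr1 addrC subrK.
have oBr (r : R) : open (ball t0 r) by exact: ball_open.
(* The profile is read on the line through [y0] directed by [a]; the shift by [t0] makes the
   parameter equal to the value of [dotv a]. *)
pose phi t := f (y0 + (t - t0) *: a).
have sphi : smooth_on (ball t0 rho) phi.
  move=> k; apply: (@Ck_on_compR _ k _ _ _ (ball y0 rho)
    (fun t => y0 + (t - t0) *: a) f) => //; last exact: smooth_line.
  by move=> t; exact: ball_line.
have phiE u : V u -> ball t0 rho (Y u 0 0) -> phi (Y u 0 0) = f (F u).
  move=> Vu Bu; apply: fE; [exact: ball_line|exact: VB|].
  by rewrite a_line Y0.
pose g t := Num.sqrt (1 + ('D_1 phi t) ^+ 2).
have g0 t : 0 < 1 + ('D_1 phi t) ^+ 2 by rewrite ltr_pwDl// sqr_ge0.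
have sg : smooth_on (ball t0 rho) g.
  move=> k; apply: Ck_on_sqrt => //; apply: Ck_onD => //; first exact: Ck_on_cst.
  have Dphi : Ck_on k (ball t0 rho) ('D_1 phi) by have [_] := sphi k.+1; apply.
  rewrite (_ : (fun t => _) = fun t => 'D_1 phi t * 'D_1 phi t) //.
  exact: Ck_onM.
have [s ss Ds] := smooth_primitive rho0 sg.
set B2 := ball t0 (rho / 2) in ss Ds.
have oB2 : open B2 by exact: ball_open.
have B2S : B2 `<=` ball t0 rho by move=> t; apply: le_ball; lra.
have ds t : B2 t -> differentiable s t by exact: (ss 1%N).1.
have Ds0 t : B2 t -> 0 < 'D_1 s t by move=> /Ds ->; rewrite sqrtr_gt0.
have sinj := derive_pos_inj ds Ds0.
have sYj j : smooth_on V (fun u => Y u 0 j).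
  by move=> k; exact: ((Ck_on_mxP _ _ oV).1 (sY k)).
(* The primitive [s] of the speed is known to be smooth only on the half-size ball [B2]. *)
pose V3 := V `&` (fun u => Y u 0 0) @^-1` B2.
have oV3 : open V3 by apply: open_cap_preimage => //; exact: (sYj 0 0%N).
have V3V : V3 `<=` V by move=> u [].
have V3u0 : V3 u0.
  by split => //=; rewrite Y0; apply: ballxx; rewrite divr_gt0.
(* [Y u] with its first coordinate replaced by the arclength. *)
pose Psi u : 'rV[R]_n := row_mx (s (Y u 0 0))%:M (rsubmx (Y u : 'rV[R]_(1 + m))).
have Psi0 u : Psi u 0 0 = s (Y u 0 0).
  transitivity (Psi u 0 (lshift m (0 : 'I_1))).
    by congr (Psi u 0 _); exact: val_inj.
  by rewrite row_mxEl [LHS]mxE eqxx mulr1n.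
have Psir u j : Psi u 0 (rshift 1 j) = Y u 0 (rshift 1 j).
  by rewrite row_mxEr mxE.
have sPsi : smooth_on V3 Psi.
  move=> k; apply/(Ck_on_mxP _ _ oV3) => i j; rewrite (ord1 i).
  have CY l : Ck_on k V3 (fun u => Y u 0 l) by apply: Ck_on_sub V3V (sYj l k).
  case: (@splitP 1 m j) => b jb.
    have -> : j = 0 by apply: val_inj; rewrite /= jb ord1.
    under eq_fun do rewrite Psi0.
    apply: (@Ck_on_comp1 _ k _ V3 B2 (fun u => Y u 0 0) s) => //.
    by move=> u [].
  have -> : j = rshift 1 b by exact: val_inj.
  by under eq_fun do rewrite Psir.
have dPsi u : V3 u -> differentiable Psi u by exact: (sPsi 1%N).1.
have dYj u j : V u -> differentiable (fun u => Y u 0 j) u by exact: (sYj j 1%N).1.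
have uPsi u : V3 u -> 'J Psi u \in unitmx.
  move=> V3u; have [Vu B2u] := V3u; apply: unitmx_inj => v vJ.
  have D0 : 'D_v Psi u = 0 by rewrite deriveEjacobian//; exact: dPsi.
  have D0j j : 'D_v (fun u => Psi u 0 j) u = 0.
    by apply: etrans (esym (derive_coord v 0 j (dPsi u V3u))) _; rewrite D0 mxE.
  have : v *m 'J Y u = 0.
    rewrite -deriveEjacobian; last exact: dY.
    apply/rowP => j; apply: etrans (derive_coord v 0 j (dY u Vu)) _; rewrite mxE.
    case: (@splitP 1 m j) => b jb.
      have -> : j = 0 by apply: val_inj; rewrite /= jb ord1.
      have := D0j 0; under eq_fun do rewrite Psi0.
      move=> H; have := etrans (esym (derive_comp1 v (dYj u 0 Vu) (ds _ B2u))) H.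
      by move/eqP; rewrite mulf_eq0 (gt_eqF (Ds0 _ B2u)) orbF => /eqP.
    have -> : j = rshift 1 b by exact: val_inj.
    by have := D0j (rshift 1 b); under eq_fun do rewrite Psir.
  by move=> vY; apply: (can_inj (mulmxK (uY u Vu))); rewrite vY mul0mx.
have [V' [r [G [[oV' V'u0 V'V3 r0] PV GP uPsi' sG]]]] :=
  inverse_function oV3 V3u0 sPsi (uPsi u0 V3u0).
set w0 := Psi u0 in PV sG; pose c := w0 0 0.
pose wl t := w0 + (t - c) *: e0.
pose I := ball c r.
have oI : open I by exact: ball_open.
have oBw : open (ball w0 r) by exact: ball_open.
have Iwl t : I t -> ball w0 r (wl t) by exact: ball_line.
have wl0 t : wl t 0 0 = t.
  rewrite mxE [X in _ + X]mxE [X in _ + _ * X]mxE !eqxx mulr1 -/c.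
  by rewrite addrC subrK.
have GV' w : ball w0 r w -> V' (G w) /\ Psi (G w) = w.
  by rewrite -PV => -[u V'u <-]; rewrite GP.
(* The inverse of [s] comes from the inverse [G] of [Psi], along the line [wl] on which only the
   arclength varies. *)
pose tau t := Y (G (wl t)) 0 0.
have IB2 t : I t -> B2 (tau t).
  by move=> /Iwl/GV' [/V'V3 [_]].
have stau t : I t -> s (tau t) = t.
  by move=> /Iwl/GV' [_ E]; rewrite /tau -Psi0 E wl0.
have smtau : smooth_on I tau.
  move=> k; apply: (@Ck_on_compR _ k _ _ I (ball w0 r) wl
    (fun w => Y (G w) 0 0)) => //; first exact: smooth_line.
  apply: (@Ck_on_compR _ k _ _ (ball w0 r) V' G (fun u => Y u 0 0)) => //.
    by move=> w /GV' [].
  by apply: Ck_on_sub (sYj 0 k) => u /V'V3 [].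
have sphi2 : smooth_on B2 phi by move=> k; apply: Ck_on_sub B2S (sphi k).
have [sb arc] := planar_curve_arc oI oB2 smtau sphi2 ss IB2 stau Ds.
have PB u : V' u -> ball w0 r (Psi u) by move=> V'u; rewrite -PV; exists u.
have PI u : V' u -> I (Psi u 0 0).
  move=> /PB; rewrite -!ball_normE /ball_/= => H; apply: le_lt_trans H.
  by have := coord_le_norm (w0 - Psi u) 0; rewrite mxE [X in _ + X]mxE.
have tauE u : V' u -> tau (Psi u 0 0) = Y u 0 0.
  move=> V'u; have Iu := PI u V'u; apply: sinj; first exact: IB2.
    by have [] := V'V3 _ V'u.
  by rewrite stau// Psi0.
exists Q, I, (planar_curve tau phi), Psi, G, V', r; split.
- split => //; move=> x y; rewrite /I -!ball_normE /ball_/= => Bx By z.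
  by move: Bx By; rewrite !ltr_distl; lra.
- split => //; first by move=> u /V'V3 [].
  by move=> k; apply: Ck_on_sub V'V3 (sPsi k).
- by split.
- by move=> t /Iwl/GV' [V'G E]; exists (G (wl t)) => //; rewrite E wl0.
move=> u V'u; split; first exact: PI.
have V3u := V'V3 _ V'u; have [Vu B2u] := V3u.
have [QE1 QE2] := QE (graph_map i0 f (F u)).
have gF : graph_map i0 f (F u) *m forget_mx i0 = F u.
  by apply/rowP => j; rewrite mul_forget_mx mxE liftK.
rewrite gF -/(Y u) in QE1.
have gi : graph_map i0 f (F u) 0 i0 = f (F u) by rewrite mxE unlift_none.
rewrite gi in QE2.
move: (_ *m Q) QE1 QE2 => x x1 x2; apply/rowP => k.
rewrite /hypercylinder; case: (@splitP 2 m k) => b kb.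
  have -> : k = lshift m b by exact: val_inj.
  apply: etrans _ (esym (row_mxEl _ _ _ _)); rewrite mxE tauE//.
  have [b0|b1] := eqVneq b 0.
    by rewrite -x1 b0; congr (x 0 _); exact: val_inj.
  rewrite phiE//; last exact: B2S.
  rewrite -x2; congr (x 0 _); apply: val_inj => /=.
  by case: b b1 {kb} => -[|[|]].
have -> : k = rshift 2 b by exact: val_inj.
apply: etrans _ (esym (row_mxEr _ _ _ _)); rewrite mxE Psir -x1.
by congr (x 0 _); exact: val_inj.
Qed.

Theorem local_cylinder (U : set 'rV[R]_n) (X : 'rV[R]_n -> 'rV[R]_n.+1) u0 :
  open U -> U u0 -> smooth_on U X -> (forall u, U u -> row_free ('J X u)) ->
  (forall u, U u -> \rank ('J (laplace_form X) u) = 1%N) ->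
  exists (Q : 'M[R]_(2 + m)) (I : set R) (beta : R -> 'rV[R]_2)
    (Psi G : 'rV[R]_n -> 'rV[R]_n) (V : set 'rV[R]_n) (r : R),
    [/\ Q *m Q^T = 1%:M, three_regular I beta,
        [/\ open V, V u0, V `<=` U & smooth_on V Psi],
        [/\ Psi @` V = ball (Psi u0) r, smooth_on (ball (Psi u0) r) G &
            forall u, V u -> G (Psi u) = u] &
        forall u, V u -> I (Psi u 0 0) /\ X u = hypercylinder beta (Psi u) *m Q].
Proof.
move=> oU Uu0 sX fX rX.
have [Q1 [V1 [r1 [f]]]] := local_graph i0 oU Uu0 sX fX.
set F := fun u => _.
move=> [QQ1 [oV1 V1u0 V1U r10] [FV uF sf df0] XG].
have [uQ1 QQ1'] := orthogonal_unitmx QQ1.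
set B1 := ball (F u0) r1 in FV sf.
have oB1 : open B1 by exact: ball_open.
have sF : smooth_on U F by do 2 apply: smooth_mulmxr => //.
have VB1 u : V1 u -> B1 (F u) by move=> V1u; rewrite -FV; exists u.
have sX1 : smooth_on V1 X by move=> k; apply: Ck_on_sub V1U (sX k).
have sF1 : smooth_on V1 F by move=> k; apply: Ck_on_sub V1U (sF k).
have rank1 y : B1 y -> \rank ('J (laplace_form (graph_map i0 f)) y) = 1%N.
  rewrite -FV => -[u V1u <-]; apply: etrans (rX u (V1U u V1u)).
  exact: (rank_laplace_graph oV1 oB1 sX1 sF1 sf QQ1 VB1 uF XG V1u).
have B1u0 : B1 (F u0) by exact: ballxx.
have [rho [a [rho0 BB aa fE]]] := graph_rank1_cylindrical oB1 sf rank1 B1u0 df0.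
pose V2 := V1 `&` F @^-1` ball (F u0) rho.
have oV2 : open V2.
  exact: (open_cap_preimage oV1 (@ball_open _ _ _ _) (sF1 0%N)).
have V2u0 : V2 u0 by split => //; exact: ballxx.
have sF2 : smooth_on V2 F by move=> k; apply: Ck_on_sub (sF1 k) => u [].
have uF2 u : V2 u -> 'J F u \in unitmx by move=> [/uF].
have VB2 u : V2 u -> ball (F u0) rho (F u) by move=> [].
have sf2 : smooth_on (ball (F u0) rho) f by move=> k; apply: Ck_on_sub BB (sf k).
have [Q2 [I [beta [Psi [G [V [r [[QQ2 oI iI sb arc] [oV Vu0 VV2 sPsi uPsi]
  [PV sG GP] IV XE]]]]]]]] :=
  graph_arclength oV2 V2u0 sF2 uF2 VB2 rho0 sf2 aa fE.
have [uQ2 QQ2'] := orthogonal_unitmx QQ2.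
(* [X u *m Q1 *m Q2] is the standard hypercylinder, so [X] is recovered by the transposes in reverse
   order. *)
pose Q := Q2^T *m Q1^T.
have QQ : Q *m Q^T = 1%:M.
  by rewrite /Q trmx_mul !trmxK mulmxA -(mulmxA _ Q1^T) QQ1' mulmx1.
have XQ u : V u -> X u = hypercylinder beta (Psi u) *m Q.
  move=> Vu; have [_ E] := XE u Vu; rewrite -{}E.
  have [V1u _] := VV2 u Vu; rewrite -(XG u V1u).
  by rewrite mulmxA -(mulmxA _ Q2) QQ2 mulmx1 -mulmxA QQ1 mulmx1.
have VU : V `<=` U by move=> u /VV2 [/V1U].
exists Q, I, beta, Psi, G, V, r; split => //.
(* Every [t] in [I] is the arclength coordinate of a point of [V], where rank one forces the third
   derivative of [beta] to be nonzero. *)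
- split => // t It; have [u Vu ut] := IV t It.
  have XQ0 w : V w -> X w = hypercylinder beta (Psi w) *m Q + 0.
    by move=> Vw; rewrite addr0; exact: XQ.
  have H := rank_laplace_cylinder oV oI sPsi sb arc uPsi
    (fun w Vw => (XE w Vw).1) QQ XQ0 Vu.
  have := etrans (esym H) (rX u (VU u Vu)).
  by rewrite ut; case: (derive1n 3 beta t != 0).
- by move=> u Vu; split; [exact: (XE u Vu).1|exact: XQ].
Qed.

End LocalTheorem.

(** * Charts and the global statement *)

Section SmoothLaplaceForm.
Context {R : realType}.

Lemma Ck_on_trmx k (V : normedModType R) p q (A : set V) (M : V -> 'M[R]_(p, q)) :
  open A -> Ck_on k A M -> Ck_on k A (fun u => (M u)^T).
Proof.
move=> oA /(Ck_on_mxP _ _ oA) HM; apply/(Ck_on_mxP _ _ oA) => i j.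
by rewrite (_ : (fun u => _) = fun u => M u j i) //; apply/funext => u; rewrite mxE.
Qed.

Lemma Ck_on_scalemx k (V : normedModType R) p q (A : set V) (f : V -> R)
    (M : V -> 'M[R]_(p, q)) : open A ->
  Ck_on k A f -> Ck_on k A M -> Ck_on k A (fun u => f u *: M u).
Proof.
move=> oA Hf /(Ck_on_mxP _ _ oA) HM; apply/(Ck_on_mxP _ _ oA) => i j.
rewrite (_ : (fun u => _) = fun u => f u * M u i j); first exact: Ck_onM.
by apply/funext => u; rewrite mxE.
Qed.

Lemma smooth_laplace_form n l (A : set 'rV[R]_n) (X : 'rV[R]_n -> 'rV[R]_l) :
  open A -> smooth_on A X -> (forall u, A u -> row_free ('J X u)) ->
  smooth_on A (laplace_form X).
Proof.
move=> oA sX fX k.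
have CJ : Ck_on k A (fun u => 'J X u) by exact: Ck_on_jacobian (sX k.+1).
have CJT := Ck_on_trmx oA CJ.
have CG : Ck_on k A (fun u => invmx ('J X u *m ('J X u)^T)).
  apply: Ck_on_invmx => //; last exact: Ck_on_mulmx.
  by move=> u Au; apply: gram_unitmx; exact: fX.
apply: Ck_onN => //; apply: Ck_on_mulmx => //.
  apply: Ck_on_sum => // i _; apply: Ck_on_sum => // j _.
  apply: Ck_on_scalemx => //; first exact: ((Ck_on_mxP _ _ oA).1 CG).
  by have [_ H] := smooth_partial sX j k.+1; exact: H.
apply: Ck_onB => //; first exact: Ck_on_cst.
by apply: Ck_on_mulmx => //; exact: Ck_on_mulmx.
Qed.

Lemma jacobian_left_inverse n (A : set 'rV[R]_n) (phi psi : 'rV[R]_n -> 'rV[R]_n)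
    u : open A -> A u -> differentiable phi u -> differentiable psi (phi u) ->
  (forall w, A w -> psi (phi w) = w) -> 'J phi u \in unitmx.
Proof.
move=> oA Au dphi dpsi K.
have E : 'J (id : 'rV[R]_n -> 'rV[R]_n) u = 'J phi u *m 'J psi (phi u).
  by apply: (jacobian_eq_comp oA) => // w Aw; rewrite K.
have J1 : 'J (id : 'rV[R]_n -> 'rV[R]_n) u = 1%:M.
  apply/row_matrixP => i.
  have d : differentiable (id : 'rV[R]_n -> 'rV[R]_n) u by [].
  by apply: etrans (row_jacobian i d) _; rewrite /partial derive_id row1.
by have [uP _] := mulmx1_unit (etrans (esym E) J1); exact: uP.
Qed.

End SmoothLaplaceForm.

(** * Chart overlaps and transition maps *)

Section Charts.
Context {R : realType} {M : topologicalType} {n : nat}.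
Implicit Types c d : chart R M n.

(** Within the open set [chart_img c] the image is the preimage of [A] under [chart_inv c], which is
    continuous there. *)
Lemma chart_image_open c (A : set M) : open A -> A `<=` chart_dom c ->
  open (chart_map c @` A).
Proof.
move=> oA Ac; rewrite openE => _ [p Ap <-].
have img : chart_img c (chart_map c p) by exists p => //; exact: Ac.
have nI : nbhs (chart_map c p) (chart_img c).
  by apply: open_nbhs_nbhs; split => //; exact: chart_img_open.
have nA : nbhs (chart_inv c (chart_map c p)) A.
  by rewrite chart_mapK; [exact: open_nbhs_nbhs|exact: Ac].
have := chart_inv_continuous img nA.
rewrite /= => H; apply: filterS (filterI nI H) => w [[q cq <-]] /=.
by rewrite chart_mapK// => Aq; exists q.
Qed.

Definition overlap c d := chart_map c @` (chart_dom c `&` chart_dom d).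

Lemma overlap_open c d : open (overlap c d).
Proof.
apply: chart_image_open; last by move=> p [].
by apply: openI; exact: chart_dom_open.
Qed.

Lemma overlap_img c d : overlap c d `<=` chart_img c.
Proof. by move=> _ [p [cp _] <-]; exists p. Qed.

Lemma transition_overlap c d u : overlap c d u -> overlap d c (transition c d u).
Proof. by move=> [p [cp dp] <-]; rewrite /transition /= chart_mapK//; exists p. Qed.

Lemma transitionK c d u : overlap c d u -> transition d c (transition c d u) = u.
Proof. by move=> [p [cp dp] <-]; rewrite /transition /= !chart_mapK. Qed.

Lemma transition_pull (T : Type) (f : M -> T) c d u : overlap c d u ->
  f (chart_inv c u) = f (chart_inv d (transition c d u)).
Proof. by move=> [p [cp dp] <-]; rewrite /transition /= !chart_mapK. Qed.

Lemma compatible_smooth c d : compatible c d ->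
  smooth_on (overlap c d) (transition c d) /\
  smooth_on (overlap d c) (transition d c).
Proof. by rewrite /compatible /overlap (setIC (chart_dom d)). Qed.

Lemma transition_unitmx c d u : compatible c d -> overlap c d u ->
  'J (transition c d) u \in unitmx.
Proof.
move=> /compatible_smooth [s1 s2] Ou.
apply: (@jacobian_left_inverse _ _ (overlap c d) _ (transition d c) _
  (@overlap_open c d) Ou).
- exact: (s1 1%N).1.
- by apply: (s2 1%N).1; exact: transition_overlap.
- by move=> w; exact: transitionK.
Qed.

Lemma chart_atP (S : smooth_structure R M n) p :
  atlas S (chart_at S p) /\ chart_dom (chart_at S p) p.
Proof. by rewrite /chart_at; case: cid2. Qed.

End Charts.

(** * The Laplace map of an isometric immersion read in a chart *)

Section Submanifold.
Context {R : realType} {M : topologicalType} {n k : nat}.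
Variables (S : smooth_structure R M n) (g : riemannian_metric S).
Variable x : M -> 'rV[R]_k.
Hypotheses (sx : smooth_map S x) (xisom : isometric g x).

Let X (c : chart R M n) := x \o chart_inv c.

Lemma img_open (c : chart R M n) : open (chart_img c).
Proof. exact: chart_img_open. Qed.

Lemma isometric_gram c u : atlas S c -> chart_img c u ->
  metric g c u = 'J (X c) u *m ('J (X c) u)^T.
Proof.
move=> Sc cu; have dX : differentiable (X c) u by exact: (sx Sc 1).1.
have dE v : 'd (X c) u v = v *m 'J (X c) u.
  by rewrite -deriveEjacobian// deriveE.
apply/matrixP => i j.
have := xisom Sc cu ('e_i) ('e_j); rewrite !dE => H.
transitivity (dotv ('e_i *m metric g c u) 'e_j).
  by rewrite dotvE trmx_delta -rowE -colE !mxE.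
by rewrite -H dotvE trmx_mul mulmxA -!mulmxA trmx_delta mulmxA -rowE mulmxA -colE mxE
   -row_mul mxE.
Qed.

(** A vector killed by the Jacobian would have length zero for the positive definite metric. *)
Lemma isometric_row_free c u : atlas S c -> chart_img c u ->
  row_free ('J (X c) u).
Proof.
move=> Sc cu; rewrite -kermx_eq0; apply/eqP/row_matrixP => i; rewrite row0.
have : row i (kermx ('J (X c) u)) *m 'J (X c) u = 0.
  by rewrite -row_mul mulmx_ker row0.
move: (row i _) => v vJ; apply/eqP; apply/negP => /negP v0.
have := @metric_pos _ _ _ _ g _ _ Sc cu v v0; rewrite isometric_gram// mulmxA vJ mul0mx.
by rewrite dotvE mul0mx mxE ltxx.
Qed.

(** [laplace_map] evaluates each point in the chart that [chart_at] picks there, a choice that may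
    jump from point to point; coordinate invariance turns it into one smooth formula on a whole
    chart, which can be differentiated. *)
Lemma laplace_map_chart c u : atlas S c -> chart_img c u ->
  laplace_map g x (chart_inv c u) = laplace_form (X c) u.
Proof.
move=> Sc cu; set p := chart_inv c u; set d := chart_at S p.
have [Sd dp] := chart_atP S p.
have cp : chart_dom c p by rewrite /p; case: cu => q cq <-; rewrite chart_mapK.
have uE : chart_map c p = u by rewrite /p; case: cu => q cq <-; rewrite chart_mapK.
have Ou : overlap c d u by exists p.
have dimg : chart_img d (chart_map d p) by exists p.
have L : laplace_map g x p = laplace_form (X d) (chart_map d p).
  apply: etrans (@laplace_form_hessian _ _ _ (chart_img d) (X d) (@img_open d)
    (sx Sd) (metric g d) (chart_map d p) _ dimg) => // w dw.
  exact: isometric_gram.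
rewrite L; apply/esym.
apply: (@laplace_form_comp _ _ _ (overlap c d) (chart_img d) (transition c d)).
- exact: overlap_open.
- exact: img_open.
- exact: Ou.
- by move=> w /transition_overlap; exact: overlap_img.
- by have [] := compatible_smooth (atlas_compatible Sc Sd).
- exact: sx.
- by move=> w Ow; exact: (transition_pull x Ow).
- exact: (transition_unitmx (atlas_compatible Sc Sd) Ou).
- exact: isometric_row_free.
Qed.

Lemma smooth_laplace_chart c : atlas S c ->
  smooth_on (chart_img c) (laplace_form (X c)).
Proof.
move=> Sc; apply: smooth_laplace_form; [exact: img_open|exact: sx|].
by move=> u; exact: isometric_row_free.
Qed.

(** [diff_rank] too is computed in the chosen chart [d]; passing to [c] multiplies the Jacobian by
    that of the transition map, which is invertible. *)
Lemma rank_laplace_chart c u : atlas S c -> chart_img c u ->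
  \rank ('J (laplace_form (X c)) u) =
  diff_rank S (laplace_map g x) (chart_inv c u).
Proof.
move=> Sc cu; rewrite /diff_rank; set p := chart_inv c u; set d := chart_at S p.
have [Sd dp] := chart_atP S p.
have cp : chart_dom c p by rewrite /p; case: cu => q cq <-; rewrite chart_mapK.
have uE : chart_map c p = u by rewrite /p; case: cu => q cq <-; rewrite chart_mapK.
have Ou : overlap c d u by exists p.
have dimg : chart_img d (chart_map d p) by exists p.
have cmp := atlas_compatible Sc Sd.
have [st _] := compatible_smooth cmp.
have dL : differentiable (laplace_form (X d)) (chart_map d p).
  exact: (smooth_laplace_chart Sd 1).1.
have dt : differentiable (transition c d) u by exact: (st 1%N).1.
have E1 : 'J (laplace_map g x \o chart_inv d) (chart_map d p) =
    'J (laplace_form (X d)) (chart_map d p).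
  have nI : nbhs (chart_map d p) (chart_img d).
    by apply: open_nbhs_nbhs; split => //; exact: img_open.
  apply: near_eq_jacobian dL; apply: filterS nI => w dw.
  by apply/esym; exact: laplace_map_chart.
have E2 : 'J (laplace_form (X c)) u =
    'J (transition c d) u *m 'J (laplace_form (X d)) (chart_map d p).
  apply: (jacobian_eq_comp (@overlap_open _ _ _ c d) Ou _ dt dL) => w Ow.
  apply: etrans (esym (laplace_map_chart Sc (overlap_img Ow))) _.
  apply: etrans _ (laplace_map_chart Sd (overlap_img (transition_overlap Ow))).
  exact: transition_pull.
apply: etrans (congr1 (fun N => \rank N) E2) _.
apply: etrans _ (esym (congr1 (fun N => \rank N) E1)).
rewrite -[_ *m _]mulmx1; apply: mxrank_unit_conj; last exact: unitmx1.
exact: transition_unitmx.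
Qed.

End Submanifold.

(** * The two implications *)

Section MainTheorem.
Context {R : realType} {M : topologicalType} {m : nat}.
Variables (S : smooth_structure R M m.+1) (g : riemannian_metric S).
Variable x : M -> 'rV[R]_m.+2.
Hypotheses (sx : smooth_map S x) (xisom : isometric g x).

(** The required chart is [Psi] after the chart at [p], with inverse [chart_inv c \o G]. Its image
    is a ball, and it is compatible with the atlas because it differs from [c] by the smooth maps
    [Psi] and [G]. *)
Lemma rank1_hypercylinder :
  (forall p : M, diff_rank S (laplace_map g x) p = 1%N) ->
  @locally_hypercylinder R M m S x.
Proof.
move=> rk p; set c := chart_at S p; have [Sc cp] := chart_atP S p.
set U := chart_img c; have oU : open U by exact: img_open.
have Up : U (chart_map c p) by exists p.
have rX u : U u -> \rank ('J (laplace_form (x \o chart_inv c)) u) = 1%N.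
  by move=> Uu; rewrite (rank_laplace_chart sx xisom Sc Uu).
have [Q [I [beta [Psi [G [V [r [QQ reg [oV Vp VU sPsi] [PV sG GP] XE]]]]]]]] :=
  @local_cylinder R m U (x \o chart_inv c) (chart_map c p) oU Up (sx Sc)
   (fun u Uu => isometric_row_free sx xisom Sc Uu) rX.
set y0 := Psi _ in PV sG.
have oB : open (ball y0 r) by exact: ball_open.
pose D := chart_dom c `&` chart_map c @^-1` V.
have oD : open D.
  rewrite openE => q [cq Vq]; apply: filterI.
    by apply: open_nbhs_nbhs; split => //; exact: chart_dom_open.
  by apply: (chart_map_continuous cq); exact: open_nbhs_nbhs.
have imgE : (Psi \o chart_map c) @` D = ball y0 r.
  rewrite -PV eqEsubset; split=> [_ [q [cq Vq] <-]|_ [u Vu <-]].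
    by exists (chart_map c q).
  have [q cq qu] := VU u Vu; exists q; last by rewrite /= qu.
  by split => //=; rewrite qu.
have GV y : ball y0 r y -> V (G y).
  by rewrite -PV => -[u Vu <-]; rewrite GP.
have oI : open ((Psi \o chart_map c) @` D) by rewrite imgE.
have mK q : D q -> (chart_inv c \o G) ((Psi \o chart_map c) q) = q.
  by move=> [cq Vq]; rewrite /= GP// chart_mapK.
have mC q : D q -> {for q, continuous (Psi \o chart_map c)}.
  move=> [cq Vq]; apply: continuous_comp; first exact: chart_map_continuous.
  exact: (sPsi 0%N).
have iC y : ((Psi \o chart_map c) @` D) y -> {for y, continuous (chart_inv c \o G)}.
  rewrite imgE => By; apply: continuous_comp; first exact: (sG 0%N).
  by apply: chart_inv_continuous; exact/VU/GV.
pose psi : chart R M (1 + m) := Chart oD oI mK mC iC.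
exists I, beta, (fun y => y *m Q), psi; split.
- exact: reg.
- by exists Q, 0; split => // y; rewrite addr0.
- move=> c' Sc'; have cmp := atlas_compatible Sc' Sc.
  have [s1 s2] := compatible_smooth cmp; split.
    move=> k; apply: (@Ck_on_comp _ k _ _ _ _ _ V (transition c' c) Psi).
    + by apply: chart_image_open; [exact: (openI (chart_dom_open c') oD)|move=> q []].
    + exact: oV.
    + by move=> _ [q [c'q [cq Vq]] <-]; rewrite /transition /= chart_mapK.
    + by apply: Ck_on_sub (s1 k) => _ [q [c'q [cq Vq]] <-]; exists q.
    + exact: sPsi.
  move=> k.
  apply: (@Ck_on_comp _ k _ _ _ _ _ (overlap c c') G (transition c c')).
  + apply: (@chart_image_open _ _ _ psi); last by move=> q [].
    exact: (openI (chart_dom_open c') oD).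
  + exact: overlap_open.
  + by move=> _ [q [c'q [cq Vq]] <-]; exists q => //=; rewrite GP.
  + by apply: Ck_on_sub (sG k) => _ [q [c'q Dq] <-]; rewrite -imgE; exists q.
  + exact: s2.
- by split.
- move=> q [cq Vq]; have [Iq E] := XE _ Vq; split; first exact: Iq.
  by rewrite -E /= chart_mapK.
Qed.

(** The transition map to [psi] serves as the coordinate change in [rank_laplace_cylinder], where
    3-regularity makes the boolean true. *)
Lemma hypercylinder_rank1 :
  @locally_hypercylinder R M m S x ->
  forall p : M, diff_rank S (laplace_map g x) p = 1%N.
Proof.
move=> H p; have [Sc cp] := chart_atP S p; move: (chart_at S p) Sc cp => c Sc cp.
have [I [beta [T [psi [[oI _ sb arc b3] [Q [b [QQ TE]]] cmp psip xE]]]]] := H p.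
have img : chart_img c (chart_map c p) by exists p.
have [s1 s2] := compatible_smooth (cmp c Sc).
have Op : overlap c psi (chart_map c p) by exists p.
have XE w : overlap c psi w -> I (transition c psi w 0 0) /\
    x (chart_inv c w) = hypercylinder beta (transition c psi w) *m Q + b.
  move=> [q [cq pq] <-]; rewrite /transition /= chart_mapK//.
  by have [Iq E] := xE q pq; split => //; rewrite E TE.
have rk := @rank_laplace_cylinder R m (overlap c psi) I beta (transition c psi)
  (x \o chart_inv c) Q b (chart_map c p) (@overlap_open _ _ _ c psi) oI s1 sb arc
  (fun w Ow => transition_unitmx (cmp c Sc) Ow)
  (fun w Ow => (XE w Ow).1) QQ (fun w Ow => (XE w Ow).2) Op.
have rc := rank_laplace_chart sx xisom Sc img.
have pE := congr1 (diff_rank S (laplace_map g x)) (chart_mapK cp).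
have b1 : (derive1n 3 beta (transition c psi (chart_map c p) 0 0) != 0) = true.
  exact: (b3 _ (XE _ Op).1).
exact: (etrans (esym (etrans rc pE)) (etrans rk (congr1 nat_of_bool b1))).
Qed.

End MainTheorem.

Theorem proposition2p3 (R : realType) (M : topologicalType) (m : nat)
    (S : smooth_structure R M m.+1) (g : riemannian_metric S)
    (x : M -> 'rV[R]_m.+2)
    (Mconn : connected [set: M])
    (ximm : immersion S x) (xisom : isometric g x) :
  (forall p : M, diff_rank S (laplace_map g x) p = 1%N) <->
  @locally_hypercylinder R M m S x.
Proof.
have [sx _] := ximm; split; first exact: rank1_hypercylinder.
exact: hypercylinder_rank1.
Qed.
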